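(* Let $\mu>0$, let $B=\{B_s\}_{s\ge 0}$ be a one-dimensional standard Brownian motion, and let $\gamma_\mu$ be a gamma random variable with parameter $\mu$. Suppose $B$ and $\gamma_\mu$ are independent. Then $$\left\{\mathbb{T}^*_{\log(2\gamma_\mu A^{(-\mu)}_\infty)}(B^{(-\mu)})(s)\right\}_{s\ge 0}\stackrel{(d)}{=}\left\{B^{(-\mu)}_s\right\}_{s\ge 0};$$ that is, the process $$B^{(-\mu)}_s-\log\left\{1+A^{(-\mu)}_s\left(2\gamma_\mu-\frac{1}{A^{(-\mu)}_\infty}\right)\right\},\quad s\ge 0,$$ is identical in law with $B^{(-\mu)}$.
   Context: $B^{(-\mu)}_s=B_s-\mu s$, $s\ge 0$. For $\phi\in C([0,\infty);\mathbb{R})$ put $A_s(\phi)=\int_0^s e^{2\phi_u}\,du$ and $A_\infty(\phi)=\lim_{s\to\infty}A_s(\phi)$; write $A^{(-\mu)}_s=A_s(B^{(-\mu)})$ and $A^{(-\mu)}_\infty=A_\infty(B^{(-\mu)})$, which is finite a.s. when $\mu>0$. For $z\in\mathbb{R}$ and $\phi\in C([0,\infty);\mathbb{R})$ with $A_\infty(\phi)<\infty$, $$\mathbb{T}^*_z(\phi)(s)=\phi_s-\log\left\{1+\frac{A_s(\phi)}{A_\infty(\phi)}(e^z-1)\right\},\quad s\ge 0,$$ and a random subscript means that its value is substituted for $z$. The gamma random variable has law $\mathbb{P}(\gamma_\mu\in du)=\frac{1}{\Gamma(\mu)}u^{\mu-1}e^{-u}\,du$, $u>0$. $\stackrel{(d)}{=}$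 denotes identity in law (of processes with paths in $C([0,\infty);\mathbb{R})$). Brownian motions start from $0$. *)

(* Defs.v *)
From HB Require Import structures.
From mathcomp Require Export all_boot all_order all_algebra.
From mathcomp Require Export all_classical all_reals all_analysis.
Export Order.TTheory GRing.Theory Num.Theory.
Export numFieldNormedType.Exports.

Set Implicit Arguments.
Unset Strict Implicit.
Unset Printing Implicit Defensive.

Local Open Scope classical_set_scope.
Local Open Scope ring_scope.

(* A path [0, oo) -> R is represented by a function R -> R; its values at
   negative times play no role anywhere below.  Likewise, a process indexed by
   [0, oo) is a map R -> T -> R. *)

Definition continuous_path (R : realType) : set (R -> R) :=
  [set phi : R -> R | {within `[(0 : R), +oo[, continuous phi}].

Definition coordinate_sets (R : realType) : set (set (R -> R)) :=
  [set S | exists s : R, exists U : set R,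
     [/\ 0 <= s, measurable U & S = [set phi : R -> R | U (phi s)]]].

(* The trace of this sigma-algebra on [continuous_path] is the Borel
   sigma-algebra of C([0, oo); R) for locally uniform convergence. *)
Definition path_sigma_algebra (R : realType) : set (set (R -> R)) :=
  <<s @coordinate_sets R >>.

(* An almost surely defined random element of C([0, oo); R). *)
Definition continuous_process (R : realType) (d : measure_display)
    (T : measurableType d) (P : probability T R) (X : R -> T -> R) : Prop :=
  (forall s : R, 0 <= s -> measurable_fun setT (X s)) /\
  {ae P, forall w, @continuous_path R (X ^~ w)}.

Definition eq_in_law (R : realType) (d d' : measure_display)
    (T : measurableType d) (T' : measurableType d')
    (P : probability T R) (Q : probability T' R)
    (X : R -> T -> R) (Y : R -> T' -> R) : Prop :=
  [/\ continuous_process P X, continuous_process Q Y &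
      forall S : set (R -> R), path_sigma_algebra S ->
        P [set w | S (X ^~ w)] = Q [set w | S (Y ^~ w)]].

(* Some of the U i may be setT, so this covers all subfamilies. *)
Definition mutually_independent (R : realType) (d : measure_display)
    (T : measurableType d) (P : probability T R) (n : nat)
    (X : 'I_n -> T -> R) : Prop :=
  forall U : 'I_n -> set R, (forall i, measurable (U i)) ->
    P [set w | forall i, U i (X i w)] =
    (\prod_(i < n) P [set w | U i (X i w)])%E.

(* [normal_prob m s] takes the standard deviation s, and is a Gaussian law only
   for s != 0, whence the strict inequality between the times. *)
Definition brownian_motion (R : realType) (d : measure_display)
    (T : measurableType d) (P : probability T R) (B : R -> T -> R) : Prop :=
  [/\ forall s : R, 0 <= s -> measurable_fun setT (B s),
      forall w : T, B 0 w = 0,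
      forall w : T, @continuous_path R (B ^~ w),
      forall s t : R, 0 <= s -> s < t ->
        forall U : set R, measurable U ->
          P [set w | U (B t w - B s w)] = normal_prob 0 (Num.sqrt (t - s)) U
    & forall (n : nat) (t : nat -> R), 0 <= t 0%N ->
        (forall i : nat, (i < n)%N -> t i <= t i.+1) ->
        mutually_independent P
          (fun (i : 'I_n) w => B (t i.+1) w - B (t i) w)].

Definition Gamma (R : realType) (a : R) : R :=
  \int[lebesgue_measure]_(u in `]0, +oo[) (u `^ (a - 1) * expR (- u)).

Definition gamma_rv (R : realType) (d : measure_display)
    (T : measurableType d) (P : probability T R) (mu : R)
    (g : {RV P >-> R}) : Prop :=
  forall U : set R, measurable U ->
    distribution P g U =
    (\int[lebesgue_measure]_(u in U `&` `]0%R, +oo[%classic)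
       ((Gamma mu)^-1 * u `^ (mu - 1) * expR (- u))%:E)%E.

Definition process_rv_independent (R : realType) (d : measure_display)
    (T : measurableType d) (P : probability T R) (X : R -> T -> R)
    (g : {RV P >-> R}) : Prop :=
  forall (S : set (R -> R)) (U : set R), path_sigma_algebra S -> measurable U ->
    P ([set w | S (X ^~ w)] `&` g @^-1` U) =
    (P [set w | S (X ^~ w)] * P (g @^-1` U))%E.

Definition drifted (R : realType) (T : Type) (mu : R) (B : R -> T -> R) :
    R -> T -> R :=
  fun s w => B s w - mu * s.

Definition A_ (R : realType) (phi : R -> R) (s : R) : R :=
  \int[lebesgue_measure]_(u in `[0, s]) expR (2 * phi u).

Definition A_infty (R : realType) (phi : R -> R) : \bar R :=
  lim ((A_ phi s)%:E @[s --> +oo%R]).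

(* Meaningful only when [A_infty phi < +oo]. *)
Definition Tstar (R : realType) (z : R) (phi : R -> R) : R -> R :=
  fun s => phi s - ln (1 + A_ phi s / fine (A_infty phi) * (expR z - 1)).

(* Main.v *)
(** Put [Z = B + mu s], [Y = B - mu s] and let [g] be the gamma variable.  The
    heart of the matter is that [W = Z - ln (1 + 2 g A(Z))] has the law of [Y].
    In discrete time this is an exact identity: with
    [y = z - ln (1 + 2 v del e^z)], the map [(z, v) |-> (y, v e^(z + y))] sends
    the product of the weight [exp (mu z - (e^z + e^(-z)) / (2 del))] and of the
    gamma weight to the product of the same weights with [mu] replaced by
    [- mu].  Iterated along the increments of [B] on a grid of mesh [del], it
    gives [Z - ln (1 + 2 g A)] with a Riemann sum [A] of [A(Z)].  Up to time
    [L], replacing these weights by Gaussian densities costs [O(sqrt del)] in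
    total variation, and [del -> 0] gives the identity in law.

    Since [A(W) = A(Z) / (1 + 2 g A(Z))] and [A_infty(Z) = +oo] almost surely,
    [A_infty(W) = 1 / (2 g)].  So [F(phi, u) = phi - ln (1 + A(phi)
    (2 u - 1 / A_infty(phi)))] satisfies [F(W, u) = Z - ln (1 + 2 u A(Z))], and
    for [u] an independent copy of [g] we get, in law,
    [F(Y, g) = F(W, u) = Z - ln (1 + 2 u A(Z)) = W = Y]. *)

From HB Require Import structures.
Require Import Defs.
From mathcomp Require Import measurable_realfun ring lra.
Set Implicit Arguments.
Unset Strict Implicit.
Unset Printing Implicit Defensive.

Local Open Scope classical_set_scope.
Local Open Scope ring_scope.

(** * Integrals against densities *)

(** The obstacle is that the weights do not become trivial as [del -> 0]. Relative to a Gaussian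
    density of variance [del], a generalized inverse Gaussian weight is a constant times
    [gig_factor], which lies in []0, 1]] and differs from [1] by [O(del)] in mean; over [L / del]
    steps the product of these factors need not tend to [1]. Concentration saves the comparison:
    each factor has variance [O(del ^ 2)], so the product has variance [O(del)] and can be replaced
    by its mean at cost [O(sqrt del)]. The means for [mu] and [- mu] agree, since the discrete
    identity with constant tests equates them, and they are bounded below uniformly in the mesh. The
    facts on total masses use no ergodic theorem: [A_infty(Z) = +oo] follows from a decaying bound
    on the mean of [1 / (1 + A(Z))], and [A_infty(Y)] is finite because this event is transported
    from [W] by equality of laws. As functionals must be measurable for the coordinate
    sigma-algebra, [A] and [A_infty] are represented on path space by upper limits of Riemann
    sums. *)

Section density.
Local Open Scope ereal_scope.
Context d (T : measurableType d) (R : realType).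
Variables (m : {measure set T -> \bar R}) (f : T -> R).
Hypotheses (f0 : forall x, (0 <= f x)%R) (mf : measurable_fun setT f).

Import HBNNSimple.

(** The hypothesis is the case of indicators; it extends to simple functions by linearity and to [h]
    by monotone convergence. *)
Lemma ge0_integral_density (nu : {measure set T -> \bar R}) (h : T -> \bar R) :
  (forall U, measurable U -> nu U = \int[m]_(x in U) (f x)%:E) ->
  measurable_fun setT h -> (forall x, 0 <= h x) ->
  \int[nu]_x h x = \int[m]_x (h x * (f x)%:E).
Proof.
move=> nuE mh h0; pose g := nnsfun_approx measurableT mh.
have -> : \int[nu]_x h x = lim (\int[nu]_x (EFin \o g n) x @[n --> \oo]).
  have hE x : h x = lim ((EFin \o g n) x @[n --> \oo]).
    by apply/esym/cvg_lim => //; exact: cvg_nnsfun_approx.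
  under eq_integral => x _ do rewrite hE.
  apply: monotone_convergence => //.
  - by move=> n; exact/measurable_EFinP.
  - by move=> n x _ //=; rewrite lee_fin.
  - by move=> x _ a b ab; rewrite lee_fin; exact/lefP/nd_nnsfun_approx.
have -> : \int[m]_x (h x * (f x)%:E) =
    lim (\int[m]_x ((EFin \o g n) x * (f x)%:E) @[n --> \oo]).
  have hE x : h x * (f x)%:E = lim ((EFin \o g n) x * (f x)%:E @[n --> \oo]).
    by apply/esym/cvg_lim => //; apply: cvgeZr => //; exact: cvg_nnsfun_approx.
  under eq_integral => x _ do rewrite hE.
  apply: monotone_convergence => //.
  - by move=> n; apply/emeasurable_funM; exact/measurable_EFinP.
  - by move=> n x _ /=; rewrite mule_ge0 ?lee_fin.
  - move=> x _ a b ab/=; rewrite lee_wpmul2r ?lee_fin//.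
    exact/lefP/nd_nnsfun_approx.
suff suf n : \int[nu]_x (EFin \o g n) x = \int[m]_x ((EFin \o g n) x * (f x)%:E).
  by under eq_fun do rewrite suf.
transitivity (\int[nu]_x
   (\sum_(y \in range (g n)) (y * \1_(g n @^-1` [set y]) x)%:E)).
  by apply: eq_integral => t _; rewrite /= fimfunE -fsumEFin.
rewrite ge0_integral_fsum//; first last.
- by move=> y x _; exact: nnfun_muleindic_ge0.
- by move=> y; exact/measurable_EFinP/measurable_funM.
transitivity (\int[m]_x (\sum_(y \in range (g n))
    (y * \1_(g n @^-1` [set y]) x)%:E * (f x)%:E)); last first.
  apply: eq_integral => x _.
  rewrite -ge0_mule_fsuml => [|y]; last exact: nnfun_muleindic_ge0.
  by rewrite fsumEFin // -(fimfunE _ x).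
rewrite ge0_integral_fsum//; last 2 first.
- by move=> y; apply: emeasurable_funM; apply/measurable_EFinP => //; exact: measurable_funM.
- by move=> y x _; rewrite mule_ge0 ?lee_fin// -lee_fin nnfun_muleindic_ge0.
apply: eq_fsbigr => r /set_mem [x _ rx].
have r0 : (0 <= r)%R by rewrite -rx.
have mg : measurable (g n @^-1` [set r]) by exact: measurable_funPTI.
under eq_integral do rewrite EFinM.
rewrite ge0_integralZl//; last exact/measurable_EFinP.
rewrite integral_indic// setIT nuE//.
under [RHS]eq_integral do rewrite EFinM -muleA.
rewrite ge0_integralZl//; first last.
- by move=> y _; rewrite mule_ge0 ?lee_fin.
- by apply: emeasurable_funM; exact/measurable_EFinP.
congr *%E; rewrite integral_mkcond; apply: eq_integral => y _.
by rewrite patchE indicE; case: ifPn => _; rewrite ?mul1e ?mul0e.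
Qed.

Definition density_measure (_ : forall x, (0 <= f x)%R)
    (_ : measurable_fun setT f) (U : set T) : \bar R :=
  \int[m]_(x in U) (f x)%:E.

Let dm := density_measure f0 mf.

Let dm0 : dm set0 = 0. Proof. by rewrite /dm /density_measure integral_set0. Qed.

Let dm_ge0 U : 0 <= dm U.
Proof. by apply: integral_ge0 => x _; rewrite lee_fin. Qed.

Let dm_sigma_additive : semi_sigma_additive dm.
Proof.
move=> F mF tF mUF; rewrite /dm /density_measure ge0_integral_bigcup//.
- apply: is_cvg_ereal_nneg_natsum_cond => n _ _.
  by apply: integral_ge0 => x _; rewrite lee_fin.
- exact/measurable_EFinP/measurable_funTS.
- by move=> x _; rewrite lee_fin.
Qed.

HB.instance Definition _ := isMeasure.Build _ _ _
  (density_measure f0 mf) dm0 dm_ge0 dm_sigma_additive.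

End density.

Section substitution.
Local Open Scope ereal_scope.
Context {R : realType}.
Local Notation leb := (@lebesgue_measure R).

Lemma ge0_integral_opp (h : R -> \bar R) :
  measurable_fun setT h -> (forall x, 0 <= h x) ->
  \int[leb]_x h (- x)%R = \int[leb]_x h x.
Proof.
move=> mh h0.
transitivity (\int[pushforward leb (-%R : _ -> measurableTypeR R)]_x h x).
  by rewrite ge0_integral_pushforward.
by apply: eq_measure_integral => A mA _; exact: lebesgue_measureN.
Qed.

(** [G] is only measurable, so the substitution is proved for measures: the image under [F] of the
    density [f] on []a, +oo[] is Lebesgue measure on []F a, +oo[], because the two agree on
    half-open intervals. *)
Lemma ge0_integral_subst_oy (F f : R -> R) (a : R) (G : R -> \bar R) :
  {homo F : x y / (x < y)%R} -> (forall x : R, is_derive x 1%R F (f x)) ->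
  continuous f -> (forall x, 0 <= f x)%R -> F x @[x --> +oo%R] --> +oo%R ->
  measurable_fun setT G -> (forall x, 0 <= G x) ->
  \int[leb]_(x in `]a, +oo[) (G (F x) * (f x)%:E) =
  \int[leb]_(x in `]F a, +oo[) G x.
Proof.
move=> ndF dF cf f0 Fy mG G0.
have cF : continuous F.
  by move=> x; apply/differentiable_continuous/derivable1_diffP; have [] := dF x.
have mF : measurable_fun setT F by exact: continuous_measurable_fun.
have mf : measurable_fun setT f by exact: continuous_measurable_fun.
have ltF x y : (F x < F y)%R = (x < y)%R by rewrite (leW_mono (le_mono ndF)).
have leF x y : (F x <= F y)%R = (x <= y)%R by rewrite (le_mono ndF).
pose f' x := (f x * \1_(`]a, +oo[) x)%R.
have f'0 x : (0 <= f' x)%R by rewrite mulr_ge0.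
have mf' : measurable_fun setT f'.
  by apply: measurable_funM => //; exact: measurable_indic.
pose dm : {measure set (measurableTypeR R) -> \bar R} :=
  density_measure leb f'0 mf'.
have mdmE U : measurable U -> dm U = \int[leb]_(x in U `&` `]a, +oo[) (f x)%:E.
  move=> mU; rewrite /dm /density_measure [RHS]integral_mkcondr.
  apply: eq_integral => x _; rewrite patchE /f' indicE.
  by case: ifPn => _; rewrite ?mulr1 ?mulr0.
transitivity (\int[pushforward dm (F : _ -> measurableTypeR R)]_x G x).
  rewrite ge0_integral_pushforward//= (@ge0_integral_density _ (measurableTypeR R) R leb f' f'0 mf' dm)//.
  - rewrite [LHS]integral_mkcond; apply: eq_integral => x _.
    by rewrite patchE /f' indicE; case: ifPn => _; rewrite ?mulr1 ?mulr0 ?mule0.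
  - exact: measurableT_comp.
transitivity (\int[mrestr leb (measurable_itv `]F a, +oo[)]_x G x).
  2: {
  rewrite [RHS]integral_mkcond.
  rewrite (@ge0_integral_density _ (measurableTypeR R) R leb (fun x => \1_(`]F a, +oo[) x))//.
  - apply: eq_integral => x _; rewrite patchE indicE.
    by case: ifPn => _; rewrite ?mule1 ?mule0.
  - exact: measurable_indic.
  - by move=> U mU; rewrite integral_indic// setIC.
  }
apply: eq_measure_integral => A mA _.
have mF' : measurable_fun setT (F : _ -> measurableTypeR R) by [].
pose g (k : nat) := `](- k%:R)%R, k%:R]%classic : set R.
have ivt y : (F a <= y)%R -> exists2 x, (a <= x)%R & F x = y.
  move=> ay; have [M [aM yM]] : exists M, (a <= M /\ y <= F M)%R.
    have /cvgryPge/(_ y) [M0 [_ HM0]] := Fy.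
    exists (Num.max a (M0 + 1)%R); rewrite le_max lexx; split => //.
    by apply: HM0; rewrite lt_max ltrDl ltr01 orbT.
  have cFaM : {within `[a, M], continuous F} by exact: continuous_subspaceT.
  have yr : (Num.min (F a) (F M) <= y <= Num.max (F a) (F M))%R.
    by rewrite ge_min le_max ay yM orbT.
  by have [x xaM <-] := IVT aM cFaM yr; exists x => //; rewrite (itvP xaM).
apply/esym; apply: (@measure_unique _ R (measurableTypeR R) (@ocitv R) g _ _ _ _
  (mrestr leb (measurable_itv `]F a, +oo[))
  (pushforward dm (F : _ -> measurableTypeR R))) => //.
- exact: ocitvI.
- by move=> k; exact: is_ocitv.
- exact: (bigcup_itvT false false).
(* Both measures give []c, e]] the length of its part above [F a]; if that part is nonempty, its
   preimage is an interval and the fundamental theorem of calculus applies. *)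
- move=> _ [[c e]] _ <-; apply/esym.
  rewrite /mrestr /=.
  have dmE U : measurable U -> pushforward dm (F : _ -> measurableTypeR R) U =
      \int[leb]_(x in F @^-1` U `&` `]a, +oo[) (f x)%:E.
    by move=> mU; rewrite /pushforward mdmE// -[X in measurable X]setTI; exact: mF.
  rewrite dmE//.
  have [ec|ce] := leP e (Num.max c (F a)).
    rewrite (_ : _ `&` _ = set0) ?integral_set0; last first.
      rewrite -subset0 => x /= []; rewrite !in_itv/= andbT => /andP[cx xe] ax.
      move: ec; rewrite le_max => /orP[|] ec.
        by have := lt_le_trans cx (le_trans xe ec); rewrite ltxx.
      by have := le_trans xe ec; rewrite leF leNgt ax.
    rewrite /mrestr (_ : _ `&` _ = set0) ?measure0// -subset0 => x /= [].
    rewrite !in_itv/= andbT => /andP[cx xe] ax.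
    move: ec; rewrite le_max => /orP[|] ec.
      by have := lt_le_trans cx (le_trans xe ec); rewrite ltxx.
    by have := lt_le_trans ax (le_trans xe ec); rewrite ltxx.
  have [|al aal Fal] := ivt (Num.max c (F a)).
    by rewrite le_max lexx orbT.
  have [|be abe Fbe] := ivt e.
    by rewrite (le_trans _ (ltW ce))// le_max lexx orbT.
  have albe : (al < be)%R by rewrite -ltF Fal Fbe.
  rewrite /mrestr (_ : `]c, e] `&` `]F a, +oo[ = `]F al, F be]%classic); last first.
    apply/seteqP; split => x /=; rewrite !in_itv/= ?andbT Fal Fbe gt_max.
      by move=> [/andP[-> ->] ->].
    by move=> /andP[/andP[-> ->] ->].
  rewrite (_ : _ `&` _ = `]al, be]%classic); last first.
    apply/seteqP; split => x /=; rewrite !in_itv/= ?andbT -(ltF al) -[(_ <= be)%R]leF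
      -(ltF a) Fal Fbe gt_max.
      by move=> [/andP[-> ->] ->].
    by move=> /andP[/andP[-> ->] ->].
  rewrite integral_itv_obnd_cbnd; last exact/measurable_EFinP/measurable_funTS.
  rewrite (@continuous_FTC2 _ _ F)//.
  + by rewrite [RHS]lebesgue_measure_itv/= lte_fin ltF albe.
  + exact: continuous_subspaceT.
  + split => //.
    * by apply: cvg_at_right_filter; exact: cF.
    * by apply: cvg_at_left_filter; exact: cF.
  + by move=> x _; rewrite derive1E; exact: derive_val.
move=> k; apply: (@le_lt_trans _ _ (leb (g k))).
  rewrite /mrestr; apply: le_measure; last exact: subIsetl.
    by rewrite inE; apply: measurableI; exact: measurable_itv.
  by rewrite inE; exact: measurable_itv.
by rewrite lebesgue_measure_itv/=; case: ifP => _; rewrite ltry.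
Qed.

End substitution.

(** * The exchange of gamma and generalized inverse Gaussian laws *)

Section measurable_comp.
Context d (T : measurableType d) (R : realType) (f : T -> R).
Hypothesis mf : measurable_fun setT f.

(** These facts are stated for [fun x => _] rather than for compositions so that the tactic
    [measurability] can apply them by matching on the head operation. *)
Lemma measurable_fun_expR : measurable_fun setT (fun x => expR (f x)).
Proof. exact: measurableT_comp. Qed.

Lemma measurable_fun_ln : measurable_fun setT (fun x => ln (f x)).
Proof. exact: (measurableT_comp (@measurable_ln R)). Qed.

Lemma measurable_fun_opp : measurable_fun setT (fun x => - f x).
Proof. exact: measurableT_comp. Qed.

Lemma measurable_fun_powR p : measurable_fun setT (fun x => f x `^ p).
Proof. exact: (measurableT_comp (@measurable_powR R p)). Qed.

Lemma measurable_fun_indic (A : set R) : measurable A ->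
  measurable_fun setT (fun x => \1_A (f x) : R).
Proof. by move=> mA; apply: measurableT_comp => //; exact: measurable_indic. Qed.

End measurable_comp.

Lemma measurable_fun_compT d1 d2 d3 (T1 : measurableType d1)
    (T2 : measurableType d2) (T3 : measurableType d3) (g : T2 -> T3) (f : T1 -> T2) :
  measurable_fun setT g -> measurable_fun setT f ->
  measurable_fun setT (fun x => g (f x)).
Proof. by move=> mg mf; exact: measurableT_comp. Qed.

Ltac measurability := repeat first
  [ match goal with
    | H : measurable_fun _ ?h |- measurable_fun _ ?h => exact: H
    | |- measurable_fun _ (fun x => x) => exact: measurable_id
    | |- measurable_fun _ (fun x => fst x) => exact: measurable_fst
    | |- measurable_fun _ (@expR _) => exact: measurable_expR
    | |- measurable_fun _ fst => exact: measurable_fst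
    | |- measurable_fun _ snd => exact: measurable_snd
    | |- measurable_fun _ (fun x => snd x) => exact: measurable_snd
    | |- measurable_fun _ (fun x => fst (fst x)) =>
        exact: (measurable_fun_compT measurable_fst measurable_fst)
    | |- measurable_fun _ (fun x => snd (fst x)) =>
        exact: (measurable_fun_compT measurable_snd measurable_fst)
    | |- measurable_fun _ (fun x => ?c) => exact: (@measurable_cst _ _ _ _ _ c)
    | |- measurable_fun _ (fun x => (_, _)) => apply: measurable_fun_pair
    | |- measurable_fun _ (fun x => EFin _) => apply/measurable_EFinP
    | |- measurable_fun _ (fun x => (_ * _)%E) => apply: emeasurable_funM
    | |- measurable_fun _ (fun x => (_ + _)%E) => apply: emeasurable_funD
    | |- measurable_fun _ (fun x => (_ * _)%R) => apply: measurable_funM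
    | |- measurable_fun _ (fun x => (_ - _)%R) => apply: measurable_funB
    | |- measurable_fun _ (fun x => (_ + _)%R) => apply: measurable_funD
    | |- measurable_fun _ (fun x => expR _) => apply: measurable_fun_expR
    | |- measurable_fun _ (fun x => ln _) => apply: measurable_fun_ln
    | |- measurable_fun _ (fun x => GRing.opp _) => apply: measurable_fun_opp
    | |- measurable_fun _ (fun x => powR _ _) => apply: measurable_fun_powR
    | |- measurable_fun _ (fun x => indic _ _) =>
        apply: measurable_fun_indic; [|exact: measurable_itv]
    | H : measurable_fun _ ?h |- measurable_fun _ (fun x => ?h _) =>
        apply: (measurable_fun_compT H)
    end ].

Section gig.
Context {R : realType}.
Variables (mu del : R).
Hypothesis (del0 : 0 < del).
Local Notation leb := (@lebesgue_measure R).

Definition gamma_weight (v : R) : R :=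
  \1_(`]0, +oo[%classic) v * v `^ (mu - 1) * expR (- v).

(** Unnormalized density of the logarithm of a generalized inverse Gaussian variable of index
    [m]. *)
Definition gig_weight (m z : R) : R :=
  expR (m * z - (expR z + expR (- z)) / (2 * del)).

Definition gig_step (v z : R) : R := z - ln (1 + 2 * v * del * expR z).

(** In the coordinates [(z, y)] with [y < z], the old gamma variable is
    [(e^(-y) - e^(-z)) / (2 del)] and the new one is [(e^z - e^y) / (2 del)]. Two one-dimensional
    substitutions, each between uses of Tonelli's theorem, bring both sides to the integral of one
    function [I(z, y)]; no planar Jacobian is involved. *)
Lemma gig_exchange (h : R * R -> \bar R) :
  measurable_fun setT h -> (forall p, (0 <= h p)%E) ->
  (\int[leb]_v \int[leb]_z (h (gig_step v z, v * expR (z + gig_step v z))%R *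
     (gamma_weight v * gig_weight mu z)%:E) =
   \int[leb]_v \int[leb]_y (h (y, v) *
     (gamma_weight v * gig_weight (- mu) y)%:E))%E.
Proof.
move=> mh h0.
pose Phi (p : R * R) := (h (gig_step p.1 p.2, p.1 * expR (p.2 + gig_step p.1 p.2))%R *
     (gamma_weight p.1 * gig_weight mu p.2)%:E)%E.
pose Psi (p : R * R) := (h (p.2, p.1) * (gamma_weight p.1 * gig_weight (- mu) p.2)%:E)%E.
(* The common integrand at [p = (z, y)]: the left integrand with [v] written in terms of [y], times
   the Jacobian, restricted to [y < z]. *)
pose I (p : R * R) := (Phi ((expR (- p.2) - expR (- p.1)) / (2 * del), p.1)%R *
  (expR (- p.2) / (2 * del) * \1_(`]0, +oo[%classic) (p.1 - p.2))%:E)%E.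
have Phi0 p : (0 <= Phi p)%E.
  by rewrite /Phi mule_ge0// lee_fin /gamma_weight /gig_weight !mulr_ge0 ?expR_ge0 ?powR_ge0.
have Psi0 p : (0 <= Psi p)%E.
  by rewrite /Psi mule_ge0// lee_fin /gamma_weight /gig_weight !mulr_ge0 ?expR_ge0 ?powR_ge0.
have I0 p : (0 <= I p)%E.
  by rewrite /I mule_ge0// lee_fin mulr_ge0// divr_ge0 ?expR_ge0 ?mulr_ge0 ?ltW.
have mind (A : set R) : measurable A -> measurable_fun setT (\1_A : R -> R).
  by move=> mA; exact: measurable_indic.
have mPhi : measurable_fun setT Phi.
  rewrite /Phi /gig_step /gamma_weight /gig_weight; by measurability.
have mPsi : measurable_fun setT Psi.
  rewrite /Psi /gamma_weight /gig_weight; by measurability.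
have mI : measurable_fun setT I.
  rewrite /I; apply: emeasurable_funM; last by measurability.
  apply: (measurable_fun_compT (f := fun p : R * R =>
    ((expR (- p.2) - expR (- p.1)) / (2 * del), p.1)) mPhi).
  by measurability.
(* One substitution serves both sides: the old gamma variable is [F (- z) (- y)] and the new one is
   [F y z]. *)
pose F a x := (expR x - expR a) / (2 * del) : R.
pose f x := expR x / (2 * del) : R.
have d2 : 0 < 2 * del by rewrite mulr_gt0.
have subst a G : measurable_fun setT G -> (forall x, (0 <= G x)%E) ->
    (\int[leb]_(x in `]a, +oo[) (G (F a x) * (f x)%:E) =
     \int[leb]_(x in `]0%R, +oo[) G x)%E.
  move=> mG G0.
  have dF (x : R) : is_derive x 1%R (F a) (f x).
    rewrite /F /f; apply: is_derive_eq. rewrite ?scaler0 ?add0r ?addr0. by rewrite subr0 [_ *: _]mulrC.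
  have ndF : {homo F a : x y / x < y}.
    by move=> x y xy; rewrite /F ltr_pM2r ?invr_gt0// ltrD2r ltr_expR.
  rewrite (ge0_integral_subst_oy a ndF dF)//.
  - by rewrite /F subrr mul0r.
  - move=> x; apply: cvgMl; exact: continuous_expR.
  - by move=> x; rewrite divr_ge0 ?expR_ge0 ?ltW.
  - apply/cvgryPge => M; exists (M * (2 * del) + expR a); split; rewrite ?num_real// => x Mx.
    rewrite /F ler_pdivlMr// lerBrDr (le_trans (ltW Mx))//.
    by rewrite (le_trans _ (expR_ge1Dx x))// lerDr.
have PhiE z : (\int[leb]_v Phi (v, z) = \int[leb]_(v in `]0%R, +oo[) Phi (v, z))%E.
  rewrite [RHS]integral_mkcond; apply: eq_integral => v _; rewrite patchE.
  by case: ifPn => // v0; rewrite /Phi /gamma_weight /= indicE (negbTE v0) !mul0r mule0.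
have PsiE y : (\int[leb]_v Psi (v, y) = \int[leb]_(v in `]0%R, +oo[) Psi (v, y))%E.
  rewrite [RHS]integral_mkcond; apply: eq_integral => v _; rewrite patchE.
  by case: ifPn => // v0; rewrite /Psi /gamma_weight /= indicE (negbTE v0) !mul0r mule0.
have IE y z : y < z -> I (z, y) = (Psi (F y z, y) * (f z)%:E)%E.
  move=> yz; rewrite /I /Phi /Psi /F /f /=.
  set v := (expR (- y) - expR (- z)) / (2 * del).
  have vE : 1 + 2 * v * del * expR z = expR (z - y).
    rewrite /v expRB !expRN; field.
    by rewrite (gt_eqF (expR_gt0 y)) (gt_eqF (expR_gt0 z)) gt_eqF.
  have sE : gig_step v z = y by rewrite /gig_step vE expRK; ring.
  have v'E : v * expR (z + y) = (expR z - expR y) / (2 * del).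
    rewrite /v expRD !expRN; field.
    by rewrite (gt_eqF (expR_gt0 y)) (gt_eqF (expR_gt0 z)) gt_eqF.
  rewrite sE v'E -(muleA (h _)) -(muleA (h _)) -2!EFinM; congr (_ * _%:E)%E.
  have v0 : 0 < v by rewrite divr_gt0// subr_gt0 ltr_expR ltrN2.
  have v'0 : 0 < (expR z - expR y) / (2 * del) by rewrite divr_gt0// subr_gt0 ltr_expR.
  rewrite /gamma_weight !indicE !mem_set/=; first last.
  - by rewrite in_itv/= v0.
  - by rewrite in_itv/= subr_gt0 yz.
  - by rewrite in_itv/= v'0.
  rewrite -[in X in _ = X]v'E powRM ?expR_ge0 ?ltW// -expRM !mul1r mulr1 /gig_weight.
  rewrite v'E.
  (* The exponents match because each gamma variable plus its own hyperbolic term,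
     [v + (e^z + e^(-z)) / (2 del)] on the left and the same with the new variable and [y] on the
     right, equals [(e^z + e^(-y)) / (2 del)]. *)
  transitivity (v `^ (mu - 1) / (2 * del) *
      expR (- v + (mu * z - (expR z + expR (- z)) / (2 * del)) - y)).
    by rewrite !expRD; ring.
  transitivity (v `^ (mu - 1) / (2 * del) *
      expR ((z + y) * (mu - 1) - (expR z - expR y) / (2 * del) +
        (- mu * y - (expR y + expR (- y)) / (2 * del)) + z)).
    by congr (_ * expR _); rewrite /v; field; rewrite gt_eqF.
  by rewrite !expRD; ring.
transitivity (\int[leb]_z \int[leb]_v Phi (v, z))%E.
  exact: (@fubini_tonelli _ _ (measurableTypeR R) (measurableTypeR R) R leb leb Phi mPhi Phi0).
transitivity (\int[leb]_z \int[leb]_y I (z, y))%E.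
  apply: eq_integral => z _; rewrite PhiE.
  have mPhiz := measurable_fun_pair1 z mPhi.
  rewrite -(subst (- z) _ mPhiz) => [|v]; last exact: Phi0.
  pose J (x : R) := (Phi (F (- z) x, z)%R * (f x * \1_(`]0, +oo[%classic) (x + z))%:E)%E.
  transitivity (\int[leb]_x J x)%E.
    rewrite integral_mkcond; apply: eq_integral => y _; rewrite patchE /J indicE.
    rewrite !mem_setE !in_itv/= !andbT -ltrBlDr sub0r.
    by case: ifPn => _; rewrite ?mulr1 ?mulr0 ?mule0.
  rewrite -ge0_integral_opp//; first last.
  - by move=> x; rewrite /J mule_ge0// lee_fin mulr_ge0// divr_ge0 ?expR_ge0 ?ltW.
  - rewrite /J; apply: emeasurable_funM; last by rewrite /f; measurability.
    apply: (measurable_fun_compT (f := fun x : R => (F (- z) x, z)) mPhi).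
    by rewrite /F; measurability.
  by apply: eq_integral => y _; rewrite /J /I /F /f [(- y + z)%R]addrC.
transitivity (\int[leb]_y \int[leb]_z I (z, y))%E.
  exact: (@fubini_tonelli _ _ (measurableTypeR R) (measurableTypeR R) R leb leb I mI I0).
transitivity (\int[leb]_y \int[leb]_v Psi (v, y))%E; last first.
  exact/esym/(@fubini_tonelli _ _ (measurableTypeR R) (measurableTypeR R) R leb leb Psi mPsi Psi0).
apply: eq_integral => y _; rewrite PsiE.
have mPsiy := measurable_fun_pair1 y mPsi.
rewrite -(subst y _ mPsiy) => [|v]; last exact: Psi0.
rewrite [RHS]integral_mkcond; apply: eq_integral => z _; rewrite patchE.
rewrite mem_setE in_itv/= andbT; case: ifPn => yz; first by rewrite IE.
by rewrite /I/= indicE mem_setE in_itv/= andbT subr_gt0 (negbTE yz) mulr0 mule0.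
Qed.
End gig.

(** * Generalized inverse Gaussian weights relative to Gaussian densities *)

Section cosh_remainder.
Context {R : realType}.
Implicit Types (f g : R -> R) (x z : R).

(** By the mean value theorem [f x = x * g c] with [0 < c < x], and [c ^+ k * expR c] increases with
    [c]: one integration from [0] costs one factor [x]. *)
Lemma integrate_expR_bound f g k :
  f 0 = 0 -> (forall x : R, is_derive x 1 f (g x)) ->
  (forall x, 0 <= x -> 0 <= g x <= x ^+ k * expR x) ->
  forall x, 0 <= x -> 0 <= f x <= x ^+ k.+1 * expR x.
Proof.
move=> f0 df gb x; rewrite le_eqVlt => /predU1P[<-|x0].
  by rewrite f0 exprS !mul0r lexx.
have cf : continuous f.
  by move=> y; apply/differentiable_continuous/derivable1_diffP; have [] := df y.
have [c c0x] := MVT x0 (fun y _ => df y) (continuous_subspaceT cf).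
rewrite f0 !subr0 => ->.
have [c0 cx] : 0 < c /\ c < x by move: c0x; rewrite in_itv/= => /andP[].
have /andP[g0 gle] := gb c (ltW c0).
rewrite mulr_ge0 ?(ltW x0)//= exprSr mulrAC ler_pM2r// (le_trans gle)//.
apply: ler_pM; rewrite ?exprn_ge0 ?expR_ge0 ?ler_expR ?(ltW c0) ?(ltW cx)//.
by rewrite lerXn2r ?nnegrE ?(ltW c0) ?(ltW x0) ?(ltW cx).
Qed.

Definition cosh_remainder z : R := (expR z + expR (- z)) / 2 - 1 - z ^+ 2 / 2.

Lemma cosh_remainderN z : cosh_remainder (- z) = cosh_remainder z.
Proof. by rewrite /cosh_remainder opprK sqrrN [X in X / 2]addrC. Qed.

(** For [z >= 0], start from [0 <= cosh z <= expR z] and integrate four times, through [sinh z],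
    [cosh z - 1], [sinh z - z] and the remainder, each vanishing at [0]. *)
Lemma cosh_remainder_bound z : 0 <= cosh_remainder z <= z ^+ 4 * expR `|z|.
Proof.
wlog z0 : z / 0 <= z => [H|].
  have [|z0] := leP 0 z; first exact: H.
  have := H (- z); rewrite cosh_remainderN normrN (exprM _ 2 2) sqrrN -exprM.
  by apply; rewrite oppr_ge0 ltW.
rewrite ger0_norm//; move: z z0.
pose ch z : R := (expR z + expR (- z)) / 2.
pose sh z : R := (expR z - expR (- z)) / 2.
have dch (z : R) : is_derive z 1 ch (sh z).
  by rewrite /ch /sh; apply: is_derive_eq; rewrite /GRing.scale/=; field.
have dsh (z : R) : is_derive z 1 sh (ch z).
  by rewrite /ch /sh; apply: is_derive_eq; rewrite /GRing.scale/=; field.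
have chb z : 0 <= z -> 0 <= ch z <= z ^+ 0 * expR z.
  move=> z0; rewrite expr0 mul1r divr_ge0 ?addr_ge0 ?expR_ge0//=.
  rewrite ler_pdivrMr// mulr_natr mulr2n lerD2l ler_expR; lra.
apply: (@integrate_expR_bound _ (fun z => sh z - z)).
- by rewrite /cosh_remainder oppr0 expR0; lra.
- move=> z; rewrite /cosh_remainder /sh; apply: is_derive_eq.
  by rewrite /GRing.scale/= /sh; field.
apply: (@integrate_expR_bound _ (fun z => ch z - 1)).
- by rewrite /sh oppr0 expR0 subrr mul0r addr0.
apply: (@integrate_expR_bound _ sh).
- by rewrite /ch oppr0 expR0; lra.
- by move=> z; apply: is_derive_eq; rewrite subr0.
apply: (@integrate_expR_bound _ ch) => //.
by rewrite /sh oppr0 expR0 subrr mul0r.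
Qed.

End cosh_remainder.

Section gig_factor.
Context {R : realType}.
Variable s : R.
Hypothesis s0 : 0 < s.

(** Ratio of [expR (- cosh z / s ^+ 2)] to [expR (- z ^+ 2 / (2 * s ^+ 2))], scaled to be [1] at
    [0]; here [s ^+ 2] is the mesh [del]. *)
Definition gig_factor (z : R) : R := expR (- cosh_remainder z / s ^+ 2).

Lemma gig_factor_gt0 z : 0 < gig_factor z. Proof. exact: expR_gt0. Qed.

Lemma gig_factor_le1 z : gig_factor z <= 1.
Proof.
rewrite -[leRHS]expR0 ler_expR mulNr oppr_le0 divr_ge0 ?sqr_ge0//.
by have /andP[] := cosh_remainder_bound z.
Qed.

Lemma measurable_gig_factor : measurable_fun setT gig_factor.
Proof.
rewrite /gig_factor /cosh_remainder; apply: measurable_fun_expR.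
by apply: measurable_funM => //; apply: measurable_fun_opp; measurability.
Qed.

(** From [1 - expR (- x) <= x], the left side is at most [s ^+ 4 * y ^+ 8 * expR (2 * |z|)] with
    [y = |z| / s], and [y ^+ 8 <= 8 ^+ 8 * expR y] since [y / 8 <= expR (y / 8)]. The result is a
    sum of exponentials because their Gaussian means are explicit, and the rate [s^-1] is harmless
    under standard deviation [s]. *)
Lemma one_sub_gig_factor_sq z : (1 - gig_factor z) ^+ 2 <=
  8 ^+ 8 * s ^+ 4 * (expR ((s^-1 + 2) * z) + expR (- (s^-1 + 2) * z)).
Proof.
have /andP[h0 hle] := cosh_remainder_bound z.
have s20 : 0 < s ^+ 2 by rewrite exprn_gt0.
have X1 : 0 <= 1 - gig_factor z <= cosh_remainder z / s ^+ 2.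
  rewrite subr_ge0 gig_factor_le1/= lerBlDr addrC -lerBlDr.
  by rewrite (le_trans _ (expR_ge1Dx _))// mulNr.
have /andP[X10 X1le] := X1.
pose y := `|z| / s.
have y0 : 0 <= y by rewrite divr_ge0// ltW.
have y8 : y ^+ 8 <= 8 ^+ 8 * expR y.
  have -> : y ^+ 8 = 8 ^+ 8 * (y / 8) ^+ 8 by rewrite -exprMn; congr (_ ^+ _); field.
  rewrite ler_pM2l ?exprn_gt0//.
  have -> : expR y = expR (y / 8) ^+ 8.
    by rewrite -expRM_natl; congr expR; field.
  rewrite lerXn2r ?nnegrE ?expR_ge0 ?(divr_ge0 y0)//.
  by rewrite (le_trans _ (expR_ge1Dx _))// lerDr.
apply: (@le_trans _ _ ((z ^+ 4 * expR `|z| / s ^+ 2) ^+ 2)).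
  have X1le' : 1 - gig_factor z <= z ^+ 4 * expR `|z| / s ^+ 2.
    by rewrite (le_trans X1le)// ler_pM2r ?invr_gt0.
  by rewrite lerXn2r ?nnegrE// (le_trans X10).
have -> : (z ^+ 4 * expR `|z| / s ^+ 2) ^+ 2 = s ^+ 4 * y ^+ 8 * expR (2 * `|z|).
  have -> : expR (2 * `|z|) = expR `|z| * expR `|z|.
    by rewrite -expRD; congr expR; ring.
  rewrite /y.
  have -> : z ^+ 4 = `|z| ^+ 4 by rewrite -[4%N]/(2 * 2)%N !exprM real_normK ?num_real.
  by field; rewrite gt_eqF.
apply: (@le_trans _ _ (s ^+ 4 * (8 ^+ 8 * expR y) * expR (2 * `|z|))).
  by rewrite ler_pM2r ?expR_gt0// ler_pM2l ?exprn_gt0.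
rewrite (_ : s ^+ 4 * _ * _ = 8 ^+ 8 * s ^+ 4 * expR (y + 2 * `|z|)); last first.
  by rewrite expRD; ring.
rewrite ler_pM2l ?mulr_gt0 ?exprn_gt0//.
have -> : y + 2 * `|z| = (s^-1 + 2) * `|z| by rewrite /y; ring.
have [z0|z0] := leP 0 z; first by rewrite (ger0_norm z0) lerDl expR_ge0.
by rewrite (ltr0_norm z0) mulNr mulrN lerDr expR_ge0.
Qed.

End gig_factor.

Section shift.
Local Open Scope ereal_scope.
Context {R : realType}.
Local Notation leb := (@lebesgue_measure R).

Lemma lebesgue_measure_shift (a : R) (A : set R) : measurable A ->
  pushforward leb ((fun x => x + a)%R : _ -> measurableTypeR R) A = leb A.
Proof.
move=> mA; apply/esym/lebesgue_measure_unique => //=; first exact: measurable_funD.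
move=> _ X [[b c]] _ <-.
rewrite /pushforward (_ : _ @^-1` _ = `](b - a)%R, (c - a)%R]%classic).
  by rewrite !lebesgue_measure_itv/= !lte_fin ltrD2r -!EFinB; case: ifP => // _; congr EFin; ring.
by apply/seteqP; split => x /=; rewrite !in_itv/= ltrBlDr lerBrDr.
Qed.

Lemma ge0_integral_shift (a : R) (h : R -> \bar R) :
  measurable_fun setT h -> (forall x, 0 <= h x) ->
  \int[leb]_x h (x + a)%R = \int[leb]_x h x.
Proof.
move=> mh h0.
transitivity (\int[pushforward leb ((fun x => x + a)%R : _ -> measurableTypeR R)]_x h x).
  rewrite ge0_integral_pushforward//=; exact: measurable_funD.
by apply: eq_measure_integral => [|? A mA _]; [exact: measurable_funD|exact: lebesgue_measure_shift].
Qed.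

End shift.

Section normal.
Context {R : realType}.
Variable s : R.
Hypothesis s0 : 0 < s.
Local Notation leb := (@lebesgue_measure R).
Local Notation N := (normal_prob (0 : R) s).

Let sN0 : s != 0. Proof. by rewrite gt_eqF. Qed.

Lemma ge0_integral_normal (h : R -> \bar R) :
  measurable_fun setT h -> (forall x, (0 <= h x)%E) ->
  (\int[N]_z h z = \int[leb]_z (h z * (normal_pdf 0 s z)%:E))%E.
Proof.
move=> mh h0.
rewrite (@ge0_integral_density _ (measurableTypeR R) R leb (normal_pdf 0 s))//.
- by move=> x; exact: normal_pdf_ge0.
- exact: measurable_normal_pdf.
Qed.

Lemma normal_mgf c : (\int[N]_z (expR (c * z))%:E = (expR (c ^+ 2 * s ^+ 2 / 2))%:E)%E.
Proof.
rewrite ge0_integral_normal; first last.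
- by move=> x; rewrite lee_fin expR_ge0.
- by measurability.
transitivity (\int[leb]_z ((expR (c ^+ 2 * s ^+ 2 / 2))%:E *
    (normal_pdf (c * s ^+ 2) s z)%:E))%E.
  apply: eq_integral => z _; rewrite -!EFinM; congr EFin; rewrite !normal_pdfE// /normal_fun.
  rewrite !(mulrCA (expR _)) -!expRD; congr (_ * expR _); field.
  by rewrite sN0.
rewrite ge0_integralZl//.
- by rewrite integral_normal_pdf mule1.
- by apply/measurable_EFinP; exact: measurable_normal_pdf.
- by move=> z _; rewrite lee_fin normal_pdf_ge0.
Qed.

(** With [c = s^-1 + 2] and [s <= 1], each of the two exponentials bounding [(1 - gig_factor) ^+ 2]
    has Gaussian mean at most [expR (9 / 2)], as [(c * s) ^+ 2 <= 9], and the shift by [m * s ^+ 2]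
    costs at most [expR (3 * |m|)]. *)
Definition variance_const (m : R) : R := 8 ^+ 8 * 2 * expR (5 + 3 * `|m|).

Lemma variance_const_gt0 m : 0 < variance_const m.
Proof. by rewrite !mulr_gt0 ?expR_gt0// exprn_gt0. Qed.

Lemma normal_gig_factor_bound m : s <= 1 ->
  (\int[N]_z ((1 - gig_factor s (z + m * s ^+ 2)) ^+ 2)%:E <=
   (variance_const m * s ^+ 4)%:E)%E.
Proof.
move=> s1.
pose c := s^-1 + 2.
pose k := 8 ^+ 8 * s ^+ 4.
have k0 : 0 <= k by rewrite mulr_ge0 ?exprn_ge0 ?ltW.
have mX : measurable_fun setT (fun z : R => (1 - gig_factor s (z + m * s ^+ 2)) ^+ 2).
  apply: measurable_funX; apply: measurable_funB => //.
  by apply: (measurable_fun_compT (measurable_gig_factor s)); measurability.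
have le9 : c ^+ 2 * s ^+ 2 <= 9.
  have t0 : 0 <= 1 + 2 * s by rewrite addr_ge0 ?mulr_ge0 ?(ltW s0).
  have t3 : 1 + 2 * s <= 3 by lra.
  rewrite (_ : c ^+ 2 * s ^+ 2 = (1 + 2 * s) ^+ 2); last by rewrite /c; field.
  by rewrite (_ : 9 = 3 ^+ 2) ?lerXn2r ?nnegrE//; ring.
have cms : c * (m * s ^+ 2) <= 3 * `|m| /\ - c * (m * s ^+ 2) <= 3 * `|m|.
  have t3 : 0 <= s + 2 * s ^+ 2 <= 3.
    rewrite addr_ge0 ?mulr_ge0 ?exprn_ge0 ?(ltW s0)//= expr2.
    have ss : s * s <= 1 * 1 by rewrite ler_pM ?(ltW s0).
    by rewrite (_ : 3 = 1 + 2 * (1 * 1)) ?lerD// ?ler_pM2l//; ring.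
  have cE : c * (m * s ^+ 2) = m * (s + 2 * s ^+ 2) by rewrite /c; field.
  rewrite mulNr cE -mulNr; move: (s + _) t3 => t /andP[t0 t3].
  by split; rewrite (le_trans (ler_norm _))// normrM ?normrN (ger0_norm t0)
    mulrC ler_wpM2r.
apply: (@le_trans _ _ (\int[N]_z
    ((k * expR (c * (m * s ^+ 2)))%:E * (expR (c * z))%:E +
     (k * expR (- c * (m * s ^+ 2)))%:E * (expR (- c * z))%:E))%E).
  apply: ge0_le_integral => //.
  - by move=> z _; rewrite lee_fin sqr_ge0.
  - exact/measurable_EFinP.
  - by apply: emeasurable_funD; apply: emeasurable_funM => //; measurability.
  move=> z _; rewrite -!EFinM -EFinD lee_fin (le_trans (one_sub_gig_factor_sq _ _))//.
  by rewrite -/k -/c !(mulrDr _ z) !expRD le_eqVlt; apply/orP; left; apply/eqP; ring.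
rewrite ge0_integralD//; first last.
all: try by move=> z _; rewrite -EFinM lee_fin (mulr_ge0 (mulr_ge0 k0 (expR_ge0 _)) (expR_ge0 _)).
all: try by apply: emeasurable_funM => //; measurability.
rewrite !ge0_integralZl//; first last.
all: try by rewrite ?lee_fin ?(mulr_ge0 k0 (expR_ge0 _)) ?expR_ge0.
all: try by move=> z _; rewrite lee_fin expR_ge0.
all: try by measurability.
rewrite !normal_mgf sqrrN -!EFinM -EFinD lee_fin.
have bd (x : R) : x <= 3 * `|m| ->
    k * expR x * expR (c ^+ 2 * s ^+ 2 / 2) <= k * expR (5 + 3 * `|m|).
  move=> xm; rewrite -mulrA -expRD ler_wpM2l// ler_expR addrC lerD//.
  by rewrite ler_pdivrMr// (le_trans le9); lra.
apply: (le_trans (lerD (bd _ cms.1) (bd _ cms.2))).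
by rewrite /variance_const /k le_eqVlt; apply/orP; left; apply/eqP; ring.
Qed.

End normal.

(** * The exchange for one weighted Gaussian step *)

Section one_step.
Context {R : realType}.
Variables (mu s c : R).
Hypotheses (s0 : 0 < s) (c0 : 0 <= c).
Local Notation leb := (@lebesgue_measure R).
Local Notation N := (normal_prob (0 : R) s).

Let sN0 : s != 0. Proof. by rewrite gt_eqF. Qed.

(** The constant left after completing the square in a Gaussian density of mean [m * s ^+ 2]. It is
    even in [m], so it is the same on both sides of the exchange of [mu] and [- mu]. *)
Definition gig_const (m : R) : R := normal_peak s * expR (s ^- 2 - m ^+ 2 * s ^+ 2 / 2).

Lemma normal_gig_factorE m z :
  gig_factor s z * normal_pdf 0 s (z - m * s ^+ 2) =
  gig_const m * gig_weight (s ^+ 2) m z.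
Proof.
rewrite normal_pdfE// /normal_fun /gig_factor /gig_const /gig_weight /cosh_remainder.
rewrite mulrCA -expRD -[RHS]mulrA -expRD; congr (_ * expR _); field.
by rewrite sN0.
Qed.

Lemma ge0_integral_normal_gig m (k : R -> \bar R) :
  measurable_fun setT k -> (forall x, (0 <= k x)%E) ->
  (\int[N]_b ((gig_factor s (b + m * s ^+ 2))%:E * k (b + m * s ^+ 2)%R) =
   \int[leb]_z (k z * (gig_const m * gig_weight (s ^+ 2) m z)%:E))%E.
Proof.
move=> mk k0; have mg := measurable_gig_factor s.
have mp := measurable_normal_pdf (0 : R) s.
rewrite (ge0_integral_normal s); first last.
- by move=> b; rewrite mule_ge0// lee_fin ltW// gig_factor_gt0.
- by measurability.
pose q z := ((gig_factor s z)%:E * k z * (normal_pdf 0 s (z - m * s ^+ 2))%:E)%E.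
transitivity (\int[leb]_b q (b + m * s ^+ 2)%R)%E.
  by apply: eq_integral => b _; rewrite /q addrK.
rewrite ge0_integral_shift; first last.
- by move=> z; rewrite /q !mule_ge0// lee_fin ?normal_pdf_ge0// ltW// gig_factor_gt0.
- by rewrite /q; measurability.
by apply: eq_integral => z _; rewrite /q muleAC -EFinM normal_gig_factorE muleC.
Qed.

Variable gam : {measure set (measurableTypeR R) -> \bar R}.
Hypothesis gamE : forall U : set R, measurable U -> gam U =
  (\int[leb]_(u in U `&` `]0%R, +oo[%classic) (c * u `^ (mu - 1) * expR (- u))%:E)%E.

Lemma measurable_gamma_weight : measurable_fun setT (gamma_weight mu).
Proof. by rewrite /gamma_weight; measurability. Qed.

Lemma gamma_weight_ge0 v : 0 <= gamma_weight mu v.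
Proof. by rewrite /gamma_weight !mulr_ge0 ?expR_ge0 ?powR_ge0. Qed.

Lemma ge0_integral_gamma (k : R -> \bar R) :
  measurable_fun setT k -> (forall x, (0 <= k x)%E) ->
  (\int[gam]_v k v = \int[leb]_v (k v * (c * gamma_weight mu v)%:E))%E.
Proof.
move=> mk k0; have mg := measurable_gamma_weight.
rewrite (@ge0_integral_density _ (measurableTypeR R) R leb (fun v => c * gamma_weight mu v) _ _ gam)//.
- by move=> v; rewrite mulr_ge0// gamma_weight_ge0.
- by measurability.
- move=> U mU; rewrite gamE// integral_mkcondr; apply: eq_integral => v _.
  rewrite patchE /gamma_weight indicE; case: ifPn => _; first by rewrite mul1r mulrA.
  by rewrite !mul0r mulr0.
Qed.

Lemma one_step_aux m (Phi : R * R -> \bar R) :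
  measurable_fun setT Phi -> (forall p, (0 <= Phi p)%E) ->
  (\int[gam]_v \int[N]_b ((gig_factor s (b + m * s ^+ 2))%:E *
     Phi (v, b + m * s ^+ 2)%R) =
   \int[leb]_v \int[leb]_z ((c * gig_const m)%:E * Phi (v, z) *
     (gamma_weight mu v * gig_weight (s ^+ 2) m z)%:E))%E.
Proof.
move=> mPhi Phi0; have mg := measurable_gig_factor s.
have mw : measurable_fun setT (gig_weight (s ^+ 2) m).
  by rewrite /gig_weight; measurability.
pose F (p : R * R) := ((gig_factor s (p.2 + m * s ^+ 2))%:E * Phi (p.1, p.2 + m * s ^+ 2)%R)%E.
have F0 p : (0 <= F p)%E by rewrite mule_ge0// lee_fin ltW// gig_factor_gt0.
have mF : measurable_fun setT F.
  rewrite /F; apply: emeasurable_funM; first by measurability.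
  by apply: (measurable_fun_compT (f := fun p : R * R => (p.1, p.2 + m * s ^+ 2)) mPhi); measurability.
rewrite (@ge0_integral_gamma (fun v => \int[N]_b F (v, b)))%E; first last.
- by move=> v; apply: integral_ge0 => b _.
- exact: (@measurable_fun_fubini_tonelli_F _ _ (measurableTypeR R) (measurableTypeR R) R N F mF F0).
apply: eq_integral => v _; rewrite /F/=.
rewrite (@ge0_integral_normal_gig m (fun z => Phi (v, z))); first last.
- by [].
- exact: measurable_fun_pair2.
rewrite -ge0_integralZr//; first last.
- by rewrite lee_fin mulr_ge0// gamma_weight_ge0.
- by move=> z _; rewrite mule_ge0// lee_fin !mulr_ge0 ?expR_ge0 ?normal_peak_ge0.
- apply: emeasurable_funM; first exact: measurable_fun_pair2.
  by measurability.
by apply: eq_integral => z _; rewrite [RHS]muleAC [RHS]muleC -muleA -!EFinM; congr (_ * _%:E)%E; ring.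
Qed.

Lemma one_step_exchange (H : R * R -> \bar R) :
  measurable_fun setT H -> (forall p, (0 <= H p)%E) ->
  (\int[gam]_v \int[N]_b ((gig_factor s (b + mu * s ^+ 2))%:E *
     H (gig_step (s ^+ 2) v (b + mu * s ^+ 2),
        v * expR (b + mu * s ^+ 2 + gig_step (s ^+ 2) v (b + mu * s ^+ 2)))%R) =
   \int[gam]_v \int[N]_b ((gig_factor s (b - mu * s ^+ 2))%:E *
     H (b - mu * s ^+ 2, v)%R))%E.
Proof.
move=> mH H0; rewrite -mulNr.
pose L (p : R * R) := H (gig_step (s ^+ 2) p.1 p.2,
  p.1 * expR (p.2 + gig_step (s ^+ 2) p.1 p.2))%R.
pose M (p : R * R) := H (p.2, p.1).
have mL : measurable_fun setT L.
  apply: (measurable_fun_compT (f := fun p : R * R => (gig_step (s ^+ 2) p.1 p.2,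
    p.1 * expR (p.2 + gig_step (s ^+ 2) p.1 p.2))%R) mH).
  by rewrite /gig_step; measurability.
have mM : measurable_fun setT M.
  by apply: (measurable_fun_compT (f := fun p : R * R => (p.2, p.1)) mH); measurability.
have L0 p : (0 <= L p)%E by exact: H0.
have M0 p : (0 <= M p)%E by exact: H0.
apply: (etrans (one_step_aux mu mL L0)).
apply: (etrans _ (esym (one_step_aux (- mu) mM M0))).
have K0 : 0 <= c * gig_const mu.
  by rewrite !mulr_ge0 ?normal_peak_ge0 ?expR_ge0.
pose h p := ((c * gig_const mu)%:E * H p)%E.
have mh : measurable_fun setT h by apply: emeasurable_funM.
have h0 p : (0 <= h p)%E by rewrite /h mule_ge0.
apply: (etrans (gig_exchange mu (exprn_gt0 2 s0) mh h0)).
by rewrite /h /M /gig_const sqrrN.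
Qed.

End one_step.

(** * Random walks *)

Section independence.
Local Open Scope ereal_scope.
Context d (T : measurableType d) (R : realType) (P : probability T R).
Context d1 (E : measurableType d1) d2 (F : measurableType d2).

Lemma ge0_integral_indep (X : T -> E) (Y : T -> F) (nu : probability F R)
    (H : E * F -> \bar R) :
  measurable_fun setT X -> measurable_fun setT Y ->
  (forall A C, measurable A -> measurable C ->
    P (X @^-1` A `&` Y @^-1` C) = P (X @^-1` A) * nu C) ->
  measurable_fun setT H -> (forall p, 0 <= H p) ->
  \int[P]_w H (X w, Y w) = \int[P]_w \int[nu]_y H (X w, y).
Proof.
move=> mX mY ind mH H0.
pose X' : {mfun T >-> E} := HB.pack X (isMeasurableFun.Build _ _ _ _ X mX).
have mXY : measurable_fun setT (fun w => (X w, Y w)) by exact: measurable_fun_pair.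
pose XY : {mfun T >-> (E * F)%type} :=
  HB.pack (fun w => (X w, Y w)) (isMeasurableFun.Build _ _ _ _ _ mXY).
transitivity (\int[distribution P XY]_p H p).
  by rewrite ge0_integral_distribution.
transitivity (\int[distribution P X' \x nu]_p H p).
  apply: eq_measure_integral => A mA _; apply/esym.
  have Q := @product_measure_unique _ _ _ _ R (distribution P X' : {sigma_finite_measure set _ -> \bar R}) nu (distribution P XY).
  by apply: Q => // C D mC mD; exact: ind.
apply: (etrans (@fubini_tonelli1 _ _ E F R (distribution P X') nu H mH H0)).
rewrite ge0_integral_distribution//.
- exact: (@measurable_fun_fubini_tonelli_F _ _ E F R nu H mH H0).
- by move=> x; apply: integral_ge0 => y _.
Qed.

End independence.

Section chain.
Context d (T : measurableType d) (R : realType) (P : probability T R).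
Variables (mu s c : R) (beta : nat -> T -> R) (gam : T -> R).
Hypotheses (s0 : 0 < s) (c0 : 0 <= c).
Hypothesis mbeta : forall i, measurable_fun setT (beta i).
Hypothesis mgam : measurable_fun setT gam.
Hypothesis gam_law : forall U : set R, measurable U -> P (gam @^-1` U) =
  (\int[lebesgue_measure]_(u in U `&` `]0%R, +oo[%classic)
    (c * u `^ (mu - 1) * expR (- u))%:E)%E.
Hypothesis beta_gam_indep : forall n (V : set R) (U : nat -> set R),
  measurable V -> (forall i, measurable (U i)) ->
  P (gam @^-1` V `&` [set w | forall i, (i < n)%N -> U i (beta i w)]) =
  (P (gam @^-1` V) * \prod_(i < n) normal_prob 0 s (U i))%E.

Local Notation N := (normal_prob (0 : R) s).

Definition past_sets n : set (set T) := [set C | exists V : set R, exists U : nat -> set R,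
  [/\ measurable V, forall i, measurable (U i) &
      C = gam @^-1` V `&` [set w | forall i, (i < n)%N -> U i (beta i w)]]].

Lemma measurable_past_set n V U : measurable V -> (forall i, measurable (U i)) ->
  measurable (gam @^-1` V `&` [set w | forall i, (i < n)%N -> U i (beta i w)]).
Proof.
move=> mV mU; apply: measurableI.
  by rewrite -[X in measurable X]setTI; exact: mgam.
rewrite (_ : [set w | _] = \bigcap_(i < n) (beta i @^-1` U i)).
  apply: bigcap_measurableType => i _.
  by rewrite -[X in measurable X]setTI; exact: mbeta.
by apply/seteqP; split.
Qed.

Lemma past_sets_measurable n : past_sets n `<=` measurable.
Proof. by move=> _ [V [U [mV mU ->]]]; exact: measurable_past_set. Qed.

(** As functions of [C] both sides are finite measures, and they agree on [past_sets n], which is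
    stable under intersection. *)
Lemma past_indep n (C : set T) (U : set R) : <<s past_sets n >> C -> measurable U ->
  P (C `&` beta n @^-1` U) = (P C * N U)%E.
Proof.
move=> sC mU.
have mbU : measurable (beta n @^-1` U).
  by rewrite -[X in measurable X]setTI; exact: mbeta.
have NU0 : 0 <= fine (N U) by rewrite fine_ge0.
have NUfin : N U \is a fin_num by exact: fin_num_measure.
rewrite muleC -(fineK NUfin).
apply: (@g_sigma_algebra_measure_unique _ R T (past_sets n) (@past_sets_measurable n)
  (fun=> setT) _ _ (mrestr P mbU) (mscale (NngNum NU0) P)) => //.
- move=> k; exists setT, (fun=> setT); split => //.
  by apply/seteqP; split.
- by rewrite bigcup_const.
- move=> _ _ [V [W [mV mW ->]]] [V' [W' [mV' mW' ->]]].
  exists (V `&` V'), (fun i => W i `&` W' i); split.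
  + exact: measurableI.
  + by move=> i; exact: measurableI.
  + apply/seteqP; split => w /=.
      by move=> [[? a] [? b]]; do 2 split => //; [exact: a|exact: b].
    by move=> [[? ?] a]; split; split => // i /a [].
- move=> _ [V [W [mV mW ->]]].
  (* The event on step [n] becomes one more constraint, so the product formula for [n.+1] steps
     gives the left side and the formula for [n] steps the right one. *)
  pose W' i := if i == n then U else W i.
  have mW' i : measurable (W' i) by rewrite /W'; case: ifP.
  transitivity (P (gam @^-1` V `&`
    [set w | forall i, (i < n.+1)%N -> W' i (beta i w)])).
    rewrite /mrestr; congr (P _).
    apply/seteqP; split => w /=.
      move=> [[gV a] b]; split => // i; rewrite ltnS leq_eqVlt /W'.
      by case: (eqVneq i n) => [->|_ /= ni] //; exact: a.
    move=> [gV a]; split; first split => //.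
      by move=> i ni; have := a i (ltnW ni); rewrite /W' (ltn_eqF ni).
    by have := a n (ltnSn n); rewrite /W' eqxx.
  rewrite beta_gam_indep// big_ord_recr/= /W' eqxx muleA.
  rewrite /mscale/= fineK// [RHS]muleC; congr (_ * _)%E.
  rewrite beta_gam_indep//; congr (_ * _)%E.
  by apply: eq_bigr => i _; rewrite (ltn_eqF (ltn_ord i)).
- move=> k; rewrite /mrestr; apply: (@le_lt_trans _ _ 1%E); last exact: ltry.
  by apply: probability_le1; exact: measurableI.
Qed.

(** The sample space with the sigma-algebra of [gam] and the first [n] steps. A function of the past
    is then a measurable function on this type, and the identity from [T] acts as the random
    variable independent of [beta n]. *)
Definition pastT n : measurableType _ := g_sigma_algebraType (past_sets n).

Lemma measurable_gam_past n : measurable_fun setT (gam : pastT n -> R).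
Proof.
move=> _ V mV; rewrite setTI; apply: sub_sigma_algebra.
exists V, (fun=> setT); split => //.
by apply/seteqP; split => w //= [].
Qed.

Lemma measurable_beta_past n i : (i < n)%N ->
  measurable_fun setT (beta i : pastT n -> R).
Proof.
move=> ni _ V mV; rewrite setTI; apply: sub_sigma_algebra.
exists setT, (fun j => if j == i then V else setT); split => //.
  by move=> j; case: ifP.
apply/seteqP; split => w /=.
  by move=> Vw; split => // j nj; case: eqVneq => [->|].
by move=> [_ /(_ i ni)]; rewrite eqxx.
Qed.

Lemma measurable_id_past n : measurable_fun setT (id : T -> pastT n).
Proof.
move=> _ A mA; rewrite setTI preimage_id.
apply: (smallest_sub (@sigma_algebra_measurable _ T) (@past_sets_measurable n)).
exact: mA.
Qed.

Lemma ge0_integral_past n (H : pastT n * measurableTypeR R -> \bar R) :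
  measurable_fun setT H -> (forall p, (0 <= H p)%E) ->
  (\int[P]_w H (w, beta n w) = \int[P]_w \int[N]_b H (w, b))%E.
Proof.
move=> mH H0.
apply: (@ge0_integral_indep _ T R P _ (pastT n) _ (measurableTypeR R) id (beta n) N H) => //.
- exact: measurable_id_past.
- exact: mbeta.
- by move=> A C mA mC; rewrite preimage_id past_indep.
Qed.

End chain.

Section walks.
Context {R : realType} {T : Type}.
Variables (mu s : R) (beta : nat -> T -> R) (gam : T -> R).

(** The state is the position together with the current gamma variable, which every step replaces by
    the second component of the exchange map. *)
Fixpoint gig_walk n (w : T) : R * R :=
  if n is n'.+1 then
    let p := gig_walk n' w in let z := beta n' w + mu * s ^+ 2 in
    let y := gig_step (s ^+ 2) p.2 z in (p.1 + y, p.2 * expR (z + y))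
  else (0, gam w).

Fixpoint drift_walk n (w : T) : R :=
  if n is n'.+1 then drift_walk n' w + (beta n' w - mu * s ^+ 2) else 0.

Variable f : nat -> R -> R.

(** Each step contributes its [gig_factor] and a test [f] of the position reached; products of such
    tests determine the finite-dimensional laws. *)
Fixpoint gig_walk_weight n (w : T) : R :=
  if n is n'.+1 then gig_walk_weight n' w *
    (gig_factor s (beta n' w + mu * s ^+ 2) * f n' (gig_walk n w).1)
  else 1.

Fixpoint drift_walk_weight n (w : T) : R :=
  if n is n'.+1 then drift_walk_weight n' w *
    (gig_factor s (beta n' w - mu * s ^+ 2) * f n' (drift_walk n w))
  else 1.

Hypothesis f0 : forall i x, 0 <= f i x.

Lemma gig_walk_weight_ge0 n w : 0 <= gig_walk_weight n w.
Proof.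
by elim: n => //= n IH; rewrite !mulr_ge0// ltW// gig_factor_gt0.
Qed.

Lemma drift_walk_weight_ge0 n w : 0 <= drift_walk_weight n w.
Proof.
by elim: n => //= n IH; rewrite !mulr_ge0// ltW// gig_factor_gt0.
Qed.

End walks.

Section walks_measurable.
Context d (T : measurableType d) (R : realType).
Variables (mu s : R) (beta : nat -> T -> R) (gam : T -> R) (n : nat).
Hypothesis mbeta : forall i, (i < n)%N -> measurable_fun setT (beta i).
Hypothesis mgam : measurable_fun setT gam.
Variable f : nat -> R -> R.
Hypothesis mf : forall i, measurable_fun setT (f i).

Lemma measurable_gig_walk k : (k <= n)%N ->
  measurable_fun setT (fun w => (gig_walk mu s beta gam k w).1) /\
  measurable_fun setT (fun w => (gig_walk mu s beta gam k w).2).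
Proof.
elim: k => [_|k IH kn]; first by split.
have [m1 m2] := IH (ltnW kn); have mb := mbeta kn.
by split; rewrite /= /gig_step; measurability.
Qed.

Lemma measurable_drift_walk k : (k <= n)%N ->
  measurable_fun setT (drift_walk mu s beta k).
Proof.
elim: k => [_|k IH kn]; first exact: measurable_cst.
have m1 := IH (ltnW kn); have mb := mbeta kn.
by rewrite /=; measurability.
Qed.

Lemma measurable_gig_walk_weight k : (k <= n)%N ->
  measurable_fun setT (gig_walk_weight mu s beta gam f k).
Proof.
elim: k => [_|k IH kn]; first exact: measurable_cst.
have m1 := IH (ltnW kn); have mb := mbeta kn.
have [m2 m3] := measurable_gig_walk kn.
apply: measurable_funM => //; apply: measurable_funM.
  by have mg := measurable_gig_factor s; measurability.
exact: (measurable_fun_compT (mf k) m2).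
Qed.

Lemma measurable_drift_walk_weight k : (k <= n)%N ->
  measurable_fun setT (drift_walk_weight mu s beta f k).
Proof.
elim: k => [_|k IH kn]; first exact: measurable_cst.
have m1 := IH (ltnW kn); have mb := mbeta kn.
have m2 := measurable_drift_walk kn.
apply: measurable_funM => //; apply: measurable_funM.
  by have mg := measurable_gig_factor s; measurability.
exact: (measurable_fun_compT (mf k) m2).
Qed.

End walks_measurable.

Section chain.
Context d (T : measurableType d) (R : realType) (P : probability T R).
Variables (mu s c : R) (beta : nat -> T -> R) (gam : T -> R).
Hypotheses (s0 : 0 < s) (c0 : 0 <= c).
Hypothesis mbeta : forall i, measurable_fun setT (beta i).
Hypothesis mgam : measurable_fun setT gam.
Hypothesis gam_law : forall U : set R, measurable U -> P (gam @^-1` U) =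
  (\int[lebesgue_measure]_(u in U `&` `]0%R, +oo[%classic)
    (c * u `^ (mu - 1) * expR (- u))%:E)%E.
Hypothesis beta_gam_indep : forall n (V : set R) (U : nat -> set R),
  measurable V -> (forall i, measurable (U i)) ->
  P (gam @^-1` V `&` [set w | forall i, (i < n)%N -> U i (beta i w)]) =
  (P (gam @^-1` V) * \prod_(i < n) normal_prob 0 s (U i))%E.

Local Notation N := (normal_prob (0 : R) s).
Local Notation RR := (measurableTypeR R).

Let gam' : {mfun T >-> RR} :=
  HB.pack (gam : T -> RR) (isMeasurableFun.Build _ _ T RR gam mgam).
Let G : probability RR R := distribution P gam'.

Variable f : nat -> R -> R.
Hypothesis f0 : forall i x, 0 <= f i x.
Hypothesis mf : forall i, measurable_fun setT (f i).

Local Notation walk := (gig_walk mu s beta gam).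
Local Notation wt := (gig_walk_weight mu s beta gam f).
Local Notation dwalk := (drift_walk mu s beta).
Local Notation dwt := (drift_walk_weight mu s beta f).

(** [h] also sees the gamma variable: the induction needs that, under the weight, this variable is
    again gamma and independent of the positions after [n] steps, which is what the integral over
    [G] on the right expresses. *)
Lemma chain_exchange n (h : R * R -> \bar R) :
  measurable_fun setT h -> (forall p, (0 <= h p)%E) ->
  (\int[P]_w ((wt n w)%:E * h (walk n w)) =
   \int[P]_w ((dwt n w)%:E * \int[G]_v h (dwalk n w, v)))%E.
Proof.
elim: n h => [|n IH] h mh h0.
  have mh0 : measurable_fun setT (fun v : RR => h (0, v)) by exact: measurable_fun_pair2.
  rewrite /= (@integral_cst _ T R P setT measurableT (1%:E * \int[G]_v h (0%R, v))%E).
  rewrite [X in (_ * X)%E](_ : _ = 1%E); last exact: probability_setT.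
  rewrite mule1 mul1e ge0_integral_distribution//.
  by apply: eq_integral => w _; rewrite mul1e.
have mg := measurable_gig_factor s.
have mfn := mf n.
(* [K1] and [K2] are the contributions of step [n.+1] to the two sides, given the state before the
   step and the increment. *)
pose K1 (q : R * R * R) : \bar R :=
  let y := gig_step (s ^+ 2) q.1.2 (q.2 + mu * s ^+ 2) in
  ((gig_factor s (q.2 + mu * s ^+ 2))%:E *
   ((f n (q.1.1 + y))%:E *
    h (q.1.1 + y, q.1.2 * expR (q.2 + mu * s ^+ 2 + y))%R))%E.
pose K2 (q : R * R) : \bar R :=
  ((gig_factor s (q.2 - mu * s ^+ 2))%:E *
   ((f n (q.1 + (q.2 - mu * s ^+ 2)))%:E *
    \int[G]_v h (q.1 + (q.2 - mu * s ^+ 2), v)%R))%E.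
have K10 q : (0 <= K1 q)%E by rewrite /K1 !mule_ge0// lee_fin// ltW// gig_factor_gt0.
have K20 q : (0 <= K2 q)%E.
  by rewrite /K2 !mule_ge0 ?integral_ge0// lee_fin// ltW// gig_factor_gt0.
have mK1 : measurable_fun setT K1.
  rewrite /K1 /gig_step; apply: emeasurable_funM; first by measurability.
  apply: emeasurable_funM; first by measurability.
  apply: (measurable_fun_compT (f := fun q : R * R * R => (q.1.1 +
    gig_step (s ^+ 2) q.1.2 (q.2 + mu * s ^+ 2), q.1.2 * expR (q.2 + mu * s ^+ 2 +
    gig_step (s ^+ 2) q.1.2 (q.2 + mu * s ^+ 2)))) mh).
  by rewrite /gig_step; measurability.
have mK2 : measurable_fun setT K2.
  rewrite /K2; apply: emeasurable_funM; first by measurability.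
  apply: emeasurable_funM; first by measurability.
  pose h' (q : R * R * RR) := h (q.1.1 + (q.1.2 - mu * s ^+ 2), q.2).
  have mh' : measurable_fun setT h'.
    by apply: (measurable_fun_compT (f := fun q : R * R * RR => (q.1.1 +
      (q.1.2 - mu * s ^+ 2), q.2)) mh); measurability.
  exact: (@measurable_fun_fubini_tonelli_F _ _ _ RR R G h' mh' (fun q => h0 _)).
transitivity (\int[P]_w ((wt n w)%:E * K1 (walk n w, beta n w)))%E.
  by apply: eq_integral => w _; rewrite /K1 /= !EFinM !muleA.
(* Everything built from the first [n] steps is measurable on [pastT], hence independent of
   [beta n]. *)
have mb i : (i < n)%N -> measurable_fun setT (beta i : pastT beta gam n -> R).
  exact: measurable_beta_past.
have mgm : measurable_fun setT (gam : pastT beta gam n -> R).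
  exact: measurable_gam_past.
have [mw1 mw2] := measurable_gig_walk mu s mb mgm (leqnn n).
have mwt := measurable_gig_walk_weight mu s mb mgm mf (leqnn n).
have mdw := measurable_drift_walk mu s mb (leqnn n).
have mdwt := measurable_drift_walk_weight mu s mb mf (leqnn n).
transitivity (\int[P]_w \int[N]_b ((wt n w)%:E * K1 (walk n w, b)))%E.
  pose H (q : pastT beta gam n * RR) := ((wt n q.1)%:E * K1 (walk n q.1, q.2))%E.
  apply: (ge0_integral_past mbeta mgam beta_gam_indep (H := H)).
  - rewrite /H; apply: emeasurable_funM; first by measurability.
    apply: (measurable_fun_compT (f := fun q : pastT beta gam n * RR => (walk n q.1, q.2)) mK1).
    apply: measurable_fun_pair => //; apply/measurable_fun_pairP; split.
      exact: (measurable_fun_compT mw1).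
    exact: (measurable_fun_compT mw2).
  - by move=> q; rewrite /H mule_ge0// lee_fin gig_walk_weight_ge0.
transitivity (\int[P]_w ((wt n w)%:E * \int[N]_b K1 (walk n w, b)))%E.
  apply: eq_integral => w _; rewrite ge0_integralZl//.
  - exact: measurable_fun_pair2.
  - by rewrite lee_fin gig_walk_weight_ge0.
(* With the last increment integrated out, the rest is a function of the state after [n] steps; the
   induction hypothesis makes the gamma variable fresh, and the one-step exchange then applies at
   each fixed position. *)
rewrite (IH (fun p => \int[N]_b K1 (p, b))%E); last 2 first.
- exact: (@measurable_fun_fubini_tonelli_F _ _ _ RR R N K1 mK1 K10).
- by move=> p; exact: integral_ge0.
transitivity (\int[P]_w ((dwt n w)%:E * \int[N]_b K2 (dwalk n w, b)))%E.
  apply: eq_integral => w _; congr (_ * _)%E.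
  pose y := dwalk n w.
  pose H (p : R * R) := ((f n (y + p.1))%:E * h (y + p.1, p.2)%R)%E.
  have mH : measurable_fun setT H.
    apply: emeasurable_funM; first by measurability.
    by apply: (measurable_fun_compT (f := fun p : R * R => (y + p.1, p.2)) mh); measurability.
  have H0 p : (0 <= H p)%E by rewrite mule_ge0// lee_fin.
  have GE (U : set R) : measurable U -> G U = (\int[lebesgue_measure]_(u in
      U `&` `]0%R, +oo[%classic) (c * u `^ (mu - 1) * expR (- u))%:E)%E.
    exact: gam_law.
  apply: (etrans (one_step_exchange s0 c0 GE mH H0)).
  pose L (q : RR * RR) := ((gig_factor s (q.2 - mu * s ^+ 2))%:E * H (q.2 - mu * s ^+ 2, q.1)%R)%E.
  have mL : measurable_fun setT L.
    apply: emeasurable_funM; first by measurability.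
    by apply: (measurable_fun_compT (f := fun q : RR * RR => (q.2 - mu * s ^+ 2, q.1)) mH); measurability.
  have L0 q : (0 <= L q)%E by rewrite mule_ge0// lee_fin ltW// gig_factor_gt0.
  apply: (etrans (@fubini_tonelli _ _ RR RR R G N L mL L0)).
  apply: eq_integral => b _; rewrite /L /H /K2 /=.
  have mhb : measurable_fun setT (fun v : RR => h (y + (b - mu * s ^+ 2), v)).
    exact: measurable_fun_pair2.
  rewrite -ge0_integralZl//; last by rewrite lee_fin.
  rewrite -ge0_integralZl//.
  - exact: emeasurable_funM.
  - by move=> v _; rewrite mule_ge0// lee_fin.
  - by rewrite lee_fin ltW// gig_factor_gt0.
transitivity (\int[P]_w \int[N]_b ((dwt n w)%:E * K2 (dwalk n w, b)))%E.
  apply: eq_integral => w _; rewrite ge0_integralZl//.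
  - exact: measurable_fun_pair2.
  - by rewrite lee_fin drift_walk_weight_ge0.
transitivity (\int[P]_w ((dwt n w)%:E * K2 (dwalk n w, beta n w)))%E.
  apply/esym.
  pose H (q : pastT beta gam n * RR) := ((dwt n q.1)%:E * K2 (dwalk n q.1, q.2))%E.
  apply: (ge0_integral_past mbeta mgam beta_gam_indep (H := H)).
  - rewrite /H; apply: emeasurable_funM; first by measurability.
    apply: (measurable_fun_compT (f := fun q : pastT beta gam n * RR => (dwalk n q.1, q.2)) mK2).
    by apply: measurable_fun_pair => //; exact: (measurable_fun_compT mdw).
  - by move=> q; rewrite /H mule_ge0// lee_fin drift_walk_weight_ge0.
by apply: eq_integral => w _; rewrite /K2 /= !EFinM !muleA.
Qed.

End chain.

(** * Comparison of the Gaussian and generalized inverse Gaussian walks *)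

Section bounded_expectation.
Context d (T : measurableType d) (R : realType) (P : probability T R).
Implicit Types (f q F : T -> R).

Lemma bounded_integrable f C : measurable_fun setT f ->
  (forall w, `|f w| <= C) -> P.-integrable setT (EFin \o f).
Proof.
move=> mf fC; apply: measurable_bounded_integrable => //.
  by rewrite (le_lt_trans (probability_le1 P _)) ?ltry.
exists C; split; first exact: num_real.
by move=> M CM w _ /=; rewrite (le_trans (fC w))// ltW.
Qed.

Lemma integral_EFin_Rintegral f C : measurable_fun setT f ->
  (forall w, `|f w| <= C) ->
  (\int[P]_w (f w)%:E = (\int[P]_w f w)%R%:E)%E.
Proof.
move=> mf fC; rewrite fineK//; apply: integrable_fin_num => //.
exact: (bounded_integrable mf fC).
Qed.

Lemma Rintegral_prob_cst r : \int[P]_w r = r.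
Proof.
rewrite Rintegral_cst// [X in fine X](_ : _ = 1%E) ?mulr1//.
exact: probability_setT.
Qed.

Lemma norm01 (x : R) : 0 <= x <= 1 -> `|x| <= 1.
Proof. by move=> /andP[x0 x1]; rewrite ger0_norm. Qed.

Lemma Rintegral_sqr_sub q a : measurable_fun setT q -> (forall w, 0 <= q w <= 1) ->
  \int[P]_w ((q w - a) ^+ 2) =
  \int[P]_w (q w ^+ 2) - 2 * a * (\int[P]_w q w) + a ^+ 2.
Proof.
move=> mq q01.
have iq : P.-integrable setT (EFin \o q).
  by apply: (bounded_integrable (C := 1)) => // w; exact: norm01.
have iq2 : P.-integrable setT (EFin \o (fun w => q w ^+ 2)).
  apply: (bounded_integrable (C := 1)) => [|w]; first exact: measurable_funX.
  by rewrite normrX exprn_ile1// norm01.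
have iaq : P.-integrable setT (EFin \o (fun w => 2 * a * q w)).
  exact: (integrableZl measurableT (2 * a) iq).
have ia : P.-integrable setT (EFin \o (fun w : T => a ^+ 2)).
  by apply: (bounded_integrable (C := `|a ^+ 2|)).
have id : P.-integrable setT (EFin \o (fun w => q w ^+ 2 - 2 * a * q w)).
  exact: (integrableB measurableT iq2 iaq).
transitivity (\int[P]_w (q w ^+ 2 - 2 * a * q w + a ^+ 2)).
  by apply: eq_Rintegral => w _; ring.
by rewrite RintegralD// RintegralB// RintegralZl// Rintegral_prob_cst.
Qed.

(* AM-GM: [`|a - q| <= (e + (q - a) ^+ 2 / e) / 2] *)
Lemma Rintegral_mul_dev q F a e : 0 < e -> 0 <= a <= 1 ->
  measurable_fun setT q -> (forall w, 0 <= q w <= 1) ->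
  measurable_fun setT F -> (forall w, 0 <= F w <= 1) ->
  `|a * (\int[P]_w F w) - \int[P]_w (q w * F w)| <=
    (e + (\int[P]_w ((q w - a) ^+ 2)) / e) / 2.
Proof.
move=> e0 a01 mq q01 mF F01.
have iF : P.-integrable setT (EFin \o F).
  by apply: (bounded_integrable (C := 1)) => // w; exact: norm01.
have mqF : measurable_fun setT (fun w => q w * F w) by exact: measurable_funM.
have iqF : P.-integrable setT (EFin \o (fun w => q w * F w)).
  by apply: (bounded_integrable (C := 1)) => // w; rewrite normrM mulr_ile1// norm01.
have iaF : P.-integrable setT (EFin \o (fun w => a * F w)).
  exact: (integrableZl measurableT a iF).
have mqa : measurable_fun setT (fun w => (q w - a) ^+ 2).
  by apply: measurable_funX; apply: measurable_funB.
have iqa : P.-integrable setT (EFin \o (fun w => (q w - a) ^+ 2)).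
  apply: (bounded_integrable (C := 1)) => // w.
  rewrite normrX exprn_ile1// ler_norml.
  by move: (q01 w) a01 => /andP[? ?] /andP[? ?]; apply/andP; split; lra.
have iqa2 : P.-integrable setT (EFin \o (fun w => (2 * e)^-1 * (q w - a) ^+ 2)).
  exact: (integrableZl measurableT _ iqa).
have ie : P.-integrable setT (EFin \o (fun w : T => e / 2)).
  by apply: (bounded_integrable (C := `|e / 2|)).
rewrite -RintegralZl// -RintegralB//.
have iB := integrableB measurableT iaF iqF.
apply: (le_trans (le_normr_Rintegral measurableT iB)).
rewrite (_ : (e + _ / e) / 2 = \int[P]_w (e / 2 + (2 * e)^-1 * (q w - a) ^+ 2)); last first.
  rewrite (RintegralD measurableT ie iqa2) (RintegralZl _ measurableT iqa) Rintegral_prob_cst.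
  by field; rewrite gt_eqF.
apply: le_Rintegral => //.
- exact: (integrable_norm iB).
- exact: (integrableD measurableT ie iqa2).
move=> w _; rewrite -mulrBl normrM.
apply: (@le_trans _ _ `|a - q w|); first by rewrite ler_piMr// norm01.
rewrite -subr_ge0 (_ : _ - _ = (2 * e)^-1 * (`|a - q w| - e) ^+ 2).
  by rewrite mulr_ge0 ?sqr_ge0// invr_ge0 mulr_ge0// ltW.
rewrite -(sqrrN (q w - a)) opprB -(@real_normK _ (a - q w)) ?num_real//.
by field; rewrite gt_eqF.
Qed.

End bounded_expectation.

Section gig_factor_moments.
Context {R : realType}.
Variables (m s : R).
Hypotheses (s0 : 0 < s).
Local Notation N := (normal_prob (0 : R) s).
Local Notation C := (variance_const m).
Hypothesis s1 : (1 + C) * s ^+ 2 <= 1.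

Let q b := gig_factor s (b + m * s ^+ 2).

Definition gig_mean : R := \int[N]_b gig_factor s (b + m * s ^+ 2).
Definition gig_second_moment : R := \int[N]_b (gig_factor s (b + m * s ^+ 2) ^+ 2).

Lemma measurable_shifted_gig_factor :
  measurable_fun setT (fun b : measurableTypeR R => gig_factor s (b + m * s ^+ 2)).
Proof. by have mg := measurable_gig_factor s; measurability. Qed.

Lemma gig_factor01 z : 0 <= gig_factor s z <= 1.
Proof. by rewrite ltW ?gig_factor_gt0//= gig_factor_le1. Qed.

Let s2_le1 : s ^+ 2 <= 1.
Proof.
apply: le_trans s1; rewrite mulrDl mul1r lerDl mulr_ge0 ?sqr_ge0//.
by rewrite ltW// variance_const_gt0.
Qed.

Let dev : \int[N]_b ((q b - 1) ^+ 2) <= C * s ^+ 4.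
Proof.
have mq := measurable_shifted_gig_factor.
have sle1 : s <= 1 by rewrite -(@ler_pXn2r _ 2)// ?nnegrE ?expr1n// ltW.
have := normal_gig_factor_bound s0 m sle1.
rewrite (@integral_EFin_Rintegral _ _ R N _ 1).
- rewrite lee_fin => H; apply: le_trans H.
  by rewrite le_eqVlt; apply/orP; left; apply/eqP; apply: eq_Rintegral => b _; rewrite -sqrrN opprB.
- by apply: measurable_funX; apply: measurable_funB.
- move=> b; rewrite normrX exprn_ile1// ler_norml.
  by have /andP[? ?] := gig_factor01 (b + m * s ^+ 2); apply/andP; split; lra.
Qed.

(** The variance is the second moment about [1] minus [(gig_mean - 1) ^+ 2]. *)
Lemma gig_variance : gig_second_moment - gig_mean ^+ 2 <= C * s ^+ 4.
Proof.
have := dev; rewrite Rintegral_sqr_sub; first last.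
- by move=> b; exact: gig_factor01.
- exact: measurable_shifted_gig_factor.
rewrite -/gig_mean -/gig_second_moment => H.
have := sqr_ge0 (gig_mean - 1); rewrite expr2 expr2; rewrite !expr2 in H; nra.
Qed.

(** Deviation bound with [F = 1] and [a = 1]; the choice [e = s ^+ 2] gives both terms order
    [s ^+ 2]. *)
Lemma gig_mean_ge : 1 - (1 + C) * s ^+ 2 / 2 <= gig_mean.
Proof.
have s20 : 0 < s ^+ 2 by rewrite exprn_gt0.
have mq := measurable_shifted_gig_factor.
have q01 b : 0 <= q b <= 1 by exact: gig_factor01.
have a01 : (0 : R) <= (1 : R) <= (1 : R) by apply/andP; split; rewrite ?ler01 ?lexx.
have one01 (b : measurableTypeR R) : (0 : R) <= (1 : R) <= (1 : R) by [].
have := @Rintegral_mul_dev _ _ R N q (fun=> 1) 1 (s ^+ 2) s20 a01 mq q01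
  (measurable_cst _) one01.
rewrite Rintegral_prob_cst mulr1 => H.
have := le_trans (ler_norm _) H.
have -> : \int[N]_w (q w * 1) = gig_mean by apply: eq_Rintegral => b _; rewrite mulr1.
move=> H2.
have : (s ^+ 2 + \int[N]_b ((q b - 1) ^+ 2) / s ^+ 2) / 2 <= (1 + C) * s ^+ 2 / 2.
  rewrite ler_pM2r ?invr_gt0// mulrDl mul1r lerD2l ler_pdivrMr// -mulrA -exprD.
  exact: dev.
by move=> H3; rewrite lerBlDr addrC -lerBlDr; exact: le_trans H2 H3.
Qed.

Lemma gig_mean01 : 0 <= gig_mean <= 1.
Proof.
have mq := measurable_shifted_gig_factor.
rewrite Rintegral_ge0/=; last first.
  by move=> b _; have /andP[] := gig_factor01 (b + m * s ^+ 2).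
rewrite -[leRHS](Rintegral_prob_cst N) le_Rintegral//.
- by apply: (@bounded_integrable _ _ _ _ _ 1) => // b; apply: norm01; exact: gig_factor01.
- by apply: (@bounded_integrable _ _ _ _ _ 1) => // b; rewrite normr1.
- by move=> b _; exact: gig_factor_le1.
Qed.

(** A lower bound that depends on the elapsed time but not on the mesh; the comparison of walks
    divides by this mean. *)
Lemma gig_mean_pow_ge n L : n%:R * s ^+ 2 <= L -> expR (- ((1 + C) * L)) <= gig_mean ^+ n.
Proof.
move=> nL; pose x := (1 + C) * s ^+ 2 / 2.
have C0 : 0 < C by exact: variance_const_gt0.
have x0 : 0 <= x by rewrite divr_ge0// mulr_ge0 ?sqr_ge0// addr_ge0// ltW.
have x2 : x <= 1 / 2 by rewrite ler_pM2r ?invr_gt0.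
(* [(1 - x)^-1 <= 1 + 2 * x <= expR (2 * x)] on [[0, 1/2]], and the smallness hypothesis on [s]
   gives [x <= 1/2]. *)
have ex : expR (- (2 * x)) <= gig_mean.
  apply: (le_trans _ gig_mean_ge); rewrite -/x expRN invf_ple ?posrE ?expR_gt0//; last lra.
  apply: (le_trans _ (expR_ge1Dx _)).
  by rewrite -[leLHS]mul1r ler_pdivrMr; nra.
apply: (@le_trans _ _ (expR (- (2 * x)) ^+ n)).
  rewrite -expRM_natl ler_expR mulrN lerN2 /x.
  rewrite (_ : n%:R * _ = (1 + C) * (n%:R * s ^+ 2)); last by field.
  by rewrite ler_pM2l// addr_gt0.
by rewrite lerXn2r ?nnegrE ?expR_ge0// (le_trans (expR_ge0 _) ex).
Qed.

Lemma gig_second_moment01 : gig_mean ^+ 2 <= gig_second_moment <= 1.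
Proof.
have mq := measurable_shifted_gig_factor.
have q01 b : 0 <= q b <= 1 by exact: gig_factor01.
have V := Rintegral_sqr_sub N gig_mean mq q01.
apply/andP; split.
  have : 0 <= \int[N]_b ((q b - gig_mean) ^+ 2).
    by apply: Rintegral_ge0 => b _; exact: sqr_ge0.
  rewrite V -/gig_mean -/gig_second_moment -[_ <= gig_second_moment]subr_ge0.
  by congr (0 <= _); ring.
rewrite -[leRHS](Rintegral_prob_cst N) le_Rintegral//.
- apply: (@bounded_integrable _ _ _ _ _ 1) => [|b]; first exact: measurable_funX.
  by rewrite normrX exprn_ile1// norm01// gig_factor01.
- by apply: (@bounded_integrable _ _ _ _ _ 1) => // b; rewrite normr1.
- by move=> b _; rewrite exprn_ile1//; have /andP[] := q01 b.
Qed.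

(** [a ^+ n - b ^+ n <= n * (a - b)] for [0 <= b <= a <= 1], with [a] the second moment and [b] the
    squared mean. By independence the left side is the variance of a product of [n] factors. *)
Lemma gig_variance_pow n : gig_second_moment ^+ n - (gig_mean ^+ n) ^+ 2 <=
  n%:R * (C * s ^+ 4).
Proof.
have /andP[ba a1] := gig_second_moment01.
have b0 : 0 <= gig_mean ^+ 2 by rewrite sqr_ge0.
have a0 := le_trans b0 ba.
rewrite exprAC; move: gig_variance ba a1 b0 a0.
move: (gig_mean ^+ 2) gig_second_moment => b a V ba a1 b0 a0.
elim: n => [|n IH]; first by rewrite !expr0 subrr mul0r.
rewrite (exprS a) (exprS b).
have abn : b ^+ n <= a ^+ n by rewrite lerXn2r ?nnegrE.
have bn1 : b ^+ n <= 1 by rewrite exprn_ile1// (le_trans ba).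
have bn0 : 0 <= b ^+ n by rewrite exprn_ge0.
have -> : a * a ^+ n - b * b ^+ n = a * (a ^+ n - b ^+ n) + b ^+ n * (a - b) by ring.
rewrite -natr1 mulrDl mul1r lerD//.
  by rewrite (le_trans _ IH)// ler_piMl// subr_ge0.
by rewrite (le_trans _ V)// ler_piMl// subr_ge0.
Qed.

End gig_factor_moments.

Lemma prod01 (R : realType) n (F : 'I_n -> R) :
  (forall i, 0 <= F i <= 1) -> 0 <= \prod_(i < n) F i <= 1.
Proof.
move=> F01; apply: (big_ind (fun x => 0 <= x <= 1)) => //.
- by rewrite ler01 lexx.
- by move=> x y /andP[x0 x1] /andP[y0 y1]; rewrite mulr_ge0// mulr_ile1.
Qed.

Section walk_compare.
Context d (T : measurableType d) (R : realType) (P : probability T R).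
Variables (mu s c : R) (beta : nat -> T -> R) (gam : T -> R).
Hypotheses (s0 : 0 < s) (c0 : 0 <= c).
Hypothesis mbeta : forall i, measurable_fun setT (beta i).
Hypothesis mgam : measurable_fun setT gam.
Hypothesis gam_law : forall U : set R, measurable U -> P (gam @^-1` U) =
  (\int[lebesgue_measure]_(u in U `&` `]0%R, +oo[%classic)
    (c * u `^ (mu - 1) * expR (- u))%:E)%E.
Hypothesis beta_gam_indep : forall n (V : set R) (U : nat -> set R),
  measurable V -> (forall i, measurable (U i)) ->
  P (gam @^-1` V `&` [set w | forall i, (i < n)%N -> U i (beta i w)]) =
  (P (gam @^-1` V) * \prod_(i < n) normal_prob 0 s (U i))%E.
Local Notation N := (normal_prob (0 : R) s).
Local Notation RR := (measurableTypeR R).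
Local Notation C := (variance_const mu).

Lemma expectation_prod_beta (q : R -> R) n : measurable_fun setT q ->
  (forall b, 0 <= q b <= 1) ->
  \int[P]_w (\prod_(j < n) q (beta j w)) = (\int[N]_b q b) ^+ n.
Proof.
move=> mq q01.
have mp k : measurable_fun setT (fun w => \prod_(j < k) q (beta j w)).
  by apply: measurable_prod => i _; exact: (measurable_fun_compT mq (mbeta i)).
have p01 k w : 0 <= \prod_(j < k) q (beta j w) <= 1 by exact: prod01.
have pE k : (\int[P]_w (\prod_(j < k) q (beta j w))%:E =
    (\int[P]_w (\prod_(j < k) q (beta j w)))%R%:E)%E.
  by apply: (@integral_EFin_Rintegral _ _ _ _ _ 1) => // w; exact: norm01.
have qE : (\int[N]_b (q b)%:E = (\int[N]_b q b)%R%:E)%E.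
  by apply: (@integral_EFin_Rintegral _ RR _ _ _ 1) => // w; exact: norm01.
elim: n => [|n IH].
  rewrite expr0 -[RHS](Rintegral_prob_cst P); apply: eq_Rintegral => w _.
  by rewrite big_ord0.
apply: EFin_inj; rewrite -pE.
pose H (x : pastT beta gam n * RR) := ((\prod_(j < n) q (beta j x.1))%:E * (q x.2)%:E)%E.
transitivity (\int[P]_w H (w, beta n w))%E.
  by apply: eq_integral => w _; rewrite big_ord_recr.
rewrite (ge0_integral_past mbeta mgam beta_gam_indep (H := H)); first last.
- by move=> x; rewrite /H mule_ge0// lee_fin; [have /andP[] := p01 n x.1|have /andP[] := q01 x.2].
- rewrite /H; apply: emeasurable_funM; last by measurability.
  apply/measurable_EFinP; apply: measurable_prod => i _.
  apply: (measurable_fun_compT mq).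
  have mbi : measurable_fun setT (beta i : pastT beta gam n -> R).
    exact: measurable_beta_past.
  exact: (measurable_fun_compT mbi measurable_fst).
transitivity (\int[P]_w ((\prod_(j < n) q (beta j w))%:E * \int[N]_b (q b)%:E))%E.
  apply: eq_integral => w _; rewrite /H /= ge0_integralZl//.
  - exact/measurable_EFinP.
  - by move=> b _; rewrite lee_fin; have /andP[] := q01 b.
  - by rewrite lee_fin; have /andP[] := p01 n w.
rewrite qE ge0_integralZr//.
- by rewrite pE IH -EFinM exprSr.
- exact/measurable_EFinP.
- by move=> w _; rewrite lee_fin; have /andP[] := p01 n w.
- by rewrite lee_fin Rintegral_ge0// => b _; have /andP[] := q01 b.
Qed.

Definition gig_prod m n (w : T) := \prod_(j < n) gig_factor s (beta j w + m * s ^+ 2).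

Lemma gig_prod01 m n w : 0 <= gig_prod m n w <= 1.
Proof. by apply: prod01 => i; exact: gig_factor01. Qed.

Lemma measurable_gig_prod m n : measurable_fun setT (gig_prod m n).
Proof.
apply: measurable_prod => i _; have mg := measurable_gig_factor s.
by have mb := mbeta i; measurability.
Qed.

Lemma expectation_gig_prod m n :
  \int[P]_w gig_prod m n w = gig_mean m s ^+ n.
Proof.
rewrite (@expectation_prod_beta (fun b => gig_factor s (b + m * s ^+ 2)))//.
- exact: measurable_shifted_gig_factor.
- by move=> b; exact: gig_factor01.
Qed.

Lemma expectation_gig_prod_dev m n : (1 + variance_const m) * s ^+ 2 <= 1 ->
  \int[P]_w ((gig_prod m n w - gig_mean m s ^+ n) ^+ 2) <=
  n%:R * (variance_const m * s ^+ 4).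
Proof.
move=> s1; apply: le_trans (gig_variance_pow s0 s1 n).
rewrite Rintegral_sqr_sub; [|exact: measurable_gig_prod|exact: gig_prod01].
rewrite expectation_gig_prod (_ : \int[P]_w _ = gig_second_moment m s ^+ n).
  by rewrite le_eqVlt; apply/orP; left; apply/eqP; ring.
rewrite -(@expectation_prod_beta (fun b => gig_factor s (b + m * s ^+ 2) ^+ 2)).
- by apply: eq_Rintegral => w _; rewrite /gig_prod -prodrXl.
- by apply: measurable_funX; exact: measurable_shifted_gig_factor.
- move=> b; have /andP[x0 x1] := gig_factor01 s (b + m * s ^+ 2).
  by rewrite exprn_ge0//= exprn_ile1.
Qed.

Local Notation walk := (gig_walk mu s beta gam).
Local Notation dwalk := (drift_walk mu s beta).

Variable f : nat -> R -> R.
Hypothesis f01 : forall i x, 0 <= f i x <= 1.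
Hypothesis mf : forall i, measurable_fun setT (f i).

Lemma gig_walk_weightE n w : gig_walk_weight mu s beta gam f n w =
  gig_prod mu n w * \prod_(j < n) f j (walk j.+1 w).1.
Proof.
rewrite /gig_prod; elim: n => [|n IH]; first by rewrite !big_ord0 mulr1.
by rewrite !big_ord_recr/= IH; ring.
Qed.

Lemma drift_walk_weightE n w : drift_walk_weight mu s beta f n w =
  gig_prod (- mu) n w * \prod_(j < n) f j (dwalk j.+1 w).
Proof.
rewrite /gig_prod; elim: n => [|n IH]; first by rewrite !big_ord0 mulr1.
by rewrite !big_ord_recr/= IH mulNr; ring.
Qed.

Lemma expectation_weight_exchange n :
  \int[P]_w (gig_prod mu n w * \prod_(j < n) f j (walk j.+1 w).1) =
  \int[P]_w (gig_prod (- mu) n w * \prod_(j < n) f j (dwalk j.+1 w)).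
Proof.
have f0 i x : 0 <= f i x by have /andP[] := f01 i x.
have := @chain_exchange _ _ _ P mu s c beta gam s0 c0 mbeta mgam gam_law beta_gam_indep
  f f0 mf n (cst 1%E) (measurable_cst _) (fun=> lee01).
rewrite /Rintegral => H; congr fine.
under eq_integral => w _ do rewrite -gig_walk_weightE -[(_)%:E]mule1.
under [RHS]eq_integral => w _ do rewrite -drift_walk_weightE -[(_)%:E]mule1.
apply: (etrans H); apply: eq_integral => w _; congr (_ * _)%E.
rewrite integral_cst// mul1e; exact: probability_setT.
Qed.

End walk_compare.

Section walk_compare_bound.
Context d (T : measurableType d) (R : realType) (P : probability T R).
Variables (mu s c : R) (beta : nat -> T -> R) (gam : T -> R).
Hypotheses (s0 : 0 < s) (c0 : 0 <= c).
Hypothesis mbeta : forall i, measurable_fun setT (beta i).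
Hypothesis mgam : measurable_fun setT gam.
Hypothesis gam_law : forall U : set R, measurable U -> P (gam @^-1` U) =
  (\int[lebesgue_measure]_(u in U `&` `]0%R, +oo[%classic)
    (c * u `^ (mu - 1) * expR (- u))%:E)%E.
Hypothesis beta_gam_indep : forall n (V : set R) (U : nat -> set R),
  measurable V -> (forall i, measurable (U i)) ->
  P (gam @^-1` V `&` [set w | forall i, (i < n)%N -> U i (beta i w)]) =
  (P (gam @^-1` V) * \prod_(i < n) normal_prob 0 s (U i))%E.
Local Notation C := (variance_const mu).
Hypothesis s1 : (1 + C) * s ^+ 2 <= 1.
Local Notation walk := (gig_walk mu s beta gam).
Local Notation dwalk := (drift_walk mu s beta).

(** The exchange with constant tests equates the total masses of the two weights, without computing
    either of them. *)
Lemma gig_mean_powN n : gig_mean (- mu) s ^+ n = gig_mean mu s ^+ n.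
Proof.
rewrite -!(expectation_gig_prod mbeta mgam beta_gam_indep).
have := expectation_weight_exchange s0 c0 mbeta mgam gam_law beta_gam_indep
  (f := fun _ _ => 1) (fun _ _ => _) (fun=> measurable_cst _) n.
have e (w : T) m (g : 'I_n -> R) : gig_prod s beta m n w * \prod_(j < n) (1 : R) =
    gig_prod s beta m n w by rewrite big1 ?mulr1.
move=> H; apply/esym; move: H.
rewrite (eq_Rintegral _ (g := gig_prod s beta mu n)); last by move=> w _; rewrite big1 ?mulr1.
rewrite [RHS](eq_Rintegral _ (g := gig_prod s beta (- mu) n)); last first.
  by move=> w _; rewrite big1 ?mulr1.
by apply=> _ _; rewrite ler01 lexx.
Qed.

Variable f : nat -> R -> R.
Hypothesis f01 : forall i x, 0 <= f i x <= 1.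
Hypothesis mf : forall i, measurable_fun setT (f i).

(** The weighted expectations coincide. On each side the weight is replaced by its mean [a], the
    same for both, at cost [(1 + C * L) * s / 2]; dividing by [a >= expR (- ((1 + C) * L))] gives
    the bound. *)
Lemma walk_compare n L : n%:R * s ^+ 2 <= L ->
  `|\int[P]_w (\prod_(j < n) f j (walk j.+1 w).1) -
    \int[P]_w (\prod_(j < n) f j (dwalk j.+1 w))| <=
  expR ((1 + C) * L) * (1 + C * L) * s.
Proof.
move=> nL; have C0 : 0 < C by exact: variance_const_gt0.
have VN : variance_const (- mu) = C by rewrite /variance_const normrN.
set F := fun w => \prod_(j < n) f j (walk j.+1 w).1.
set F' := fun w => \prod_(j < n) f j (dwalk j.+1 w).
have F01 w : 0 <= F w <= 1 by apply: prod01.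
have F'01 w : 0 <= F' w <= 1 by apply: prod01.
have mF : measurable_fun setT F.
  apply: measurable_prod => i _; apply: (measurable_fun_compT (mf i)).
  by have [] := @measurable_gig_walk _ T R mu s beta gam n (fun i _ => mbeta i) mgam i.+1 (ltn_ord i).
have mF' : measurable_fun setT F'.
  apply: measurable_prod => i _; apply: (measurable_fun_compT (mf i)).
  exact: (@measurable_drift_walk _ T R mu s beta n (fun i _ => mbeta i) i.+1 (ltn_ord i)).
pose a := gig_mean mu s ^+ n.
have a01 : 0 <= a <= 1.
  have /andP[k0 k1] := gig_mean01 mu s.
  by rewrite exprn_ge0//= exprn_ile1.
have aL : expR (- ((1 + C) * L)) <= a by exact: gig_mean_pow_ge.
(* The deviation bound is used with [e = s], which matches a standard deviation of order [s] for the
   product of the factors. *)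
have bnd x : x <= n%:R * (C * s ^+ 4) -> (s + x / s) / 2 <= (1 + C * L) * s / 2.
  move=> xb; rewrite ler_pM2r ?invr_gt0// mulrDl mul1r lerD2l ler_pdivrMr//.
  apply: (le_trans xb); rewrite (_ : _ * _ = C * s ^+ 2 * (n%:R * s ^+ 2)); last by ring.
  rewrite (_ : C * L * s * s = C * s ^+ 2 * L); last by ring.
  by rewrite ler_wpM2l// mulr_ge0 ?sqr_ge0 ?ltW.
have D1 := Rintegral_mul_dev P s0 a01 (measurable_gig_prod s mbeta mu n)
  (gig_prod01 s beta mu n) mF F01.
have D2 := Rintegral_mul_dev P s0 a01 (measurable_gig_prod s mbeta (- mu) n)
  (gig_prod01 s beta (- mu) n) mF' F'01.
have {}D1 := le_trans D1 (bnd _ (expectation_gig_prod_dev s0 mbeta mgam beta_gam_indep n s1)).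
have {}D2 : `|a * (\int[P]_w F' w) - \int[P]_w (gig_prod s beta (- mu) n w * F' w)| <=
    (1 + C * L) * s / 2.
  apply: (le_trans D2); apply: bnd; rewrite /a -gig_mean_powN -VN.
  by apply: (expectation_gig_prod_dev s0 mbeta mgam beta_gam_indep); rewrite VN.
have E := expectation_weight_exchange s0 c0 mbeta mgam gam_law beta_gam_indep f01 mf n.
have D : a * `|\int[P]_w F w - \int[P]_w F' w| <= (1 + C * L) * s.
  rewrite -(ger0_norm (andP a01).1) -normrM mulrBr.
  rewrite (_ : (1 + C * L) * s = (1 + C * L) * s / 2 + (1 + C * L) * s / 2); last by field.
  apply: (le_trans _ (lerD D1 D2)); rewrite -E.
  rewrite -[X in _ <= _ + X]normrN.
  apply: (le_trans _ (ler_normD _ _)); rewrite le_eqVlt; apply/orP; left; apply/eqP.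
  by congr `|_|; rewrite /F /F'; ring.
rewrite -mulrA -ler_pdivrMl ?expR_gt0// -expRN (le_trans _ D)//.
by rewrite ler_wpM2r.
Qed.

End walk_compare_bound.

(** * Exponential functionals of continuous paths *)

Section paths.
Context {R : realType}.
Local Notation leb := (@lebesgue_measure R).
Implicit Types (phi : R -> R) (s t : R).

(** Freezing the path at negative times makes it continuous on the whole line, so two-sided
    continuity and derivatives are available at [0]. *)
Definition extend_path phi (u : R) : R := phi (Num.max 0 u).

Lemma extend_pathE phi u : 0 <= u -> extend_path phi u = phi u.
Proof. by move=> u0; rewrite /extend_path max_r. Qed.

Lemma continuous_extend_path phi : continuous_path phi -> continuous (extend_path phi).
Proof.
move=> /continuous_within_itvcyP[cphi phi0] u.
have [u0|u0|->] := ltgtP u 0.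
- apply: cvg_near_cst; near=> v; rewrite /extend_path !max_l ?(ltW u0)//.
  by apply: ltW; near: v; exact: (lt_nbhsl u0).
- apply: (@cvg_trans _ (phi @ u)); last first.
    by rewrite extend_pathE ?ltW//; apply: cphi; rewrite in_itv/= u0.
  apply: near_eq_cvg; near=> v; rewrite extend_pathE//.
  by apply: ltW; near: v; exact: (lt_nbhsr u0).
- apply/cvgrPdist_lt => e e0.
  move/cvgrPdist_lt : phi0 => /(_ e e0) [r /= r0 H].
  exists r => //= v rv; rewrite /extend_path maxxx.
  have [v0|v0] := leP v 0; first by rewrite subrr normr0.
  exact: H.
Unshelve. all: by end_near. Qed.

Lemma continuous_path_extend phi : continuous (extend_path phi) -> continuous_path phi.
Proof.
move=> c; apply/continuous_within_itvcyP; split => [u|].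
  rewrite in_itv/= andbT => u0.
  apply: (@cvg_trans _ (extend_path phi @ u)); last first.
    by rewrite -[phi u](extend_pathE _ (ltW u0)); exact: c.
  apply: near_eq_cvg; near=> v; rewrite extend_pathE//.
  by apply: ltW; near: v; exact: (lt_nbhsr u0).
apply: (@cvg_trans _ (extend_path phi @ 0^'+)); last first.
  by rewrite -[phi 0](extend_pathE _ (lexx 0)); apply: cvg_at_right_filter; exact: c.
apply: near_eq_cvg; near=> v; rewrite extend_pathE//.
Unshelve. all: by end_near. Qed.

Lemma uniform_continuity_segment (g : R -> R) a b e : continuous g -> 0 < e ->
  exists2 d, 0 < d & forall x y, a <= x <= b -> `|y - x| < d -> `|g y - g x| < e.
Proof.
move=> cg e0; have e20 : 0 < e / 2 by rewrite divr_gt0.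
(* Compactness in near-covering form, with the radius [d], tending to [0] from the right, as
   parameter. *)
have /compact_near_coveringP/(_ R (0^'+)
  (fun d x => forall y, `|y - x| < d -> `|g y - g x| < e)) cov := @segment_compact R a b.
have [x xab|d /= d0 H] := cov _.
  have /cvgrPdist_lt /(_ _ e20) [r /= r0 Hr] := cg x.
  have r20 : 0 < r / 2 by rewrite divr_gt0.
  exists (ball x (r / 2), [set d | d < r / 2]) => /=.
    by split; [exact: nbhsx_ballx|exact: nbhs_right_lt].
  move=> [x' d] [/= xx' dr] y yx'.
  have gx' : `|g x - g x'| < e / 2.
    by apply: Hr => /=; rewrite (lt_trans xx')// ltr_pdivrMr// mulr2n mulrDr mulr1 ltrDr.
  have gy : `|g x - g y| < e / 2.
    apply: Hr => /=; rewrite -(subrKA x') [X in _ < X](splitr r).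
    rewrite (le_lt_trans (ler_normD _ _))// ltrD// distrC; exact: lt_trans yx' dr.
  rewrite (_ : g y - g x' = (g x - g x') - (g x - g y)); last by ring.
  by rewrite [X in _ < X](splitr e) (le_lt_trans (ler_normB _ _))// ltrD.
have d20 : 0 < d / 2 by rewrite divr_gt0.
exists (d / 2) => // x y xab; apply: (H (d / 2)) => //=.
by rewrite sub0r normrN ger0_norm ?(ltW d20)// ltr_pdivrMr// mulr2n mulrDr mulr1 ltrDr.
Qed.

(* With [-1] as lower bound the integral is differentiable on a neighbourhood of [[0, +oo[]. *)
Definition path_primitive phi (t : R) : R :=
  \int[leb]_(u in `[-1, t]) expR (2 * extend_path phi u) -
  \int[leb]_(u in `[-1, 0]) expR (2 * extend_path phi u).

Variable phi : R -> R.
Hypothesis cphi : continuous_path phi.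

Let psi u := expR (extend_path phi u).

Let cpsi : continuous psi.
Proof.
move=> u; apply: (cvg_comp _ expR); last exact: continuous_expR.
exact: continuous_extend_path.
Qed.

Let cpsi2 : continuous (fun u => expR (2 * extend_path phi u)).
Proof.
move=> u; apply: (cvg_comp _ expR); last exact: continuous_expR.
by apply: cvgMr; exact: continuous_extend_path.
Qed.

Let integrable_psi2 a b :
  leb.-integrable `[a, b] (EFin \o (fun u => expR (2 * extend_path phi u))).
Proof.
apply: continuous_compact_integrable; first exact: segment_compact.
exact: continuous_subspaceT.
Qed.

Lemma A_primitive t : 0 <= t -> A_ phi t = path_primitive phi t.
Proof.
move=> t0; rewrite /A_ /path_primitive.
have /= -> := @Rintegral_itvB R _ (BLeft (-1)) (BRight t) 0 (integrable_psi2 (-1) t).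
- rewrite Rintegral_itv_obnd_cbnd//.
    by apply: eq_Rintegral => u; rewrite inE/= in_itv/= => /andP[u0 _]; rewrite extend_pathE.
  apply: (integrableS _ _ _ (integrable_psi2 0 t)) => //; exact: subset_itv_oc_cc.
- by rewrite bnd_simp lerN10.
- by rewrite bnd_simp.
Qed.

Lemma is_derive_path_primitive t : -1 < t ->
  is_derive t 1 (path_primitive phi) (expR (2 * extend_path phi t)).
Proof.
move=> t1.
have [] := @continuous_FTC1_closed R (fun u => expR (2 * extend_path phi u)) (-1) t (t + 1)
  _ (integrable_psi2 _ _) t1 (@cpsi2 t); first by rewrite ltrDl.
rewrite derive1E => dF F'.
have := DeriveDef dF F'.
move=> H; rewrite -[X in is_derive _ _ _ X]subr0 /path_primitive.
exact: is_deriveB.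
Qed.

Lemma continuous_path_primitive t : -1 < t -> {for t, continuous (path_primitive phi)}.
Proof.
move=> t1; apply/differentiable_continuous/derivable1_diffP.
by have [] := is_derive_path_primitive t1.
Qed.

Lemma A_ge0 t : 0 <= A_ phi t.
Proof. by apply: Rintegral_ge0 => u _; exact: expR_ge0. Qed.

Lemma path_primitive_MVT a b : 0 <= a -> a < b -> exists2 x, a < x < b &
  path_primitive phi b - path_primitive phi a = (b - a) * expR (2 * extend_path phi x).
Proof.
move=> a0 ab.
have [||x xab ->] := @MVT R (path_primitive phi)
    (fun t => expR (2 * extend_path phi t)) a b ab.
- move=> x; rewrite in_itv/= => /andP[ax _]; apply: is_derive_path_primitive.
  by rewrite (lt_trans _ ax)// (lt_le_trans _ a0)// ltrN10.
- apply: continuous_in_subspaceT => x; rewrite inE/= in_itv/= => /andP[ax _].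
  by apply: continuous_path_primitive; rewrite (lt_le_trans _ ax)// (lt_le_trans _ a0)// ltrN10.
by exists x; rewrite 1?mulrC//; move: xab; rewrite in_itv.
Qed.

Lemma A_at0 : A_ phi 0 = 0.
Proof. by rewrite A_primitive// /path_primitive subrr. Qed.

Lemma A_gt0 t : 0 < t -> 0 < A_ phi t.
Proof.
move=> t0; have [x _] := path_primitive_MVT (lexx 0) t0.
rewrite -(A_primitive (ltW t0)) -(A_primitive (lexx 0)) A_at0 !subr0 => ->.
by rewrite mulr_gt0// expR_gt0.
Qed.

Lemma A_nondecreasing a b : 0 <= a -> a <= b -> A_ phi a <= A_ phi b.
Proof.
move=> a0; rewrite le_eqVlt => /predU1P[->//|ab].
rewrite -subr_ge0 !A_primitive// ?(le_trans a0 (ltW ab))//.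
have [x _ ->] := path_primitive_MVT a0 ab.
by rewrite mulr_ge0 ?expR_ge0// subr_ge0 ltW.
Qed.

(** Riemann sum for [expR (2 * f)] with the geometric mean of the two endpoint values in each cell:
    the form that composing [gig_step] produces. *)
Definition riemann_sum (f : R -> R) (del : R) (k : nat) : R :=
  \sum_(j < k) del * expR (f (j%:R * del) + f (j.+1%:R * del)).

Lemma riemann_sum_close K e : 0 <= K -> 0 < e -> exists2 d, 0 < d &
  forall del k, 0 < del < d -> k%:R * del <= K ->
    `|A_ phi (k%:R * del) - riemann_sum phi del k| <= e.
Proof.
move=> K0 e0.
have [c cK Mc] := @EVT_max R psi 0 K K0 (continuous_subspaceT cpsi).
pose M := psi c; have M0 : 0 < M by exact: expR_gt0.
have MK u : 0 <= u <= K -> psi u <= M by move=> uK; apply: Mc; rewrite in_itv.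
(* The error per unit time is at most [2 * M * h]; [K + 1] instead of [K] keeps the denominator
   positive when [K = 0]. *)
pose h := e / (2 * M * (K + 1)).
have h0 : 0 < h by rewrite divr_gt0 ?mulr_gt0// ltr_wpDl.
have [d d0 Hd] := uniform_continuity_segment 0 K cpsi h0.
exists d => // del k /andP[del0 deld].
(* The induction needs an error proportional to the elapsed time. In each cell the mean value
   theorem leaves a difference of products of two values of [psi], bounded through [M] and [h]. *)
suff : k%:R * del <= K ->
    `|A_ phi (k%:R * del) - riemann_sum phi del k| <= k%:R * del * (2 * M * h).
  move=> H kK; rewrite (le_trans (H kK))//.
  rewrite (_ : 2 * M * h = e / (K + 1)); last first.
    by rewrite /h; field; rewrite !gt_eqF// ltr_wpDl.
  rewrite mulrA ler_pdivrMr ?ltr_wpDl// mulrC ler_pM2l// (le_trans kK)//.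
  by rewrite lerDl.
elim: k => [_|k IH kK].
  by rewrite !mul0r /riemann_sum big_ord0 subr0 A_at0 normr0.
have a0 : 0 <= k%:R * del by rewrite mulr_ge0// ltW.
have ab : k%:R * del < k.+1%:R * del by rewrite ltr_pM2r// ltr_nat.
have := IH (le_trans (ltW ab) kK).
rewrite /riemann_sum big_ord_recr/= -/(riemann_sum phi del k).
have [x /andP[ax xb] E] := path_primitive_MVT a0 ab.
rewrite !A_primitive ?(le_trans a0 (ltW ab))//.
have bE : k.+1%:R * del - k%:R * del = del by rewrite -natr1; ring.
rewrite bE in E.
move: (path_primitive phi _) (path_primitive phi _) E => Ia Ib E H.
have -> : Ib - (riemann_sum phi del k + del * expR (phi (k%:R * del) + phi (k.+1%:R * del))) =
    (Ia - riemann_sum phi del k) + del * (expR (2 * extend_path phi x) -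
      expR (phi (k%:R * del) + phi (k.+1%:R * del))).
  by rewrite mulrBr -E; ring.
rewrite (_ : k.+1%:R * del * (2 * M * h) = k%:R * del * (2 * M * h) +
  del * (2 * M * h)); last by rewrite -natr1; ring.
apply: (le_trans (ler_normD _ _)); apply: lerD => //.
rewrite normrM (gtr0_norm del0) ler_pM2l//.
rewrite -(extend_pathE _ a0) -(extend_pathE _ (le_trans a0 (ltW ab))).
rewrite expRD (_ : expR (2 * _) = psi x * psi x); last by rewrite -expRD; congr expR; ring.
rewrite -/(psi (k%:R * del)) -/(psi (k.+1%:R * del)).
have xK : 0 <= x <= K by rewrite (le_trans a0 (ltW ax)) (le_trans (ltW xb) kK).
have aK : 0 <= k%:R * del <= K by rewrite a0 (le_trans (ltW ab) kK).
have h1 : `|psi (k%:R * del) - psi x| < h.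
  apply: Hd => //; rewrite distrC gtr0_norm ?subr_gt0//.
  by apply: le_lt_trans deld; rewrite -[leRHS]bE lerD2r ltW.
have h2 : `|psi (k.+1%:R * del) - psi x| < h.
  apply: Hd => //; rewrite gtr0_norm ?subr_gt0//.
  by apply: le_lt_trans deld; rewrite -[leRHS]bE lerD2l lerN2 ltW.
move: h1 h2 (MK _ xK) (MK _ aK).
have p0 := expR_ge0 (extend_path phi x); rewrite -/(psi x) in p0.
have q0 := expR_ge0 (extend_path phi (k%:R * del)); rewrite -/(psi (k%:R * del)) in q0.
move: (psi x) (psi (k%:R * del)) (psi (k.+1%:R * del)) p0 q0 => p q r p0 q0 h1 h2 pM qM.
rewrite (_ : p * p - q * r = - (p * (q - p) + q * (r - p))); last by ring.
rewrite normrN (le_trans (ler_normD _ _))// !normrM (ger0_norm p0) (ger0_norm q0).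
rewrite (_ : 2 * M * h = M * h + M * h); last by ring.
by apply: lerD; apply: ler_pM => //; exact: ltW.
Qed.

End paths.

Section mesh.
Context {R : realType}.
Implicit Types (phi : R -> R) (t : R).

Definition mesh (n : nat) : R := n.+1%:R^-1.
(** The successor makes the index positive, as the tests of the walks bear on positions after at
    least one step. The grid point is at or just after [t]. *)
Definition mesh_index (n : nat) t : nat := (Num.truncn (t * n.+1%:R)).+1.

Lemma mesh_gt0 n : 0 < mesh n. Proof. by rewrite invr_gt0. Qed.

Lemma cvg_mesh : mesh n @[n --> \oo] --> (0 : R).
Proof. exact: cvg_harmonic. Qed.

Lemma mesh_index_bound n t : 0 <= t ->
  t <= (mesh_index n t)%:R * mesh n <= t + mesh n.
Proof.
move=> t0; have tn0 : 0 <= t * n.+1%:R by rewrite mulr_ge0.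
have /andP[lb ub] := truncn_itv tn0.
apply/andP; split; first by rewrite /mesh ler_pdivlMr ?ltr0n// ltW.
by rewrite /mesh /mesh_index ler_pdivrMr ?ltr0n// mulrDl mulVf// -[leLHS]natr1 lerD2r.
Qed.

Lemma cvg_mesh_index t : 0 <= t ->
  (mesh_index n t)%:R * mesh n @[n --> \oo] --> t.
Proof.
move=> t0; apply: (@squeeze_cvgr _ _ _ _ (fun=> t) (fun n => t + mesh n)).
- by near=> n; exact: mesh_index_bound.
- exact: cvg_cst.
- rewrite -[X in _ --> X]addr0; apply: cvgD; [exact: cvg_cst|exact: cvg_mesh].
Unshelve. all: by end_near. Qed.

Variable phi : R -> R.
Hypothesis cphi : continuous_path phi.

Lemma cvg_path_mesh t : 0 <= t ->
  phi ((mesh_index n t)%:R * mesh n) @[n --> \oo] --> phi t.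
Proof.
move=> t0; rewrite -(extend_pathE phi t0).
rewrite (_ : (fun n => phi _) = (fun n => extend_path phi ((mesh_index n t)%:R * mesh n))).
  apply: continuous_cvg; last exact: cvg_mesh_index.
  exact: continuous_extend_path.
by apply/funext => n; rewrite extend_pathE// mulr_ge0// ltW// mesh_gt0.
Qed.

Lemma cvg_riemann_sum t : 0 <= t ->
  riemann_sum phi (mesh n) (mesh_index n t) @[n --> \oo] --> A_ phi t.
Proof.
move=> t0; apply/cvgrPdist_le => e e0.
have e20 : 0 < e / 2 by rewrite divr_gt0.
have t10 : 0 <= t + 1 by rewrite addr_ge0.
have [d d0 Hd] := riemann_sum_close cphi t10 e20.
have cA : path_primitive phi ((mesh_index n t)%:R * mesh n) @[n --> \oo] --> path_primitive phi t.
  apply: continuous_cvg; last exact: cvg_mesh_index.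
  by apply: continuous_path_primitive => //; rewrite (lt_le_trans _ t0)// ltrN10.
move/cvgrPdist_le : cA => /(_ _ e20) cA.
near=> n.
have m0 : 0 <= (mesh_index n t)%:R * mesh n by rewrite mulr_ge0// ltW// mesh_gt0.
rewrite (_ : _ - _ = (path_primitive phi t - path_primitive phi ((mesh_index n t)%:R * mesh n)) +
  (A_ phi ((mesh_index n t)%:R * mesh n) - riemann_sum phi (mesh n) (mesh_index n t))); last first.
  by rewrite !A_primitive//; ring.
rewrite [leRHS]splitr (le_trans (ler_normD _ _))// lerD//; first by near: n.
apply: Hd.
  rewrite mesh_gt0/=; near: n.
  by apply: (cvgr_lt _ cvg_mesh).
have /andP[_ ub] := mesh_index_bound n t0.
by rewrite (le_trans ub)// lerD2l /mesh invf_le1// ler1n.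
Unshelve. all: by end_near. Qed.

End mesh.

(** * The walks driven by Brownian increments *)

Section closed_form.
Context {R : realType} {T : Type}.
Variables (mu s : R) (B : R -> T -> R) (gam : T -> R) (w : T).
Hypotheses (s0 : 0 < s) (B0 : B 0 w = 0) (gam0 : 0 <= gam w).

Let beta j (w : T) := B (j.+1%:R * s ^+ 2) w - B (j%:R * s ^+ 2) w.
Let Z u := B u w + mu * u.

Lemma riemann_sum_ge0 f del k : 0 <= del -> 0 <= riemann_sum f del k :> R.
Proof. by move=> d0; apply: sumr_ge0 => j _; rewrite mulr_ge0 ?expR_ge0. Qed.

(** Put [D_k = 1 + 2 * gam w * riemann_sum Z (s ^+ 2) k]. The second component of the state is
    [gam w * expR (2 * Z_k) / D_k], so the logarithm in the next step has argument [D_(k+1) / D_k],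
    and the logarithms telescope. *)
Lemma gig_walkE k : gig_walk mu s beta gam k w =
  (Z (k%:R * s ^+ 2) - ln (1 + 2 * gam w * riemann_sum Z (s ^+ 2) k),
   gam w * expR (Z (k%:R * s ^+ 2) + (gig_walk mu s beta gam k w).1)).
Proof.
elim: k => [|k IH].
  by rewrite /riemann_sum big_ord0 /Z !mul0r B0 !mulr0 !addr0 ln1 subr0/= expR0 mulr1.
rewrite /=; set p := gig_walk _ _ _ _ k w.
have zE : beta k w + mu * s ^+ 2 = Z (k.+1%:R * s ^+ 2) - Z (k%:R * s ^+ 2).
  by rewrite /beta /Z -natr1; ring.
rewrite zE; set z := Z _ - Z _.
have D0 j : 0 < 1 + 2 * gam w * riemann_sum Z (s ^+ 2) j.
  by rewrite ltr_wpDr// !mulr_ge0// riemann_sum_ge0// sqr_ge0.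
have p1 : p.1 = Z (k%:R * s ^+ 2) - ln (1 + 2 * gam w * riemann_sum Z (s ^+ 2) k).
  by rewrite /p IH.
have p2 : p.2 = gam w * expR (Z (k%:R * s ^+ 2) + p.1) by rewrite {1}/p IH.
congr pair; last first.
  rewrite p2 -mulrA -expRD; congr (_ * expR _); rewrite /z; ring.
rewrite /gig_step p1 /z.
have e1 : 1 + 2 * p.2 * s ^+ 2 * expR z = (1 + 2 * gam w * riemann_sum Z (s ^+ 2) k.+1) /
    (1 + 2 * gam w * riemann_sum Z (s ^+ 2) k).
  rewrite p2 p1 /z [riemann_sum _ _ k.+1]/riemann_sum big_ord_recr/= -/(riemann_sum Z (s ^+ 2) k).
  move: (riemann_sum Z _ k) (Z (k.+1%:R * s ^+ 2)) (Z (k%:R * s ^+ 2)) (D0 k) => A b a DA.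
  rewrite (expRD a (a - _)) (expRD a (- _)) (expRD b (- a)) (expRD a b) !expRN lnK ?posrE//.
  by field; rewrite !gt_eqF ?expR_gt0.
rewrite e1 ln_div ?posrE//; ring.
Qed.

Lemma drift_walkE k : drift_walk mu s beta k w = B (k%:R * s ^+ 2) w - mu * (k%:R * s ^+ 2).
Proof.
elim: k => [|k IH]; first by rewrite mul0r B0 mulr0 subr0.
by rewrite /= IH /beta -natr1; ring.
Qed.

End closed_form.

(** * From walks to Brownian motion *)

Section path_space.
Context {R : realType}.

Definition pathT : measurableType _ := g_sigma_algebraType (@coordinate_sets R).

Lemma measurable_path_eval (s : R) : 0 <= s ->
  measurable_fun setT (fun phi : pathT => (phi : R -> R) s).
Proof.
move=> s0 _ U mU; rewrite setTI; apply: sub_sigma_algebra.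
by exists s, U.
Qed.

Lemma measurable_path_map d (T : measurableType d) (X : R -> T -> R) :
  (forall s, 0 <= s -> measurable_fun setT (X s)) ->
  measurable_fun setT (fun w => (X ^~ w : pathT)).
Proof.
move=> mX; apply: (@measurability _ _ T pathT setT _ (@coordinate_sets R)) => //.
move=> _ [_ [s [U [s0 mU ->]]] <-].
exact: (mX s s0 measurableT U mU).
Qed.

Lemma measurable_path_set d (T : measurableType d) (X : R -> T -> R) (S : set (R -> R)) :
  (forall s, 0 <= s -> measurable_fun setT (X s)) -> path_sigma_algebra S ->
  measurable [set w | S (X ^~ w)].
Proof.
move=> mX mS; rewrite -[X in measurable X]setTI.
exact: (measurable_path_map mX measurableT mS).
Qed.

End path_space.

Section dominated.
Context d (T : measurableType d) (R : realType) (P : probability T R).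

Lemma cvg_Rintegral_bounded (F : (T -> R)^nat) (f : T -> R) :
  (forall n, measurable_fun setT (F n)) -> measurable_fun setT f ->
  (forall n w, `|F n w| <= 1) -> (forall w, `|f w| <= 1) ->
  {ae P, forall w, F n w @[n --> \oo] --> f w} ->
  \int[P]_w F n w @[n --> \oo] --> \int[P]_w f w.
Proof.
move=> mF mf F1 f1 Ff.
have [] := @dominated_convergence _ T R P setT measurableT (fun n => EFin \o F n)
  (EFin \o f) (cst 1%E).
- by move=> n; exact/measurable_EFinP.
- exact/measurable_EFinP.
- by apply: filterS Ff => w H _; apply: cvg_EFin => //; near=> n.
- by apply: (@bounded_integrable _ _ _ P (cst 1) 1) => // w; rewrite normr1.
- by apply: aeW => w n _ /=; rewrite lee_fin.
move=> _ _; rewrite (@integral_EFin_Rintegral _ _ _ P f 1)// => H.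
rewrite (_ : (fun n => _) = (fun n => fine (\int[P]_w (F n w)%:E)%E))//.
exact: (fine_cvg H).
Unshelve. all: by end_near. Qed.

End dominated.

Section measurable_A.
Context d (T : measurableType d) (R : realType).

Lemma measurable_riemann_sum (X : R -> T -> R) del k :
  (forall s, 0 <= s -> measurable_fun setT (X s)) -> 0 <= del ->
  measurable_fun setT (fun w => riemann_sum (X ^~ w) del k).
Proof.
move=> mX d0; apply: measurable_sum => j.
have m1 := mX (j%:R * del) (mulr_ge0 (ler0n _ _) d0).
have m2 := mX (j.+1%:R * del) (mulr_ge0 (ler0n _ _) d0).
by measurability.
Qed.

(** A pointwise limit of Riemann sums, each a function of finitely many coordinates. *)
Lemma measurable_A (X : R -> T -> R) t :
  (forall s, 0 <= s -> measurable_fun setT (X s)) ->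
  (forall w, continuous_path (X ^~ w)) -> 0 <= t ->
  measurable_fun setT (fun w => A_ (X ^~ w) t).
Proof.
move=> mX cX t0; apply: (@measurable_fun_cvg _ _ _ _
  (fun n w => riemann_sum (X ^~ w) (mesh n) (mesh_index n t))).
  by move=> n; apply: measurable_riemann_sum => //; rewrite ltW// mesh_gt0.
by move=> w _; exact: cvg_riemann_sum.
Qed.

End measurable_A.

Lemma cvg_prod_seq (R : realType) (I : Type) (r : seq I) (u : I -> R^nat) (l : I -> R) :
  (forall i, u i n @[n --> \oo] --> l i) ->
  (\prod_(i <- r) u i n) @[n --> \oo] --> \prod_(i <- r) l i.
Proof.
move=> ul; elim: r => [|i r IH].
  by rewrite big_nil (_ : (fun n => _) = fun=> 1); [exact: cvg_cst|apply/funext => n; rewrite big_nil].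
rewrite big_cons (_ : (fun n => _) = fun n => u i n * \prod_(j <- r) u j n).
  exact: cvgM.
by apply/funext => n; rewrite big_cons.
Qed.

Lemma gamma_rv_gt0 d (T : measurableType d) (R : realType) (P : probability T R)
    (mu : R) (gam : {RV P >-> R}) : gamma_rv mu gam ->
  {ae P, forall w, 0 < gam w}.
Proof.
move=> gam_law; exists (gam @^-1` `]-oo, 0]); split.
- by apply: measurable_funPTI.
- have := gam_law _ (measurable_itv `]-oo, 0%R]); rewrite /distribution /pushforward => ->.
  rewrite (_ : _ `&` _ = set0) ?integral_set0// -subset0 => x /= [].
  by rewrite !in_itv/= andbT leNgt => /negP.
- by move=> w /=; rewrite in_itv/= => /negP; rewrite -leNgt.
Qed.

Section brownian.
Context d (T : measurableType d) (R : realType) (P : probability T R).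
Variables (mu : R) (B : R -> T -> R) (gam : {RV P >-> R}).
Hypothesis mu_gt0 : 0 < mu.
Hypothesis B_bm : brownian_motion P B.
Hypothesis gam_law : gamma_rv mu gam.
Hypothesis B_gam_indep : process_rv_independent B gam.

Let mB s : 0 <= s -> measurable_fun setT (B s). Proof. by case: B_bm => + _ _ _ _; apply. Qed.
Let B0 w : B 0 w = 0. Proof. by case: B_bm. Qed.
Let cB w : continuous_path (B ^~ w). Proof. by case: B_bm. Qed.

Let Z u w := B u w + mu * u.
Let Y := drifted mu B.

Lemma continuous_path_addlin (phi : R -> R) (a : R) :
  continuous_path phi -> continuous_path (fun u => phi u + a * u).
Proof.
move=> cphi x; apply: cvgD; first exact: cphi.
by apply: continuous_subspaceT => y; apply: cvgMr; exact: cvg_id.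
Qed.

Let cZ w : continuous_path (Z ^~ w). Proof. exact: continuous_path_addlin. Qed.

Let cY w : continuous_path (Y ^~ w).
Proof.
rewrite (_ : Y ^~ w = fun u => B u w + - mu * u).
  exact: (@continuous_path_addlin (B ^~ w)).
by apply/funext => u; rewrite /Y /drifted mulNr.
Qed.

Let mZ s : 0 <= s -> measurable_fun setT (Z s).
Proof. by move=> s0; apply: measurable_funD => //; exact: mB. Qed.

Let mY s : 0 <= s -> measurable_fun setT (Y s).
Proof. by move=> s0; apply: measurable_funB => //; exact: mB. Qed.

Let gam_gt0 : {ae P, forall w, 0 < gam w}. Proof. exact: gamma_rv_gt0 gam_law. Qed.

Definition gamma_const : R := (Gamma mu)^-1.

Lemma gamma_const_ge0 : 0 <= gamma_const.
Proof.
rewrite invr_ge0; apply: Rintegral_ge0 => u _.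
by rewrite mulr_ge0 ?powR_ge0 ?expR_ge0.
Qed.

Let step n : R := Num.sqrt (mesh n).
Let beta n j w := B (j.+1%:R * step n ^+ 2) w - B (j%:R * step n ^+ 2) w.

Let step_gt0 n : 0 < step n. Proof. by rewrite sqrtr_gt0 mesh_gt0. Qed.
Let step2 n : step n ^+ 2 = mesh n. Proof. by rewrite sqr_sqrtr// ltW// mesh_gt0. Qed.
Let grid_ge0 n j : 0 <= j%:R * step n ^+ 2. Proof. by rewrite mulr_ge0 ?sqr_ge0. Qed.

Let mbeta n j : measurable_fun setT (beta n j).
Proof. by apply: measurable_funB; exact: mB. Qed.

Let beta_gam_indep n k (V : set R) (U : nat -> set R) :
  measurable V -> (forall i, measurable (U i)) ->
  P (gam @^-1` V `&` [set w | forall i, (i < k)%N -> U i (beta n i w)]) =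
  (P (gam @^-1` V) * \prod_(i < k) normal_prob 0 (step n) (U i))%E.
Proof.
move=> mV mU; have [_ _ _ inc ind] := B_bm.
pose t i : R := i%:R * step n ^+ 2.
(* The increment event is written as an event of path space: this is the form in which independence
   from [gam] is given. *)
pose S : set (R -> R) := [set phi | forall i, (i < k)%N -> U i (phi (t i.+1) - phi (t i))].
have mS : path_sigma_algebra S.
  rewrite (_ : S = \bigcap_(i < k)
    ((fun phi : @pathT R => (phi : R -> R) (t i.+1) - (phi : R -> R) (t i)) @^-1` U i)); last first.
    by apply/seteqP; split.
  apply: (@bigcap_measurableType _ (@pathT R)) => i _.
  have mf : measurable_fun setT
      (fun phi : @pathT R => (phi : R -> R) (t i.+1) - (phi : R -> R) (t i)).
    by apply: measurable_funB; exact: measurable_path_eval (grid_ge0 _ _).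
  by rewrite -[X in measurable X]setTI; exact: mf.
rewrite setIC; apply: (etrans (B_gam_indep mS mV)); rewrite muleC; congr (_ * _)%E.
have tm i : (i < k)%N -> t i <= t i.+1 by rewrite /t ler_pM2r ?exprn_gt0// ler_nat.
have := ind k t (grid_ge0 n 0) tm (fun i => U i) (fun i => mU i).
rewrite (_ : [set w | _] = [set w | S (B ^~ w)]); last first.
  apply/seteqP; split => w /=; first by move=> H i ik; exact: (H (Ordinal ik)).
  by move=> H i; exact: H.
move=> ->; apply: eq_bigr => i _.
have ti : t i < t i.+1 by rewrite /t ltr_pM2r ?exprn_gt0// ltr_nat.
apply: (etrans (inc (t i) (t i.+1) (grid_ge0 n i) ti (U i) (mU i))).
congr (normal_prob 0 _ (U i)); rewrite /t -mulrBl -natr1 addrC addKr mul1r.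
by rewrite sqrtr_sqr gtr0_norm.
Qed.

Definition reversed_process (u : R) (w : T) : R :=
  Z u w - ln (1 + 2 * gam w * A_ (Z ^~ w) u).
Local Notation W := reversed_process.

Lemma measurable_reversed_process u : 0 <= u -> measurable_fun setT (W u).
Proof.
move=> u0; have m1 := mZ u0; have m2 := measurable_A mZ cZ u0.
have m3 : measurable_fun setT (gam : T -> R) by [].
by rewrite /reversed_process; measurability.
Qed.

(** Both sides are limits, by bounded convergence and continuity of the tests, of expectations along
    the two walks on finer and finer grids, and [walk_compare] makes the difference vanish. *)
Lemma fdd_reversed_process (m : nat) (t : 'I_m -> R) (g : 'I_m -> R -> R) :
  (forall i, 0 <= t i) -> (forall i, continuous (g i)) ->
  (forall i x, 0 <= g i x <= 1) ->
  \int[P]_w (\prod_(i < m) g i (W (t i) w)) = \int[P]_w (\prod_(i < m) g i (Y (t i) w)).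
Proof.
move=> t0 cg g01.
have mg i : measurable_fun setT (g i) by exact: continuous_measurable_fun.
(* An integer time beyond every [t i]: [L * n.+1] steps of length [mesh n] fill [[0, L]] and reach
   all the grid points used. *)
pose L := (Num.truncn (\sum_i t i)).+1.
have tL i : t i < L%:R.
  have := truncnS_gt (\sum_i t i); apply: le_lt_trans.
  by rewrite (bigD1 i)//= lerDl sumr_ge0.
pose N n := (L * n.+1)%N.
have kN n i : (Num.truncn (t i * n.+1%:R) < N n)%N.
  rewrite -(ltr_nat R) (le_lt_trans (_ : _ <= t i * n.+1%:R))//.
    by rewrite truncn_le mulr_ge0.
  by rewrite /N natrM ltr_pM2r.
pose p n i : 'I_(N n) := Ordinal (kN n i).
(* Tests at times in the same cell are multiplied together; a cell without test times gets the
   constant [1]. *)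
pose f n j x := \prod_(i < m | Num.truncn (t i * n.+1%:R) == j) g i x.
have prodE n (x : nat -> R) :
    \prod_(j < N n) f n j (x j.+1) = \prod_(i < m) g i (x (mesh_index n (t i))).
  rewrite (partition_big (p n) xpredT)//=; apply: eq_bigr => j _.
  by apply: eq_big => // i /eqP; rewrite /mesh_index => ->.
have f01 n j x : 0 <= f n j x <= 1.
  rewrite /f; apply: (big_ind (fun y => 0 <= y <= 1)) => //.
  - by rewrite ler01 lexx.
  - by move=> y z /andP[y0 y1] /andP[z0 z1]; rewrite mulr_ge0// mulr_ile1.
have mf n j : measurable_fun setT (f n j).
  rewrite /f; under eq_fun do rewrite big_mkcond/=.
  by apply: measurable_prod => i _; case: (Num.truncn (t i * n.+1%:R) == j) => //; exact: mg.
pose F n w := \prod_(i < m) g i (gig_walk mu (step n) (beta n) gam (mesh_index n (t i)) w).1.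
pose F' n w := \prod_(i < m) g i (drift_walk mu (step n) (beta n) (mesh_index n (t i)) w).
have cmp n : (1 + variance_const mu) * step n ^+ 2 <= 1 ->
    `|\int[P]_w F n w - \int[P]_w F' n w| <=
      expR ((1 + variance_const mu) * L%:R) * (1 + variance_const mu * L%:R) * step n.
  move=> s1.
  have NL : (N n)%:R * step n ^+ 2 <= L%:R.
    by rewrite step2 /N natrM -mulrA /mesh divff ?mulr1.
  have E1 : \int[P]_w F n w = \int[P]_w \prod_(j < N n) f n j (gig_walk mu (step n) (beta n) gam j.+1 w).1.
    by apply: eq_Rintegral => w _; exact: (esym (prodE n (fun j => (gig_walk mu (step n) (beta n) gam j w).1))).
  have E2 : \int[P]_w F' n w = \int[P]_w \prod_(j < N n) f n j (drift_walk mu (step n) (beta n) j.+1 w).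
    by apply: eq_Rintegral => w _; exact: (esym (prodE n (fun j => drift_walk mu (step n) (beta n) j w))).
  rewrite E1 E2.
  exact: (walk_compare (step_gt0 n) gamma_const_ge0 (mbeta n) (measurable_funPT gam) gam_law (@beta_gam_indep n) s1 (f01 n) (mf n) NL).
have step0 : step n @[n --> \oo] --> (0 : R).
  rewrite -[X in _ --> X](@sqrtr0 R); apply: continuous_cvg; last exact: cvg_mesh.
  exact: sqrt_continuous.
pose K := expR ((1 + variance_const mu) * L%:R) * (1 + variance_const mu * L%:R).
have diff0 : (\int[P]_w F n w - \int[P]_w F' n w) @[n --> \oo] --> (0 : R).
  apply/norm_cvg0P/(@squeeze_cvgr _ _ _ _ (fun=> 0) (fun n => K * step n)); last 2 first.
  - exact: cvg_cst.
  - rewrite -[X in _ --> X](mulr0 K); apply: cvgMr; exact: step0.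
  have s1 : \forall n \near \oo, (1 + variance_const mu) * step n ^+ 2 <= 1.
    have : (1 + variance_const mu) * mesh n @[n --> \oo] --> (0 : R).
      by rewrite -[X in _ --> X](mulr0 (1 + variance_const mu)); apply: cvgMr; exact: cvg_mesh.
    move=> /cvgrPdist_le/(_ 1 ltr01); apply: filterS => n; rewrite sub0r normrN step2.
    exact/le_trans/ler_norm.
  by apply: filterS s1 => n s1'; rewrite normr_ge0 cmp.
have bnd (x : 'I_m -> R) : `|\prod_(i < m) g i (x i)| <= 1.
  apply: norm01; apply: (big_ind (fun y => 0 <= y <= 1)) => //.
  - by rewrite ler01 lexx.
  - by move=> y z /andP[y0 y1] /andP[z0 z1]; rewrite mulr_ge0// mulr_ile1.
have mprod (X : R -> T -> R) : (forall i, measurable_fun setT (X (t i))) ->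
    measurable_fun setT (fun w => \prod_(i < m) g i (X (t i) w)).
  by move=> mX; apply: measurable_prod => i _; exact: measurable_fun_compT (mg i) (mX i).
have cvgF : (\int[P]_w F n w) @[n --> \oo] --> \int[P]_w (\prod_(i < m) g i (W (t i) w)).
  apply: cvg_Rintegral_bounded.
  - move=> n; apply: measurable_prod => i _; apply: measurable_fun_compT (mg i) _.
    by have [] := @measurable_gig_walk _ T R mu (step n) (beta n) gam _
      (fun i _ => mbeta n i) (measurable_funPT gam) (mesh_index n (t i)) (leqnn _).
  - by apply: mprod => i; exact: measurable_reversed_process.
  - by move=> n w; exact: bnd.
  - by move=> w; exact: bnd.
  apply: filterS gam_gt0 => w gw; apply: cvg_prod_seq => i; apply: continuous_cvg; first exact: cg.
  rewrite (_ : (fun n => _) = fun n => Z ((mesh_index n (t i))%:R * mesh n) w -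
      ln (1 + 2 * gam w * riemann_sum (Z ^~ w) (mesh n) (mesh_index n (t i)))); last first.
    by apply/funext => n; rewrite gig_walkE ?step2//= ltW.
  apply: cvgB; first exact: (cvg_path_mesh (@cZ w) (t0 i)).
  apply: continuous_cvg.
    apply: continuous_ln; rewrite ltr_pwDl// mulr_ge0 ?A_ge0// mulr_ge0// ltW//.
  apply: cvgD; first exact: cvg_cst.
  by apply: cvgMr; exact: cvg_riemann_sum.
have cvgF' : (\int[P]_w F' n w) @[n --> \oo] --> \int[P]_w (\prod_(i < m) g i (Y (t i) w)).
  apply: cvg_Rintegral_bounded.
  - move=> n; apply: measurable_prod => i _; apply: measurable_fun_compT (mg i) _.
    have -> : drift_walk mu (step n) (beta n) (mesh_index n (t i)) =
        Y ((mesh_index n (t i))%:R * mesh n).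
      by apply/funext => w; rewrite drift_walkE// step2.
    by apply: mY; rewrite mulr_ge0// ltW// mesh_gt0.
  - by apply: mprod => i; exact: mY.
  - by move=> n w; exact: bnd.
  - by move=> w; exact: bnd.
  apply: aeW => w; apply: cvg_prod_seq => i; apply: continuous_cvg; first exact: cg.
  rewrite (_ : (fun n => _) = fun n => Y ((mesh_index n (t i))%:R * mesh n) w); last first.
    by apply/funext => n; rewrite drift_walkE ?step2.
  exact: (cvg_path_mesh (@cY w) (t0 i)).
apply/eqP; rewrite -subr_eq0; apply/eqP.
have lim1 := cvg_lim (@Rhausdorff R) (cvgB cvgF cvgF').
by rewrite -lim1; exact: (cvg_lim (@Rhausdorff R) diff0).
Qed.

End brownian.

(** * Laws of processes determined by continuous tests at finitely many times *)

Section half_lines.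
Context {R : realType}.

(** Pairs are (time, level). With lists as indices, intersection of events is concatenation and the
    empty list gives the whole space. *)
Definition half_line_sets : set (set (R -> R)) := [set S |
  exists2 s : seq (R * R), (forall p, p \in s -> 0 <= p.1) &
    S = [set phi : R -> R | forall p, p \in s -> p.2 <= phi p.1]].

Lemma half_line_sets_setI : setI_closed half_line_sets.
Proof.
move=> _ _ [s s0 ->] [r r0 ->]; exists (s ++ r).
  by move=> p; rewrite mem_cat => /orP[/s0|/r0].
apply/seteqP; split => [phi [sp rp] p|phi sr].
  by rewrite mem_cat => /orP[/sp|/rp].
by split => p pin; apply: sr; rewrite mem_cat pin ?orbT.
Qed.

Lemma measurable_half_line_sets : @measurable _ (@pathT R) = <<s half_line_sets >>.
Proof.
apply/seteqP; split.
  apply: smallest_sub; first exact: smallest_sigma_algebra.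
  move=> _ [s [U [s0 mU ->]]].
  have mev : measurable_fun setT
      (fun phi : g_sigma_algebraType half_line_sets => (phi : R -> R) s).
    apply: (measurability _ (RGenCInfty.measurableE R)) => _ [_ [x ->] <-].
    rewrite setTI; apply: sub_sigma_algebra; exists [:: (s, x)].
      by move=> p; rewrite inE => /eqP ->.
    apply/seteqP; split => phi /=; rewrite in_itv/= andbT.
      by move=> xs p; rewrite inE => /eqP ->.
    by move=> H; apply: (H (s, x)); rewrite inE.
  by have := mev measurableT U mU; rewrite setTI.
apply: smallest_sub; first exact: sigma_algebra_measurable.
move=> _ [s s0 ->].
rewrite (_ : [set phi | _] = \bigcap_(p in [set` s]) [set phi : @pathT R | p.2 <= (phi : R -> R) p.1]).
  apply: fin_bigcap_measurable; first exact: finite_seq.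
  move=> p /= ps; have := measurable_path_eval (s0 p ps) measurableT (measurable_itv `[p.2, +oo[).
  rewrite setTI (_ : _ @^-1` _ = [set phi : @pathT R | p.2 <= (phi : R -> R) p.1])//.
  by apply/seteqP; split => phi /=; rewrite in_itv/= andbT.
by [].
Qed.

(** Equal to [1] for [x >= c] and to [expR (- 2 * (c - x))] below, so its powers are continuous
    tests with values in [[0, 1]] decreasing to the indicator of the closed half-line. *)
Definition half_line_factor (c x : R) : R := expR ((x - c) - `|x - c|).

Lemma half_line_factor01 c x k : 0 <= half_line_factor c x ^+ k <= 1.
Proof.
rewrite exprn_ge0 ?expR_ge0//= exprn_ile1 ?expR_ge0//.
by rewrite -expR0 ler_expR subr_le0 ler_norm.
Qed.

Lemma continuous_half_line_factor c k : continuous (fun x => half_line_factor c x ^+ k).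
Proof.
move=> x.
have h : {for x, continuous (fun x => x - c)} by apply: continuousB; [exact: cvg_id|exact: cvg_cst].
have h1 : {for x, continuous (fun x => (x - c) - `|x - c|)}.
  by apply: continuousB => //; exact: (continuous_comp h (@norm_continuous _ _ _)).
have h2 := continuous_comp h1 (@continuous_expR R _).
exact: (continuous_comp h2 (@exprn_continuous _ k _)).
Qed.

Lemma cvg_half_line_factor (c x : R) :
  (half_line_factor c x ^+ k)%R @[k --> \oo] --> ((c <= x)%R%:R : R).
Proof.
rewrite /half_line_factor; case: leP => cx.
  rewrite ger0_norm ?subr_ge0// subrr expR0.
  by under eq_fun do rewrite expr1n; exact: cvg_cst.
apply: cvg_expr; rewrite gtr0_norm ?expR_gt0// -expR0 ltr_expR.
have := ltr0_norm (_ : x - c < 0); rewrite subr_lt0 cx => /(_ isT) ->.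
by rewrite opprK -mulr2n pmulrn_llt0// subr_lt0.
Qed.

End half_lines.

Section law.
Context d (T : measurableType d) (R : realType) (P : probability T R).

Lemma eq_law_of_continuous_fdd (X Y : R -> T -> R) :
  (forall s, 0 <= s -> measurable_fun setT (X s)) ->
  (forall s, 0 <= s -> measurable_fun setT (Y s)) ->
  (forall (m : nat) (t : 'I_m -> R) (g : 'I_m -> R -> R),
    (forall i, 0 <= t i) -> (forall i, continuous (g i)) ->
    (forall i x, 0 <= g i x <= 1) ->
    \int[P]_w (\prod_(i < m) g i (X (t i) w)) = \int[P]_w (\prod_(i < m) g i (Y (t i) w))) ->
  forall S, path_sigma_algebra S -> P [set w | S (X ^~ w)] = P [set w | S (Y ^~ w)].
Proof.
move=> mX mY XY S mS.
have bnd (s : seq (R * R)) (g : R * R -> R -> R) (x : R * R -> R) :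
    (forall p y, 0 <= g p y <= 1) -> `|\prod_(i < size s) g (tnth (in_tuple s) i) (x (tnth (in_tuple s) i))| <= 1.
  move=> g01; apply: norm01; apply: (big_ind (fun y => 0 <= y <= 1)) => //.
  - by rewrite ler01 lexx.
  - by move=> y z /andP[y0 y1] /andP[z0 z1]; rewrite mulr_ge0// mulr_ile1.
(* The probability of a half-line event is the limit in [k] of expectations of products of
   continuous tests, on which the two processes agree by hypothesis. *)
have main (s : seq (R * R)) (V : R -> T -> R) : (forall p, p \in s -> 0 <= p.1) ->
    (forall s, 0 <= s -> measurable_fun setT (V s)) ->
    let q := fun k w => \prod_(i < size s)
      half_line_factor (tnth (in_tuple s) i).2 (V (tnth (in_tuple s) i).1 w) ^+ k in
    [/\ measurable [set w | forall p, p \in s -> p.2 <= V p.1 w] &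
      \int[P]_w q k w @[k --> \oo] -->
        fine (P [set w | forall p, p \in s -> p.2 <= V p.1 w])].
  move=> s0 mV q; set A := [set w | _].
  pose f w : R := \prod_(i < size s) ((tnth (in_tuple s) i).2 <= V (tnth (in_tuple s) i).1 w)%R%:R.
  have fE : f = \1_A :> (T -> R).
    apply/funext => w; rewrite /f indicE; have [wA|nwA] := boolP (w \in A).
      apply: big1 => i _; move: wA; rewrite inE => /(_ (tnth (in_tuple s) i)).
      by rewrite mem_tnth => /(_ isT) ->.
    have /existsNP[p /not_implyP[ps /negP/negbTE pV]] : ~ A w by move=> wA; case/negP: nwA; rewrite inE.
    have [i ip] : exists i, p = tnth (in_tuple s) i by apply/tnthP.
    by rewrite (bigD1 i)//= -ip pV mul0r.
  have mA : measurable A.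
    rewrite (_ : A = \bigcap_(p in [set` s]) [set w | p.2 <= V p.1 w]); last by [].
    apply: fin_bigcap_measurable; first exact: finite_seq.
    move=> p /= ps; have := mV _ (s0 p ps) measurableT _ (measurable_itv `[p.2, +oo[).
    rewrite setTI (_ : _ @^-1` _ = [set w | p.2 <= V p.1 w])//.
    by apply/seteqP; split => w /=; rewrite in_itv/= andbT.
  split => //.
  have -> : fine (P A) = \int[P]_w f w.
    by rewrite fE /Rintegral integral_indic// setIT.
  apply: cvg_Rintegral_bounded.
  - move=> k; apply: measurable_prod => i _.
    have ti : 0 <= (tnth (in_tuple s) i).1 by apply: s0; exact: mem_tnth.
    have mg := continuous_measurable_fun (@continuous_half_line_factor _ (tnth (in_tuple s) i).2 k).
    exact: (measurable_fun_compT mg (mV _ ti)).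
  - by rewrite fE; exact: measurable_indic.
  - move=> k w; apply: (bnd s (fun p y => half_line_factor p.2 y ^+ k) (fun p => V p.1 w)) => p y.
    exact: half_line_factor01.
  - move=> w; apply: (bnd s (fun p y => (p.2 <= y)%R%:R) (fun p => V p.1 w)) => p y.
    by case: (p.2 <= y)%R => /=; rewrite ?mulr1n ?mulr0n ?lexx ?ler01.
  apply: aeW => w; apply: cvg_prod_seq => i; exact: cvg_half_line_factor.
pose X' : {mfun T >-> @pathT R} :=
  HB.pack (fun w => X ^~ w : @pathT R) (isMeasurableFun.Build _ _ _ _ _ (measurable_path_map mX)).
pose Y' : {mfun T >-> @pathT R} :=
  HB.pack (fun w => Y ^~ w : @pathT R) (isMeasurableFun.Build _ _ _ _ _ (measurable_path_map mY)).
suff : distribution P X' (S : set (@pathT R)) = distribution P Y' (S : set (@pathT R)) by [].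
have U := @measure_unique _ R (@pathT R) half_line_sets (fun=> setT)
  measurable_half_line_sets half_line_sets_setI _ _ (distribution P X') (distribution P Y').
apply: U => //.
- by move=> _; exists [::] => //; apply/seteqP; split.
- by rewrite bigcup_const//; exists 0%N.
- move=> _ [s s0 ->].
  have [mA cA] := main s X s0 mX; have [mC cC] := main s Y s0 mY.
  suff : fine (P [set w | forall p, p \in s -> p.2 <= X p.1 w]) =
         fine (P [set w | forall p, p \in s -> p.2 <= Y p.1 w]).
    by move=> e; move: (congr1 EFin e); rewrite !fineK ?fin_num_measure.
  rewrite -[LHS](cvg_lim (@Rhausdorff R) cA) -[RHS](cvg_lim (@Rhausdorff R) cC).
  apply: (congr1 (fun f : nat -> R => lim (f k @[k --> \oo]))); apply/funext => k.
  apply: (XY (size s) (fun i => (tnth (in_tuple s) i).1)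
    (fun i x => half_line_factor (tnth (in_tuple s) i).2 x ^+ k)).
  - by move=> i; apply: s0; exact: mem_tnth.
  - by move=> i; exact: continuous_half_line_factor.
  - by move=> i x; exact: half_line_factor01.
- by move=> _; rewrite (le_lt_trans (probability_le1 (distribution P X') measurableT))// ltry.
Qed.

End law.

(** * The total mass *)

Section total_mass.
Context {R : realType}.
Implicit Types (phi psi : R -> R) (s t c : R).

Lemma A_lt0 phi s : s < 0 -> A_ phi s = 0.
Proof. by move=> s0; rewrite /A_ set_itv_ge ?Rintegral_set0// bnd_simp -ltNge. Qed.

Lemma A_homo phi : continuous_path phi -> nondecreasing_fun (A_ phi).
Proof.
move=> cphi s t st; have [s0|s0] := ltP s 0; last exact: A_nondecreasing.
by rewrite (A_lt0 _ s0) A_ge0.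
Qed.

Lemma cvg_A_infty phi : continuous_path phi ->
  ((A_ phi s)%:E @[s --> +oo%R] --> A_infty phi)%E.
Proof.
move=> cphi; apply: nondecreasing_is_cvge => s t st.
by rewrite lee_fin A_homo.
Qed.

Lemma A_le_A_infty phi t : continuous_path phi -> ((A_ phi t)%:E <= A_infty phi)%E.
Proof.
move=> cphi; rewrite /A_infty.
have h : {homo (fun s => (A_ phi s)%:E) : s t / s <= t >-> (s <= t)%E}.
  by move=> u v uv; rewrite lee_fin A_homo.
rewrite (cvg_lim (@ereal_hausdorff R) (nondecreasing_cvge h)).
by apply: ereal_sup_ubound; exists t.
Qed.

Lemma A_infty_gt0 phi : continuous_path phi -> (0 < A_infty phi)%E.
Proof.
by move=> cphi; rewrite (lt_le_trans _ (A_le_A_infty 1 cphi))// lte_fin A_gt0.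
Qed.

Lemma A_infty_fin_num phi K : continuous_path phi ->
  (forall n : nat, A_ phi n%:R <= K) -> A_infty phi \is a fin_num.
Proof.
move=> cphi AK; rewrite ge0_fin_numE ?(ltW (A_infty_gt0 cphi))//.
apply: (@le_lt_trans _ _ K%:E); last exact: ltry.
apply: lime_le; first exact: (cvgP _ (cvg_A_infty cphi)).
near=> s; rewrite lee_fin; apply: (le_trans _ (AK (Num.truncn s).+1)).
by apply: A_homo => //; exact/ltW/truncnS_gt.
Unshelve. all: by end_near. Qed.

Lemma cvg_A_natmul phi : continuous_path phi ->
  ((A_ phi n%:R)%:E @[n --> \oo] --> A_infty phi)%E.
Proof.
move=> cphi.
by apply: (cvg_comp _ _ _ (cvg_A_infty cphi)); exact: cvgr_idn.
Qed.

(** [pathT] contains discontinuous paths, and the integral in [A_] involves uncountably many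
    coordinates. An upper limit of Riemann sums uses countably many, is measurable on all of
    [pathT], and agrees with [A_] on continuous paths. *)
Definition path_A t phi : R :=
  fine (limn_esup (fun n => (riemann_sum phi (mesh n) (mesh_index n t))%:E)).

Definition path_A_infty phi : R :=
  fine (limn_esup (fun n => (path_A n%:R phi)%:E)).

Lemma path_AE phi t : continuous_path phi -> 0 <= t -> path_A t phi = A_ phi t.
Proof.
move=> cphi t0; rewrite /path_A.
have /cvg_limn_einf_sup[_ ->] : ((riemann_sum phi (mesh n) (mesh_index n t))%:E @[n --> \oo]
    --> (A_ phi t)%:E)%E by apply: cvg_EFin; [exact: nearW|exact: cvg_riemann_sum].
by [].
Qed.

Lemma path_A_inftyE phi : continuous_path phi -> path_A_infty phi = fine (A_infty phi).
Proof.
move=> cphi; rewrite /path_A_infty; congr fine.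
under eq_fun do rewrite path_AE//.
by have /cvg_limn_einf_sup[_ ->] := cvg_A_natmul cphi.
Qed.

(** The sets that do not distinguish [phi] from [psi] form a sigma-algebra containing the coordinate
    sets. *)
Lemma path_sigma_algebra_eq (S : set (R -> R)) phi psi : path_sigma_algebra S ->
  (forall t, 0 <= t -> phi t = psi t) -> S phi = S psi.
Proof.
move=> mS e; suff : [set S : set (R -> R) | S phi = S psi] S by [].
apply: mS; split.
- split => /=.
  + by [].
  + by move=> A /= AE; rewrite /setD/= AE.
  + move=> F /= FE; rewrite propeqE; split => -[i _ Fi]; exists i => //.
      by rewrite -FE.
    by rewrite FE.
- by move=> _ [s [U [s0 _ ->]]] /=; rewrite e.
Qed.

Lemma measurable_fun_fine d (T : measurableType d) (f : T -> \bar R) :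
  measurable_fun setT f -> measurable_fun setT (fun x => fine (f x)).
Proof. by move=> mf; exact: (measurableT_comp _ mf). Qed.

Lemma measurable_path_A d (T : measurableType d) (X : R -> T -> R) t : 0 <= t ->
  (forall s, 0 <= s -> measurable_fun setT (X s)) ->
  measurable_fun setT (fun w => path_A t (X ^~ w)).
Proof.
move=> t0 mX; apply: measurable_fun_fine.
apply: (measurable_fun_limn_esup (f := fun n w => (riemann_sum (X ^~ w) (mesh n) (mesh_index n t))%:E)) => n.
apply/measurable_EFinP; apply: measurable_riemann_sum => //.
exact/ltW/mesh_gt0.
Qed.

Lemma measurable_path_A_infty d (T : measurableType d) (X : R -> T -> R) :
  (forall s, 0 <= s -> measurable_fun setT (X s)) ->
  measurable_fun setT (fun w => path_A_infty (X ^~ w)).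
Proof.
move=> mX; apply: measurable_fun_fine.
apply: (measurable_fun_limn_esup (f := fun n w => (path_A n%:R (X ^~ w))%:E)) => n.
by apply/measurable_EFinP; exact: measurable_path_A.
Qed.

Lemma continuous_A_path phi : continuous_path phi -> continuous_path (A_ phi).
Proof.
move=> cphi; apply: continuous_path_extend => t.
have -> : extend_path (A_ phi) = path_primitive phi \o (fun t => Num.max 0 t).
  by apply/funext => u; rewrite /extend_path/= A_primitive// le_max lexx.
apply: continuous_comp.
  by apply: (@continuous_max R _ (cst 0) id); [exact: cvg_cst|exact: cvg_id].
by apply: continuous_path_primitive => //; rewrite lt_max ltrN10.
Qed.

Lemma continuous_path_sub_ln phi (a : R -> R) :
  continuous_path phi -> continuous_path a -> (forall u, 0 <= u -> 0 < a u) ->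
  continuous_path (fun u => phi u - ln (a u)).
Proof.
move=> cphi ca a0; apply: continuous_path_extend => t.
apply: (@continuousB _ _ _ (extend_path phi) (fun u => ln (extend_path a u))).
  exact: continuous_extend_path.
apply: (@continuous_comp _ _ _ (extend_path a)); first exact: continuous_extend_path.
by apply: continuous_ln; rewrite a0// le_max lexx.
Qed.

Lemma continuous_path_affine (a : R -> R) b c :
  continuous_path a -> continuous_path (fun u => b + c * a u).
Proof.
move=> ca x; apply: cvgD; first exact: cvg_cst.
by apply: cvgMr; exact: ca.
Qed.

Section log_transform.
Variables (phi : R -> R) (c : R).
Hypotheses (cphi : continuous_path phi) (c0 : 0 <= c).

Let psi u := phi u - ln (1 + c * A_ phi u).

Let den_gt0 u : 0 < 1 + c * A_ phi u.
Proof. by rewrite ltr_pwDl// mulr_ge0// A_ge0. Qed.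

Lemma continuous_log_transform : continuous_path psi.
Proof.
apply: continuous_path_sub_ln => //.
exact/continuous_path_affine/continuous_A_path.
Qed.

(** Both sides vanish at [0] and have derivative [expR (2 * phi) / (1 + c * A_ phi) ^+ 2], which is
    [expR (2 * psi)]. *)
Lemma A_log_transform t : 0 <= t -> A_ psi t = A_ phi t / (1 + c * A_ phi t).
Proof.
rewrite le_eqVlt => /predU1P[<-|t0].
  by rewrite !A_at0 ?mul0r//; exact: continuous_log_transform.
pose p := path_primitive phi; pose q := path_primitive psi.
have pE u : 0 <= u -> p u = A_ phi u by move=> u0; exact/esym/A_primitive.
have d0 u : 0 <= u -> 0 < 1 + c * p u by move=> u0; rewrite pE.
have dH (u : R) : 0 < u -> is_derive u 1 (fun u : R => q u - p u / (1 + c * p u)) 0.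
  move=> u0; have u1 : -1 < u by rewrite (lt_trans _ u0)// ltrN10.
  have hp : is_derive u 1 p (expR (2 * extend_path phi u)) := is_derive_path_primitive cphi u1.
  have hq : is_derive u 1 q (expR (2 * extend_path psi u)) :=
    is_derive_path_primitive continuous_log_transform u1.
  have nz : 1 + c * p u != 0 by rewrite gt_eqF// d0// ltW.
  have hd : is_derive u 1 (fun u => 1 + c * p u) (c * expR (2 * extend_path phi u)).
    by apply: is_derive_eq; rewrite /GRing.scale/=; ring.
  have hv : is_derive u 1 (fun u => (1 + c * p u)^-1)
      (- (1 + c * p u) ^- 2 *: (c * expR (2 * extend_path phi u))).
    exact: is_deriveV.
  apply: is_derive_eq.
  rewrite !extend_pathE ?(ltW u0)// /psi -pE ?(ltW u0)// mulrBr expRD expRN.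
  rewrite (mulrC 2 (ln _)) mulr_natr -lnXn ?d0 ?(ltW u0)// lnK ?posrE ?exprn_gt0 ?d0 ?(ltW u0)//.
  by rewrite /GRing.scale/=; field.
have cp u : 0 <= u -> {for u, continuous p}.
  by move=> u0; apply: continuous_path_primitive => //; rewrite (lt_le_trans _ u0)// ltrN10.
have cq u : 0 <= u -> {for u, continuous q}.
  move=> u0; apply: continuous_path_primitive; first exact: continuous_log_transform.
  by rewrite (lt_le_trans _ u0)// ltrN10.
have [||x xt] := @MVT R (fun u => q u - p u / (1 + c * p u)) (fun=> 0) 0 t t0.
- by move=> u; rewrite in_itv/= => /andP[u0 _]; exact: dH.
- apply: continuous_in_subspaceT => u; rewrite inE/= in_itv/= => /andP[u0 _].
  apply: continuousB; first exact: cq.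
  apply: continuousM; first exact: cp.
  apply: continuousV; first by rewrite gt_eqF// d0.
  apply: continuousD; first exact: cvg_cst.
  by apply: continuousM; [exact: cvg_cst|exact: cp].
rewrite mul0r => /eqP; rewrite subr_eq0 => /eqP.
rewrite /q -!(A_primitive continuous_log_transform)// ?(ltW t0)// !pE ?(ltW t0)//.
rewrite !A_at0 ?mul0r ?subrr//; last exact: continuous_log_transform.
by move=> /eqP; rewrite subr_eq0 => /eqP.
Qed.

(** [x / (1 + c * x) = c^-1 - c^-1 / (1 + c * x)], whose second term vanishes as [x] grows. *)
Lemma A_infty_log_transform : 0 < c -> (A_ phi n%:R @[n --> \oo] --> +oo%R) ->
  A_infty psi = (c^-1)%:E.
Proof.
move=> cgt0 Aoo.
have h1 := cvg_A_natmul continuous_log_transform.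
apply: (cvg_unique (@ereal_hausdorff R) h1).
have -> : (fun n : nat => (A_ psi n%:R)%:E) =
    (fun n : nat => (c^-1 - c^-1 * (1 + c * A_ phi n%:R)^-1)%:E).
  by apply/funext => n; congr EFin; rewrite A_log_transform//; field; rewrite !gt_eqF.
apply: cvg_EFin; first exact: nearW.
rewrite -[X in _ --> X]subr0 -[X in _ --> _ - X](mulr0 c^-1).
apply: cvgB; first exact: cvg_cst.
apply: cvgMr; apply/gtr0_cvgV0; first by near=> n.
apply/cvgryPge => K; near=> n.
have : K / c <= A_ phi n%:R by near: n; move/cvgryPge : Aoo; apply.
rewrite ler_pdivrMr// mulrC => /le_trans -> //; lra.
Unshelve. all: by end_near. Qed.

End log_transform.

Lemma one_add_A_gt0 phi c t : continuous_path phi -> 0 < c -> 0 <= t ->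
  0 < 1 + A_ phi t * (c - 1 / fine (A_infty phi)).
Proof.
move=> cphi c0; rewrite le_eqVlt => /predU1P[<-|t0]; first by rewrite A_at0// mul0r addr0.
have At := A_gt0 cphi t0.
have := A_le_A_infty t cphi; have := A_infty_gt0 cphi.
(* When the total mass is infinite, [fine] returns [0] and so does the inverse, which leaves
   [1 + A * c]. Otherwise [A / a <= 1] suffices. *)
case: (A_infty phi) => [a|_ _|//] /=; last first.
  by rewrite invr0 mulr0 subr0 addr_gt0// mulr_gt0.
rewrite lte_fin lee_fin => a0 Aa.
have : A_ phi t * (1 / a) <= 1 by rewrite mul1r ler_pdivrMr// mul1r.
have : 0 < A_ phi t * c by rewrite mulr_gt0.
rewrite mulrBr; lra.
Qed.

End total_mass.

(* [x^-1] is the limit of [x / (x ^+ 2 + e)], also at the junk value [0^-1 = 0]. *)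
Lemma measurable_inv d (T : measurableType d) (R : realType) (f : T -> R) :
  measurable_fun setT f -> measurable_fun setT (fun x => (f x)^-1).
Proof.
move=> mf; apply: (@measurable_fun_cvg _ _ _ _
  (fun n x => f x * expR (- ln (f x * f x + mesh n)))).
  by move=> n; measurability.
move=> x _; have p n : 0 < f x * f x + mesh n.
  by rewrite ltr_wpDl ?mesh_gt0// -expr2 sqr_ge0.
have -> : (fun n => f x * expR (- ln (f x * f x + mesh n))) = (fun n => f x * (f x * f x + mesh n)^-1).
  by apply/funext => n; rewrite expRN lnK// posrE.
have [f0|f0] := eqVneq (f x) 0.
  by rewrite f0 invr0; under eq_fun do rewrite mul0r; exact: cvg_cst.
have e : (f x)^-1 = f x * (f x * f x + 0)^-1 by rewrite addr0; field.
rewrite e; apply: cvgMr; apply: cvgV; first by rewrite addr0 mulf_neq0.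
by apply: cvgD; [exact: cvg_cst|exact: cvg_mesh].
Qed.

(** * Almost sure divergence of the exponential functional under positive drift *)

Section divergence.
Context d (T : measurableType d) (R : realType) (P : probability T R).
Variables (mu : R) (B : R -> T -> R).
Hypothesis mu_gt0 : 0 < mu.
Hypothesis B_bm : brownian_motion P B.

Let mB s : 0 <= s -> measurable_fun setT (B s). Proof. by case: B_bm => + _ _ _ _; apply. Qed.
Let B0 w : B 0 w = 0. Proof. by case: B_bm. Qed.
Let cB w : continuous_path (B ^~ w). Proof. by case: B_bm. Qed.

Lemma brownian_exp_moment c s : 0 <= s ->
  (\int[P]_w (expR (c * B s w))%:E = (expR (c ^+ 2 * s / 2))%:E)%E.
Proof.
(* Time [0] is separate, since increments have a prescribed law only between distinct times. *)
rewrite le_eqVlt => /predU1P[<-|s0].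
  rewrite mulr0 mul0r expR0 (eq_integral (cst 1%E)).
    by rewrite integral_cst// mul1e; exact: probability_setT.
  by move=> w _; rewrite B0 mulr0 expR0.
pose X : {mfun T >-> measurableTypeR R} :=
  HB.pack (B s) (isMeasurableFun.Build _ _ _ (measurableTypeR R) (B s) (mB (ltW s0))).
have me : measurable_fun setT (fun z : measurableTypeR R => (expR (c * z))%:E).
  by apply/measurable_EFinP; measurability.
transitivity (\int[distribution P X]_z (expR (c * z))%:E)%E.
  by rewrite ge0_integral_distribution// => z; rewrite lee_fin expR_ge0.
have sq0 : 0 < Num.sqrt s by rewrite sqrtr_gt0.
transitivity (\int[normal_prob 0 (Num.sqrt s)]_z (expR (c * z))%:E)%E.
  apply: eq_measure_integral => A mA _; have [_ _ _ inc _] := B_bm.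
  have := inc 0 s (lexx _) s0 A mA; rewrite subr0; apply: etrans.
  rewrite /distribution/pushforward; congr (P _).
  by apply/seteqP; split => w /=; rewrite B0 subr0.
by rewrite normal_mgf// sqr_sqrtr// ltW.
Qed.

Let Z u w := B u w + mu * u.

Let mZ s : 0 <= s -> measurable_fun setT (Z s).
Proof. by move=> s0; apply: measurable_funD => //; exact: mB. Qed.
Let cZ w : continuous_path (Z ^~ w). Proof. exact: continuous_path_addlin. Qed.

Let a := mu ^+ 2 / 2.
Let a_gt0 : 0 < a. Proof. by rewrite divr_gt0// exprn_gt0. Qed.

(** The mean of [expR (c * Z s)] is [expr ((c * mu + c ^+ 2 / 2) * s)] with the real exponential;
    [c = - mu] minimizes the rate and gives decay at rate [a]. *)
Lemma drifted_exp_moment s : 0 <= s ->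
  (\int[P]_w (expR (- mu * Z s w))%:E = (expR (- (a * s)))%:E)%E.
Proof.
move=> s0; have h := brownian_exp_moment (- mu) s0.
transitivity (\int[P]_w ((expR (- mu ^+ 2 * s))%:E * (expR (- mu * B s w))%:E))%E.
  by apply: eq_integral => w _; rewrite -EFinM -expRD; congr (expR _)%:E; rewrite /Z; ring.
rewrite ge0_integralZl//.
- by rewrite h -EFinM -expRD; congr (expR _)%:E; rewrite /a; field.
- by apply/measurable_EFinP; have m := mB s0; measurability.
Qed.

(** Either [x + y >= 0], or one of [x] and [y] is negative. Thus a cell of the Riemann sum of [A(Z)]
    contributes at least its length, up to terms of exponentially small mean. *)
Lemma expRD_ge x y : 1 <= expR (x + y) + (expR (- mu * x) + expR (- mu * y)) :> R.
Proof.
have [xy|xy] := leP 0 (x + y).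
  rewrite (@le_trans _ _ (expR (x + y)))//; first by rewrite -expR0 ler_expR.
  by rewrite lerDl addr_ge0 ?expR_ge0.
have h z : z < 0 -> 1 <= expR (- mu * z).
  by move=> z0; rewrite -expR0 ler_expR mulNr -mulrN mulr_ge0 ?oppr_ge0 ?ltW.
have [x0|x0] := ltP x 0.
  rewrite addrCA (le_trans (h x x0))// lerDl addr_ge0 ?expR_ge0//.
have y0 : y < 0 by lra.
by rewrite addrA (le_trans (h y y0))// lerDr addr_ge0 ?expR_ge0.
Qed.

(** Bounds the amount by which the Riemann sum falls short of the elapsed time; its mean is bounded
    uniformly in the number of steps and, for [del <= 1], in the mesh. *)
Let dev del k w := \sum_(j < k) del * (expR (- mu * Z (j%:R * del) w) + expR (- mu * Z (j.+1%:R * del) w)).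

Lemma riemann_sum_dev del k w : 0 <= del ->
  k%:R * del <= riemann_sum (Z ^~ w) del k + dev del k w.
Proof.
move=> d0; rewrite /riemann_sum /dev -big_split/=.
rewrite (_ : k%:R * del = \sum_(j < k) del); last by rewrite sumr_const card_ord mulr_natl.
apply: ler_sum => j _; rewrite -mulrDr ler_peMr//; exact: expRD_ge.
Qed.

(** With [x = expR (- (a * del))] the sum is at most [2 * del / (1 - x)]. As
    [1 - x >= a * del / (1 + a * del)], this is at most [2 * (1 + a * del) / a], and [del <= 1]. *)
Lemma geometric_riemann_bound del k : 0 < del <= 1 ->
  \sum_(j < k) del * (expR (- (a * (j%:R * del))) + expR (- (a * (j.+1%:R * del)))) <=
  2 * (1 + a) / a.
Proof.
move=> /andP[d0 d1]; pose x := expR (- (a * del)).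
have x1 : x < 1 by rewrite /x -expR0 ltr_expR oppr_lt0 mulr_gt0.
have x0 : 0 <= x by exact: expR_ge0.
have xE (j : nat) : expR (- (a * (j%:R * del))) = x ^+ j.
  by rewrite /x -expRM_natl; congr expR; ring.
apply: (@le_trans _ _ (\sum_(j < k) (2 * del) * x ^+ j)).
  apply: ler_sum => j _; rewrite !xE.
  have -> : 2 * del * x ^+ j = del * (x ^+ j + x ^+ j) by ring.
  by rewrite ler_wpM2l ?(ltW d0)// lerD2l exprS ler_piMl ?exprn_ge0// ltW.
rewrite -mulr_sumr.
have S : (1 - x) * \sum_(j < k) x ^+ j <= 1.
  have e := subrX1 x k; have : 0 <= x ^+ k by rewrite exprn_ge0.
  have -> : (1 - x) * \sum_(j < k) x ^+ j = - ((x - 1) * \sum_(i < k) x ^+ i) by ring.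
  rewrite -e; lra.
have X : a * del <= (1 - x) * (1 + a * del).
  have h : x * (1 + a * del) <= 1.
    apply: (@le_trans _ _ (x * expR (a * del))); first by rewrite ler_wpM2l// expR_ge1Dx.
    by rewrite /x -expRD addNr expR0.
  by rewrite mulrBl mul1r; lra.
set s := \sum_(j < k) _ in S *.
have s0 : 0 <= s by apply: sumr_ge0 => j _; rewrite exprn_ge0.
rewrite ler_pdivlMr//.
have ad : a * del <= a by rewrite ler_piMr// ltW.
have : s * (a * del) <= 1 + a * del.
  apply: (le_trans (ler_wpM2l s0 X)); rewrite mulrA -[leRHS]mul1r (mulrC s).
  by rewrite ler_wpM2r// addr_ge0// mulr_ge0 ?ltW.
rewrite (_ : 2 * del * s * a = 2 * (s * (a * del))); last by ring.
by move=> h; rewrite ler_wpM2l// (le_trans h)// lerD2l.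
Qed.

Let C := 2 * (1 + a) / a.

Lemma dev_mean del k : 0 < del <= 1 -> (\int[P]_w (dev del k w)%:E <= C%:E)%E.
Proof.
move=> del01; have /andP[d0 d1] := del01.
have t0 j : 0 <= j%:R * del by rewrite mulr_ge0 ?(ltW d0).
have me (j : nat) : measurable_fun setT (fun w => (expR (- mu * Z (j%:R * del) w))%:E).
  by apply/measurable_EFinP; have m := mZ (t0 j); measurability.
have -> : (\int[P]_w (dev del k w)%:E = \int[P]_w \sum_(j < k)
    (del%:E * ((expR (- mu * Z (j%:R * del) w))%:E + (expR (- mu * Z (j.+1%:R * del) w))%:E)))%E.
  by apply: eq_integral => w _; rewrite /dev -sumEFin.
rewrite ge0_integral_sum//; last 2 first.
- by move=> j; apply: measurable_funeM; apply: emeasurable_funD.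
- by move=> j w _; rewrite mule_ge0 ?adde_ge0 ?lee_fin ?expR_ge0 ?(ltW d0).
apply: le_trans (_ : (\sum_(j < k) del * (expR (- (a * (j%:R * del))) + expR (- (a * (j.+1%:R * del)))))%:E <= _)%E; last first.
  by rewrite lee_fin geometric_riemann_bound.
rewrite -sumEFin; apply: lee_sum => j _.
rewrite ge0_integralZl//; last 3 first.
- exact: emeasurable_funD.
- by move=> w _; rewrite adde_ge0 ?lee_fin ?expR_ge0.
- by rewrite lee_fin ltW.
by rewrite ge0_integralD// !drifted_exp_moment.
Qed.

(** Passing to the inverse turns the bounded mean of [dev] into decay in [t], and the integrand is
    bounded by [1], so the estimate for Riemann sums passes to the limit. *)
Lemma inv_A_mean t : 0 <= t -> \int[P]_w (1 + A_ (Z ^~ w) t)^-1 <= (1 + C) / (1 + t).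
Proof.
move=> t0; have t1 : 0 < 1 + t by rewrite ltr_pwDl.
pose r n w := riemann_sum (Z ^~ w) (mesh n) (mesh_index n t).
have r0 n w : 0 <= r n w by apply: riemann_sum_ge0; exact/ltW/mesh_gt0.
have mr n : measurable_fun setT (r n) by apply: measurable_riemann_sum => //; exact/ltW/mesh_gt0.
have inv01 (x : R) : 0 <= x -> `|(1 + x)^-1| <= 1.
  by move=> x0; rewrite ger0_norm ?invr_ge0 ?addr_ge0// invf_le1 ?lerDl// ltr_pwDl.
have mA := measurable_A mZ cZ t0.
have cvgI : \int[P]_w (1 + r n w)^-1 @[n --> \oo] --> \int[P]_w (1 + A_ (Z ^~ w) t)^-1.
  apply: cvg_Rintegral_bounded.
  - by move=> n; apply: measurable_inv; exact: measurable_funD.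
  - by apply: measurable_inv; exact: measurable_funD.
  - by move=> n w; exact: inv01.
  - by move=> w; apply: inv01; exact: A_ge0.
  apply: aeW => w; apply: cvgV; first by rewrite gt_eqF// ltr_pwDl// A_ge0.
  by apply: cvgD; [exact: cvg_cst|exact: cvg_riemann_sum].
rewrite -(cvg_lim (@Rhausdorff R) cvgI); apply: limr_le; first exact: (cvgP _ cvgI).
near=> n.
have m01 : 0 < (mesh n : R) <= 1 by rewrite mesh_gt0 /mesh invf_le1// ler1n.
have mD : measurable_fun setT (dev (mesh n) (mesh_index n t)).
  apply: measurable_sum => j; have m1 := mZ (mulr_ge0 (ler0n R j) (ltW (mesh_gt0 n))).
  have m2 := mZ (mulr_ge0 (ler0n R j.+1) (ltW (mesh_gt0 n))); measurability.
have D0 w : 0 <= dev (mesh n) (mesh_index n t) w.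
  by apply: sumr_ge0 => j _; rewrite mulr_ge0 ?addr_ge0 ?expR_ge0// ltW// mesh_gt0.
rewrite -lee_fin -(@integral_EFin_Rintegral _ _ _ P _ 1)//; last 2 first.
- by apply: measurable_inv; exact: measurable_funD.
- by move=> w; exact: inv01.
apply: (@le_trans _ _ (\int[P]_w (((1 + t)^-1)%:E * (1%:E + (dev (mesh n) (mesh_index n t) w)%:E)))%E).
  apply: ge0_le_integral => //.
  - by move=> w _; rewrite lee_fin invr_ge0 addr_ge0.
  - by apply/measurable_EFinP; apply: measurable_inv; exact: measurable_funD.
  - by apply: measurable_funeM; apply: emeasurable_funD => //; exact/measurable_EFinP.
  (* [1 + t <= 1 + r + dev <= (1 + r) * (1 + dev)], where [r] is the Riemann sum. *)
  move=> w _; rewrite -EFinD -EFinM lee_fin ler_pdivlMl// ler_pdivrMr ?ltr_pwDl//.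
  have := riemann_sum_dev (mesh_index n t) w (ltW (mesh_gt0 n)).
  have /andP[lb _] := mesh_index_bound n t0; rewrite -/(r n w).
  have : 0 <= dev (mesh n) (mesh_index n t) w * r n w by rewrite mulr_ge0.
  have := r0 n w; rewrite mulrDr mulrDl !mul1r mulr1; lra.
rewrite ge0_integralZl//; last 3 first.
- by apply: emeasurable_funD => //; exact/measurable_EFinP.
- by move=> w _; rewrite adde_ge0// lee_fin.
- by rewrite lee_fin invr_ge0 ltW.
rewrite ge0_integralD//; last 2 first.
- by move=> w _; rewrite lee_fin.
- exact/measurable_EFinP.
rewrite integral_cst// mul1e [X in (X + _)%E]probability_setT mulrC EFinM.
by rewrite lee_pmul2l// ?lte_fin ?invr_gt0// EFinD leeD2l// dev_mean.
Unshelve. all: by end_near. Qed.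

(** For each integer [K], staying below [K] at all integer times has probability [0], as the mean of
    [(1 + A)^-1] tends to [0]; monotonicity of [A_] upgrades unboundedness to divergence. *)
Lemma A_drifted_unbounded : {ae P, forall w, A_ (Z ^~ w) n%:R @[n --> \oo] --> +oo%R}.
Proof.
have mA n : measurable_fun setT (fun w => A_ (Z ^~ w) n%:R) by exact: measurable_A.
have C0 : 0 < 1 + C by rewrite addr_gt0// divr_gt0// mulr_gt0// addr_gt0.
have null (K : nat) : {ae P, forall w, ~ forall n : nat, A_ (Z ^~ w) n%:R <= K%:R}.
  pose E := [set w | forall n : nat, A_ (Z ^~ w) n%:R <= K%:R].
  have mE : measurable E.
    rewrite (_ : E = \bigcap_n [set w | A_ (Z ^~ w) n%:R <= K%:R]); last first.
      by apply/seteqP; split => w /=; [move=> H n _; exact: H|move=> H n; exact: H].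
    apply: bigcap_measurableType => n _.
    have -> : [set w | A_ (Z ^~ w) n%:R <= K%:R] = (fun w => A_ (Z ^~ w) n%:R) @^-1` `]-oo, K%:R].
      by apply/seteqP; split => w /=; rewrite in_itv.
    by rewrite -[X in measurable X]setTI; exact: mA.
  exists E; split => //; last by move=> w /= /contrapT.
  (* Markov's inequality: on [E] the inverse [(1 + A)^-1] is at least [(1 + K)^-1]. *)
  have PE n : fine (P E) <= (1 + K%:R) * (1 + C) / (1 + n%:R).
    have K0 : 0 < (1 + K%:R)^-1 :> R by rewrite invr_gt0 ltr_pwDl.
    rewrite -mulrA -ler_pdivrMl ?ltr_pwDl//.
    apply: le_trans (inv_A_mean (ler0n _ n)).
    rewrite -lee_fin -(@integral_EFin_Rintegral _ _ _ P _ 1)//; last 2 first.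
    - by apply: measurable_inv; exact: measurable_funD.
    - move=> w; rewrite ger0_norm ?invr_ge0 ?addr_ge0 ?A_ge0//.
      by rewrite invf_le1 ?lerDl ?A_ge0// ltr_pwDl ?A_ge0.
    apply: (@le_trans _ _ (\int[P]_(w in E) ((1 + K%:R)^-1)%:E)%E).
      by rewrite integral_cst//= EFinM fineK// fin_num_measure.
    apply: (@le_trans _ _ (\int[P]_(w in E) ((1 + A_ (Z ^~ w) n%:R)^-1)%:E)%E).
      apply: ge0_le_integral => //.
      - apply: measurable_funTS; apply/measurable_EFinP.
        by apply: measurable_inv; exact: measurable_funD.
      by move=> w /= Ew; rewrite lee_fin lef_pV2 ?posrE ?lerD2l// ltr_pwDl// A_ge0.
    apply: ge0_subset_integral => //.
    - by apply/measurable_EFinP; apply: measurable_inv; exact: measurable_funD.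
    - by move=> w _; rewrite lee_fin invr_ge0 addr_ge0// A_ge0.
  have PE0 : fine (P E) <= 0.
    apply/ler_addgt0Pr => e e0; rewrite add0r.
    pose D := (1 + K%:R) * (1 + C).
    apply: (le_trans (PE (Num.truncn (D / e)))); rewrite -/D.
    have De : D / e < (Num.truncn (D / e)).+1%:R by exact: truncnS_gt.
    rewrite -natr1 addrC in De.
    rewrite ler_pdivrMr ?ltr_pwDl// mulrC -ler_pdivrMr//; exact: ltW.
  by apply/eqP; rewrite eq_le measure_ge0 andbT -[P E]fineK ?fin_num_measure//.
apply: filterS (ae_foralln null) => w H; apply/cvgryPge => M.
have /existsNP[N /negP] := H (Num.truncn M).+1; rewrite -ltNge => HN.
near=> n; apply: (le_trans (ltW (truncnS_gt M))); apply: (le_trans (ltW HN)).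
by apply: A_homo => //; rewrite ler_nat; near: n; exact: nbhs_infty_ge.
Unshelve. all: by end_near. Qed.

End divergence.

(** * The laws of the transformed processes *)

Lemma indic_congr (R : pzRingType) (U V : Type) (A : set U) (C : set V) u v :
  A u = C v -> \1_A u = \1_C v :> R.
Proof. by move=> e; rewrite !indicE /in_mem/= /in_set e. Qed.

Section transfer.
Context d (T : measurableType d) (R : realType) (P : probability T R).

Lemma ae_eq_measure (A C : set T) : measurable A -> measurable C ->
  {ae P, forall w, A w = C w} -> P A = P C.
Proof.
move=> mA mC AC; rewrite -[A]setIT -[C]setIT -!integral_indic//.
apply: ge0_ae_eq_integral => //.
- by apply/measurable_EFinP; exact: measurable_indic.
- by apply/measurable_EFinP; exact: measurable_indic.
- by apply: filterS AC => w AC _; exact: (congr1 EFin (indic_congr _ AC)).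
Qed.

Lemma ge0_integral_eq_law d1 (E : measurableType d1) (X Y : T -> E) (h : E -> \bar R) :
  measurable_fun setT X -> measurable_fun setT Y ->
  (forall A, measurable A -> P (X @^-1` A) = P (Y @^-1` A)) ->
  measurable_fun setT h -> (forall x, (0 <= h x)%E) ->
  (\int[P]_w h (X w) = \int[P]_w h (Y w))%E.
Proof.
move=> mX mY XY mh h0.
pose X' : {mfun T >-> E} := HB.pack X (isMeasurableFun.Build _ _ _ _ X mX).
pose Y' : {mfun T >-> E} := HB.pack Y (isMeasurableFun.Build _ _ _ _ Y mY).
transitivity (\int[distribution P X']_x h x)%E; first by rewrite ge0_integral_distribution.
transitivity (\int[distribution P Y']_x h x)%E; last by rewrite ge0_integral_distribution.
by apply: eq_measure_integral => A mA _; exact: XY.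
Qed.

End transfer.

Section final.
Context d (T : measurableType d) (R : realType) (P : probability T R).
Variables (mu : R) (B : R -> T -> R) (gam : {RV P >-> R}).
Hypothesis mu_gt0 : 0 < mu.
Hypothesis B_bm : brownian_motion P B.
Hypothesis gam_law : gamma_rv mu gam.
Hypothesis B_gam_indep : process_rv_independent B gam.

Let mB s : 0 <= s -> measurable_fun setT (B s). Proof. by case: B_bm => + _ _ _ _; apply. Qed.
Let cB w : continuous_path (B ^~ w). Proof. by case: B_bm. Qed.

Let Z u w := B u w + mu * u.
Let Y := drifted mu B.
Let W := reversed_process mu B gam.

Let cZ w : continuous_path (Z ^~ w). Proof. exact: continuous_path_addlin. Qed.

Let cY w : continuous_path (Y ^~ w).
Proof.
rewrite (_ : Y ^~ w = fun u => B u w + - mu * u).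
  exact: (@continuous_path_addlin R (B ^~ w)).
by apply/funext => u; rewrite /Y /drifted mulNr.
Qed.

Let mY s : 0 <= s -> measurable_fun setT (Y s).
Proof. by move=> s0; apply: measurable_funB => //; exact: mB. Qed.

Let mW s : 0 <= s -> measurable_fun setT (W s).
Proof. by move=> s0; exact: measurable_reversed_process. Qed.

Lemma law_reversed_process S : path_sigma_algebra S ->
  P [set w | S (W ^~ w)] = P [set w | S (Y ^~ w)].
Proof.
apply: eq_law_of_continuous_fdd => // m t g t0 cg g01.
exact: fdd_reversed_process.
Qed.

Let RR := measurableTypeR R.

(** The transform of the theorem, with the path and the gamma value as arguments; [path_A] and
    [path_A_infty] make it jointly measurable on all of path space. *)
Let F (s : R) (p : @pathT R * RR) : R :=
  (p.1 : R -> R) s - ln (1 + path_A s p.1 * (2 * p.2 - 1 / path_A_infty p.1)).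

(** The drift is added inside, so that [G] is evaluated at [B] itself, the path whose independence
    from [gam] is given. *)
Let G (s : R) (p : @pathT R * RR) : R :=
  ((p.1 : R -> R) s + mu * s) - ln (1 + 2 * p.2 * path_A s (fun u => (p.1 : R -> R) u + mu * u)).

Let mfst s : 0 <= s -> measurable_fun setT (fun p : @pathT R * RR => (p.1 : R -> R) s).
Proof. by move=> s0; exact: measurable_fun_compT (measurable_path_eval s0) measurable_fst. Qed.

Let msnd : measurable_fun setT (fun p : @pathT R * RR => p.2 : R).
Proof. exact: measurable_snd. Qed.

Let mF s : 0 <= s -> measurable_fun setT (F s).
Proof.
move=> s0; have m1 := mfst s0.
have m2 := measurable_path_A (X := fun s (p : @pathT R * RR) => (p.1 : R -> R) s) s0 mfst.
have m3 := measurable_inv (measurable_path_A_infty (X := fun s (p : @pathT R * RR) => (p.1 : R -> R) s) mfst).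
by rewrite /F; measurability.
Qed.

Let mG s : 0 <= s -> measurable_fun setT (G s).
Proof.
move=> s0; have m1 := mfst s0.
have m2 : measurable_fun setT (fun p : @pathT R * RR => path_A s (fun u => (p.1 : R -> R) u + mu * u)).
  have mX (u : R) : 0 <= u -> measurable_fun setT
      (fun p : @pathT R * RR => (p.1 : R -> R) u + mu * u).
    by move=> u0; have m := mfst u0; measurability.
  exact: (measurable_path_A s0 mX).
by rewrite /G; measurability.
Qed.

Let gam_gt0 : {ae P, forall w, 0 < gam w}. Proof. exact: gamma_rv_gt0 gam_law. Qed.

Let WE w : W ^~ w = fun u => Z u w - ln (1 + 2 * gam w * A_ (Z ^~ w) u).
Proof. by []. Qed.

Let ae_W : {ae P, forall w, [/\ 0 < gam w, continuous_path (W ^~ w) &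
  A_infty (W ^~ w) = ((2 * gam w)^-1)%:E]}.
Proof.
apply: filterS2 gam_gt0 (A_drifted_unbounded mu_gt0 B_bm) => w g0 Aoo.
have c0 : 0 < 2 * gam w by rewrite mulr_gt0.
split => //; rewrite WE.
- exact: (continuous_log_transform (@cZ w) (ltW c0)).
- exact: (A_infty_log_transform (@cZ w) (ltW c0) c0 Aoo).
Qed.

(** The total mass of [W] gives back [2 * gam w], so [F] removes the logarithm built with [gam w]
    and installs the one built with [u]. *)
Let FW w u s : continuous_path (W ^~ w) -> A_infty (W ^~ w) = ((2 * gam w)^-1)%:E ->
  0 < gam w -> 0 < u -> 0 <= s -> F s (W ^~ w, u) = G s (B ^~ w, u).
Proof.
move=> cW AW g0 u0 s0; have c0 : 0 <= 2 * gam w by rewrite mulr_ge0// ltW.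
have cZw := @cZ w.
rewrite /F /G/= path_A_inftyE// AW/= (path_AE cW s0) (path_AE cZw s0).
have -> : A_ (W ^~ w) s = A_ (Z ^~ w) s / (1 + 2 * gam w * A_ (Z ^~ w) s).
  by rewrite WE; exact: (A_log_transform cZw c0 s0).
have -> : W s w = Z s w - ln (1 + 2 * gam w * A_ (Z ^~ w) s) by [].
have A0 := A_ge0 (Z ^~ w) s; rewrite -/(Z s w); set A := A_ _ _ in A0 *.
have d1 : 0 < 1 + 2 * gam w * A by rewrite ltr_pwDl// mulr_ge0.
have d2 : 0 < 1 + 2 * u * A by rewrite ltr_pwDl// mulr_ge0// mulr_ge0// ltW.
rewrite div1r invrK.
have -> : 1 + A / (1 + 2 * gam w * A) * (2 * u - 2 * gam w) =
    (1 + 2 * u * A) / (1 + 2 * gam w * A) by field; rewrite gt_eqF.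
by rewrite ln_div ?posrE//; ring.
Qed.

Let GB w s : 0 <= s -> G s (B ^~ w, gam w) = W s w.
Proof. by move=> s0; rewrite /G/= (path_AE (@cZ w) s0). Qed.

Let gam' : {mfun T >-> RR} :=
  HB.pack (gam : T -> R) (isMeasurableFun.Build _ _ _ RR gam (measurable_funPT gam)).

Let nu : probability RR R := distribution P gam'.

Let nu_gt0 : {ae nu, forall u : RR, 0 < (u : R)}.
Proof.
exists `]-oo, 0]%classic; split => //.
- have [N [mN N0 sN]] := gam_gt0.
  have mE : measurable (gam @^-1` `]-oo, 0%R]).
    by rewrite -[X in measurable X]setTI; exact: (measurable_funPT gam).
  have EN : gam @^-1` `]-oo, 0%R] `<=` N.
    by move=> w /=; rewrite in_itv/= => g0; apply: sN => /=; rewrite ltNge g0.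
  exact: (subset_measure0 mE mN EN N0).
- by move=> u /= /negP; rewrite in_itv/= -leNgt.
Qed.

Let indep (X : R -> T -> R) (H : @pathT R * RR -> \bar R) :
  (forall s, 0 <= s -> measurable_fun setT (X s)) ->
  (forall A C, path_sigma_algebra A -> measurable C ->
    P ([set w | A (X ^~ w)] `&` gam @^-1` C) = (P [set w | A (X ^~ w)] * P (gam @^-1` C))%E) ->
  measurable_fun setT H -> (forall p, (0 <= H p)%E) ->
  (\int[P]_w H (X ^~ w, gam w) = \int[P]_w \int[nu]_u H (X ^~ w, u))%E.
Proof.
move=> mX ind mH H0.
apply: (@ge0_integral_indep _ T R P _ (@pathT R) _ RR (fun w => X ^~ w) gam nu H) => //.
exact: measurable_path_map.
exact: (measurable_funPT gam).
Qed.

Let indepY A C : path_sigma_algebra A -> measurable C ->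
  P ([set w | A (Y ^~ w)] `&` gam @^-1` C) = (P [set w | A (Y ^~ w)] * P (gam @^-1` C))%E.
Proof.
move=> mA mC.
(* Subtracting the drift is a measurable map of path space, so events of [Y] are events of [B]. *)
pose A' : set (R -> R) := [set phi | A (fun s => phi s - mu * s)].
have mA' : path_sigma_algebra A'.
  apply: (@measurable_path_set R _ (@pathT R) (fun s phi => (phi : R -> R) s - mu * s)) => // s s0.
  by apply: measurable_funB => //; exact: measurable_path_eval.
exact: (B_gam_indep mA' mC).
Qed.

(** [W] depends on [gam], so [gam] is integrated out against its law [nu] before [Y] is replaced by
    [W]. The variable [u] of that integral is the independent copy, and the probability space is not
    enlarged. At the end, independence of [B] and [gam] turns [u] back into [gam]. *)
Lemma law_path_transform S : path_sigma_algebra S ->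
  P [set w | S (fun s => F s (Y ^~ w, gam w))] = P [set w | S (Y ^~ w)].
Proof.
move=> mS.
have mAF : measurable [set p | S (F ^~ p)] by exact: measurable_path_set.
have mAG : measurable [set p | S (G ^~ p)] by exact: measurable_path_set.
pose HF p : \bar R := (\1_[set p | S (F ^~ p)] p)%:E.
pose HG p : \bar R := (\1_[set p | S (G ^~ p)] p)%:E.
have mHF : measurable_fun setT HF by apply/measurable_EFinP; exact: measurable_indic.
have mHG : measurable_fun setT HG by apply/measurable_EFinP; exact: measurable_indic.
have HF0 p : (0 <= HF p)%E by rewrite lee_fin.
have HG0 p : (0 <= HG p)%E by rewrite lee_fin.
have probE (X : R -> T -> R) (f : R -> @pathT R * RR -> R) :
    (forall s, 0 <= s -> measurable_fun setT (X s)) ->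
    (forall s, 0 <= s -> measurable_fun setT (f s)) ->
    P [set w | S (fun s => f s (X ^~ w, gam w))] =
    (\int[P]_w (\1_[set p | S (f ^~ p)] (X ^~ w : @pathT R, gam w : RR))%:E)%E.
  move=> mX mf; rewrite -[X in P X]setIT -integral_indic//.
  have mXg : measurable_fun setT (fun w => (X ^~ w : @pathT R, gam w : RR)).
    by apply: measurable_fun_pair; [exact: measurable_path_map|exact: (measurable_funPT gam)].
  have := measurable_path_set mf mS => mP.
  by rewrite -[X in measurable X]setTI; exact: (mXg measurableT _ mP).
rewrite (probE Y F)// (indep mY indepY mHF HF0).
have mIF : measurable_fun setT (fun phi : @pathT R => (\int[nu]_u HF (phi, u))%E).
  exact: (@measurable_fun_fubini_tonelli_F _ _ (@pathT R) RR R nu HF mHF HF0).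
have mIG : measurable_fun setT (fun phi : @pathT R => (\int[nu]_u HG (phi, u))%E).
  exact: (@measurable_fun_fubini_tonelli_F _ _ (@pathT R) RR R nu HG mHG HG0).
have sec (phi : @pathT R) : measurable_fun setT (fun u : RR => (phi, u)).
  by apply: measurable_fun_pair; [exact: measurable_cst|exact: measurable_id].
have mHFs (phi : @pathT R) : measurable_fun setT (fun u : RR => HF (phi, u)).
  exact: (measurable_fun_compT mHF (sec phi)).
have mHGs (phi : @pathT R) : measurable_fun setT (fun u : RR => HG (phi, u)).
  exact: (measurable_fun_compT mHG (sec phi)).
transitivity (\int[P]_w \int[nu]_u HF (W ^~ w, u))%E.
  apply: (ge0_integral_eq_law (X := fun w => Y ^~ w : @pathT R) (Y := fun w => W ^~ w : @pathT R)
    (h := fun phi => (\int[nu]_u HF (phi, u))%E)) => //.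
  - exact: measurable_path_map.
  - exact: measurable_path_map.
  - by move=> A mA; exact/esym/law_reversed_process.
  - by move=> phi; apply: integral_ge0.
transitivity (\int[P]_w \int[nu]_u HG (B ^~ w, u))%E.
  apply: ge0_ae_eq_integral => //.
  - exact: (measurable_fun_compT mIF (measurable_path_map mW)).
  - exact: (measurable_fun_compT mIG (measurable_path_map mB)).
  - by move=> w _; apply: integral_ge0.
  - by move=> w _; apply: integral_ge0.
  apply: filterS ae_W => w [g0 cW AW] _.
  have FG : ae_eq nu setT (fun u : RR => HF (W ^~ w : @pathT R, u)) (fun u : RR => HG (B ^~ w : @pathT R, u)).
    apply: filterS nu_gt0 => u u0 _; apply: (congr1 EFin).
    have FGu : S (fun s => F s (W ^~ w, u)) = S (fun s => G s (B ^~ w, u)).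
      by apply: (path_sigma_algebra_eq mS) => s s0; exact: FW.
    exact: (indic_congr _ FGu).
  exact: (@ge0_ae_eq_integral _ RR R nu setT _ _ measurableT (mHFs _) (mHGs _)
    (fun u _ => HF0 _) (fun u _ => HG0 _) FG).
rewrite -(indep mB B_gam_indep mHG HG0) -(probE B G)//.
rewrite -law_reversed_process//; congr (P _); apply/seteqP.
by split => w /=; rewrite (path_sigma_algebra_eq mS (fun s s0 => GB w s0)).
Qed.

(** The total mass of [W] is almost surely [(2 * gam)^-1], hence finite. Boundedness of [path_A] at
    integer times is an event of path space, so it carries over to [Y] by equality of laws. *)
Lemma ae_A_infty_fin_num : {ae P, forall w, A_infty (Y ^~ w) \is a fin_num}.
Proof.
pose S : set (R -> R) := [set phi | exists K : nat, forall n : nat, path_A n%:R phi <= K%:R].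
have mS : path_sigma_algebra (~` S).
  rewrite (_ : S = \bigcup_(K : nat) \bigcap_(n : nat)
      ((fun phi : @pathT R => path_A n%:R phi) @^-1` `]-oo, K%:R])); last first.
    apply/seteqP; split => phi /=.
      by move=> [K HK]; exists K => // n _ /=; rewrite in_itv/= HK.
    by move=> [K _ HK]; exists K => n; have := HK n I; rewrite /= in_itv.
  apply: (@measurableC _ (@pathT R)).
  apply: (@bigcupT_measurable _ (@pathT R)) => K.
  apply: (@bigcapT_measurable _ (@pathT R)) => n.
  rewrite -[X in measurable X]setTI.
  apply: (measurable_path_A (T := @pathT R) (X := fun s phi => (phi : R -> R) s) (ler0n R n)) => //.
  exact: measurable_path_eval.
exists [set w | (~` S) (Y ^~ w)]; split.
- exact: measurable_path_set.
- rewrite -law_reversed_process//; apply/negligibleP; first exact: measurable_path_set.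
  apply: negligibleS ae_W => w /= nS [g0 cW AW]; apply: nS.
  exists (Num.truncn (2 * gam w)^-1).+1 => n; rewrite path_AE//.
  apply: ltW; apply: le_lt_trans (truncnS_gt _).
  by rewrite -lee_fin -AW; exact: A_le_A_infty.
- move=> w /= nf [K HK]; apply: nf; apply: (A_infty_fin_num (K := K%:R)) => // n.
  by rewrite -path_AE.
Qed.

Let Ainf w := fine (A_infty (Y ^~ w)).
Let V s w := Y s w - ln (1 + A_ (Y ^~ w) s * (2 * gam w - 1 / Ainf w)).
Let U s w := Tstar (ln (2 * gam w * Ainf w)) (Y ^~ w) s.

Let mA s : 0 <= s -> measurable_fun setT (fun w => A_ (Y ^~ w) s).
Proof. exact: measurable_A. Qed.

Let mAinf : measurable_fun setT Ainf.
Proof.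
rewrite (_ : Ainf = fun w => path_A_infty (Y ^~ w)); first exact: measurable_path_A_infty.
by apply/funext => w; rewrite path_A_inftyE.
Qed.

Let mVU s : 0 <= s -> measurable_fun setT (V s) /\ measurable_fun setT (U s).
Proof.
move=> s0; have m1 := mY s0; have m2 := mA s0; have m3 := measurable_inv mAinf.
have m4 := mAinf; have m5 : measurable_fun setT (gam : T -> R) := measurable_funPT gam.
by split; rewrite /V /U /Tstar; measurability.
Qed.

Let continuous_V w : 0 < gam w -> continuous_path (V ^~ w).
Proof.
move=> g0; have g20 : 0 < 2 * gam w by rewrite mulr_gt0.
apply: continuous_path_sub_ln => //.
  rewrite (_ : (fun u => _) = fun u => 1 + (2 * gam w - 1 / Ainf w) * A_ (Y ^~ w) u).
    exact/continuous_path_affine/continuous_A_path.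
  by apply/funext => u; rewrite mulrC.
by move=> u u0; exact: one_add_A_gt0.
Qed.

(** The exponential undoes the logarithm only if [2 * gam w * Ainf w > 0]. This fails at infinite
    total mass, where [fine] returns [0], so the two forms are identified almost surely only. *)
Let ae_UV : {ae P, forall w, U ^~ w = V ^~ w}.
Proof.
apply: filterS2 gam_gt0 ae_A_infty_fin_num => w g0 fA; apply/funext => s.
have a0 : 0 < Ainf w by rewrite -lte_fin fineK//; exact: A_infty_gt0.
rewrite /U /V /Tstar lnK ?posrE ?mulr_gt0//; congr (_ - ln (1 + _)).
by rewrite -/(Ainf w); field; rewrite gt_eqF.
Qed.

Lemma eq_in_law_path_transform : eq_in_law P P V Y.
Proof.
split.
- split; first by move=> s /mVU[].
  by apply: filterS gam_gt0 => w; exact: continuous_V.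
- by split => //; apply: aeW.
move=> S mS; rewrite -law_path_transform//; congr (P _); apply/seteqP.
have e w s : 0 <= s -> V s w = F s (Y ^~ w, gam w).
  by move=> s0; rewrite /V /F/= path_AE// path_A_inftyE.
by split => w /=; rewrite (path_sigma_algebra_eq mS (@e w)).
Qed.

Lemma eq_in_law_Tstar : eq_in_law P P U Y.
Proof.
have [_ cYp lawV] := eq_in_law_path_transform.
split => //.
- split; first by move=> s /mVU[].
  by apply: filterS2 gam_gt0 ae_UV => w g0 ->; exact: continuous_V.
move=> S mS; rewrite -lawV//; apply: ae_eq_measure.
- by apply: measurable_path_set => // s /mVU[].
- by apply: measurable_path_set => // s /mVU[].
by apply: filterS ae_UV => w /= ->.
Qed.

End final.

Theorem proposition4p1 (R : realType) (d : measure_display)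
    (T : measurableType d) (P : probability T R) (mu : R)
    (B : R -> T -> R) (gam : {RV P >-> R})
    (mu_gt0 : 0 < mu)
    (B_bm : brownian_motion P B)
    (gam_law : gamma_rv mu gam)
    (B_gam_indep : process_rv_independent B gam) :
  let Bmu := drifted mu B in
  let Ainf := fun w : T => fine (A_infty (Bmu ^~ w)) in
  eq_in_law P P
    (fun s w => Tstar (ln (2 * gam w * Ainf w)) (Bmu ^~ w) s)
    Bmu
  /\
  eq_in_law P P
    (fun s w => Bmu s w - ln (1 + A_ (Bmu ^~ w) s * (2 * gam w - 1 / Ainf w)))
    Bmu.
Proof.
by split; [exact: eq_in_law_Tstar|exact: eq_in_law_path_transform].
Qed.
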